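(* Let $\Gamma$ be a countable discrete group and let $A$ be a finite abelian group. Assume the following conditions: (i) $\Gamma$ is residually finite and of finite type; (ii) $\Gamma$ satisfies a cosystolic inequality in dimension $2$ with respect to the family of all finite transitive $\Gamma$-actions and $A$; (iii) there exists a central extension $1 \to A \to \tilde\Gamma \to \Gamma \to 1$ of $\Gamma$ by $A$ such that $\tilde\Gamma$ is not residually finite. Then the following implication holds: if $\Gamma$ is stable in finite actions, then the group $\tilde\Gamma$ is not sofic.
   Context: **Measured Boolean algebras.** A measured Boolean algebra $(\mathrm P,\mu)$ is a Boolean algebra $(\mathrm P,\cap,\cup,\neg,0,1)$ with a map $\mu\colon \mathrm P\to[0,1]$ such that $\mu(X\cup Y)+\mu(X\cap Y)=\mu(X)+\mu(Y)$, $\mu(0)=0$, $\mu(1)=1$. Put $d(X,Y)=\mu(X\cup Y)-\mu(X\cap Y)$. A measured $\Gamma$-Boolean algebra is a measured Boolean algebra with a measure-preserving action of $\Gamma$ by Boolean automorphisms. A finite action is a finite measured $\Gamma$-Boolean algebra; a finite transitive action is the algebra $\mathrm P^{\Gamma/\Lambda}$ of all subsets of $\Gamma/\Lambda$, with normalized counting measure, for a finite-index subgroup $\Lambda\le\Gamma$. **$A$-valued functions.** For a finite abelian group $A$, $\mathrm P(A)$ is the abelian group generated by symbols $X\otimes a$ ($X\in\mathrm P$, $a\in A$) subject to $X\otimes a+Y\otimes b=(X\setminus Y)\otimes a+(Y\setminus X)\otimes b+(X\cap Y)\otimes(a+b)$. Every $x\in\mathrm P(A)$ is uniquely of the form $x=\sum_{a\ne0}X_a\otimes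 a$ with the $X_a$ pairwise disjoint; put $\mu(x)=\sum_{a\neq 0}\mu(X_a)$. If $\mathrm P$ is a measured $\Gamma$-Boolean algebra, $\mathrm P(A)$ is a $\mathbb Z[\Gamma]$-module. **Cohomology norms.** $\Gamma$ is of finite type if it has a finite classifying space $B\Gamma=E\Gamma/\Gamma$, where $E\Gamma$ is a contractible simplicial complex with free simplicial $\Gamma$-action. Fix such a finite model, and faithful probability measures $\nu_i$ on the finite sets $B\Gamma(i)$ of $i$-simplices. Put $\mathrm C^i(B\Gamma,\mathrm P(A))=\hom_{\mathbb Z\Gamma}(\mathrm C_i(E\Gamma),\mathrm P(A))$, and for a cochain $c$ put $\|c\|_i=\sum_{x\in B\Gamma(i)}\mu(c(\tilde x))\nu_i(x)$, where $\tilde x\in E\Gamma(i)$ is any lift of $x$. For $\alpha\in\mathrm H^i(B\Gamma,\mathrm P(A))$ let $|||\alpha|||_i$ be the infimum of $\|c\|_i$ over cocycles $c$ representing $\alpha$. **Cosystolic inequality.** $\Gamma$ satisfies a cosystolic inequality in dimension $i$ with respect to a family $\mathcal P$ of measured $\Gamma$-Boolean algebras and $A$ if there is $\varepsilon>0$ with $|||\alpha|||_i\ge\varepsilon$ for all nonzero $\alpha\in\mathrm H^i(B\Gamma,\mathrm P(A))$ and all $(\mathrm P,\mu)\in\mathcal P$. (This does not depend on the choice of the model and of the measures $\nu_i$.) **Ultraproducts and weak containment.** For measured $\Gamma$-Boolean algebras $(\mathrm P_j,\mu_j)_{j\in I}$ and a non-principal ultrafilter $\mathcal U$ on $I$, the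 metric ultraproduct is $\mathrm P_{\mathcal U}=\prod_j\mathrm P_j/\sim$, where $(X_j)\sim(Y_j)$ iff $\lim_{j\to\mathcal U}d_j(X_j,Y_j)=0$, with measure $\mu_{\mathcal U}([X_j]_j)=\lim_{j\to\mathcal U}\mu_j(X_j)$ and the induced $\Gamma$-action. $(\mathrm P,\mu)$ is contained in $(\mathrm Q,\nu)$ if there is a measure-preserving $\Gamma$-equivariant homomorphism of Boolean algebras $\mathrm P\to\mathrm Q$. It is weakly contained in a family if it is contained in a metric ultraproduct of members of the family. **Soficity and stability.** For $\sigma,\tau\in\mathrm{Sym}(n)$ let $d_n(\sigma,\tau)=\frac1n|\{i:\sigma(i)\ne\tau(i)\}|$. A sofic approximation of a countable group $\Gamma$ is a sequence of maps $\sigma_n\colon\Gamma\to\mathrm{Sym}(k_n)$ with $d_{k_n}(\sigma_n(gh),\sigma_n(g)\sigma_n(h))\to0$ for all $g,h\in\Gamma$ and $d_{k_n}(1,\sigma_n(g))\to1$ for all $g\neq1$. (For a finitely presented group, one may equivalently use homomorphisms from a finitely generated free group $\mathrm F\to \Gamma$ that asymptotically kill the finitely many relators and become asymptotically free on elements outside the kernel.) A group is sofic if it has a sofic approximation. Given a non-principal ultrafilter $\mathcal U$ on $\mathbb N$, the limit action of a sofic approximation is the metric ultraproduct of the algebras of subsets of $\{1,\dots,k_n\}$ with normalized counting measure, with the $\Gamma$-action induced by the $\sigma_n$. $\Gamma$ is stable in finite actions if the limit action of any sofic approximation of $\Gamma$ is weakly contained in the family of finite $\Gamma$-actions. *)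

(* Defs.v *)
From HB Require Import structures.
From mathcomp Require Import freeg.
From mathcomp Require Import all_boot all_order all_fingroup all_algebra.
From mathcomp Require Import generic_quotient ring_quotient finmap.
From mathcomp Require Import all_classical all_reals all_analysis.
From mathcomp Require Import lra.

Set Implicit Arguments.
Unset Strict Implicit.
Unset Printing Implicit Defensive.

Import Order.Theory GRing.Theory Num.Theory.
Import numFieldNormedType.Exports.

Local Open Scope classical_set_scope.
Local Open Scope ring_scope.
Local Open Scope quotient_scope.

Record measured_alg (R : realType) := MeasuredAlg {
  malg_disp : Order.disp_t;
  malg_sort :> ctbDistrLatticeType malg_disp;
  mu : malg_sort -> R;
  mu_ge0 : forall x, 0 <= mu x;
  mu_le1 : forall x, mu x <= 1;
  mu_modular : forall x y,
    mu (x `|` y)%O + mu (x `&` y)%O = mu x + mu y;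
  mu_bot : mu \bot%O = 0;
  mu_top : mu \top%O = 1
}.

Definition mdist (R : realType) (P : measured_alg R) (x y : P) : R :=
  mu (x `|` y)%O - mu (x `&` y)%O.

(* The library's [{tblmorphism _ -> _}] only asks that bottom and top be
   preserved, not meets and joins. *)
Record measured_hom (R : realType) (P Q : measured_alg R) := MeasuredHom {
  mhom_fun :> P -> Q;
  mhomI : Order.meet_morphism mhom_fun;
  mhomU : Order.join_morphism mhom_fun;
  mhom_bot : mhom_fun \bot%O = \bot%O;
  mhom_top : mhom_fun \top%O = \top%O;
  mhom_mu : forall x, mu (mhom_fun x) = mu x
}.

Section MeasureTheory.
Context (R : realType) (P : measured_alg R).
Implicit Types x y z : P.

Lemma mu_disjoint x y :
  (x `&` y)%O = \bot%O -> mu (x `|` y)%O = mu x + mu y.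
Proof. by move=> xy; rewrite -mu_modular xy mu_bot addr0. Qed.

Lemma le_mu x y : (x <= y)%O -> mu x <= mu y.
Proof.
move=> /leBKU <-; rewrite mu_disjoint ?diffKI// lerDl; exact: mu_ge0.
Qed.

Lemma mu_subadd x y : mu (x `|` y)%O <= mu x + mu y.
Proof. by rewrite -mu_modular lerDl mu_ge0. Qed.

Lemma mdistE x y : mdist x y = mu (x `\` y)%O + mu (y `\` x)%O.
Proof.
have h (u v : P) : mu u = mu (u `&` v)%O + mu (u `\` v)%O.
  rewrite -[in LHS](joinIB v u) mu_disjoint//; exact: meetIB.
have := mu_modular x y; have := h x y; have := h y x.
rewrite (meetC y x) /mdist; lra.
Qed.

Lemma mdist_ge0 x y : 0 <= mdist x y.
Proof. by rewrite mdistE addr_ge0// mu_ge0. Qed.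

Lemma mdistxx x : mdist x x = 0.
Proof. by rewrite /mdist joinxx meetxx subrr. Qed.

Lemma mdistC x y : mdist x y = mdist y x.
Proof. by rewrite !mdistE addrC. Qed.

Lemma mu_diff_le x y z t u :
  (x `\` y <= (z `\` t) `|` u)%O -> mu (x `\` y)%O <= mu (z `\` t)%O + mu u.
Proof. by move=> h; apply: le_trans (le_mu h) (mu_subadd _ _). Qed.

Lemma mdist_triangle y x z : mdist x z <= mdist x y + mdist y z.
Proof.
have h (u v w : P) : (u `\` w <= (u `\` v) `|` (v `\` w))%O.
  have uv : (u <= v `|` (u `\` v))%O by rewrite -leBLR.
  have vw : (v <= w `|` (v `\` w))%O by rewrite -leBLR.
  by rewrite leBLR joinCA; apply: le_trans uv _; rewrite joinC leU2.
have := mu_diff_le (h x y z); have := mu_diff_le (h z y x).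
rewrite !mdistE; lra.
Qed.

Lemma mdistU x y x' y' :
  mdist (x `|` x')%O (y `|` y')%O <= mdist x y + mdist x' y'.
Proof.
have h (u v u' v' : P) : ((u `|` u') `\` (v `|` v') <= (u `\` v) `|` (u' `\` v'))%O.
  have uv : (u <= v `|` (u `\` v))%O by rewrite -leBLR.
  have uv' : (u' <= v' `|` (u' `\` v'))%O by rewrite -leBLR.
  by rewrite leBLR joinACA leU2.
have := mu_diff_le (h x y x' y'); have := mu_diff_le (h y x y' x').
rewrite !mdistE; lra.
Qed.

Lemma mdist_compl x y : mdist (~` x)%O (~` y)%O = mdist x y.
Proof.
have h (u v : P) : (~` u `\` ~` v)%O = (v `\` u)%O.
  by rewrite !diffE complK meetC.
by rewrite !mdistE !h addrC.
Qed.

Lemma mdistI x y x' y' :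
  mdist (x `&` x')%O (y `&` y')%O <= mdist x y + mdist x' y'.
Proof.
rewrite -(complK (x `&` x')%O) -(complK (y `&` y')%O) mdist_compl !complI.
by rewrite -(mdist_compl x) -(mdist_compl x') mdistU.
Qed.

Lemma mu_mdist x y : `|mu x - mu y| <= mdist x y.
Proof.
have h (u v : P) : mu u = mu (u `&` v)%O + mu (u `\` v)%O.
  rewrite -[in LHS](joinIB v u) mu_disjoint//; exact: meetIB.
have := h x y; have := h y x; rewrite (meetC y x) mdistE ler_norml.
have := mu_ge0 (x `\` y)%O; have := mu_ge0 (y `\` x)%O.
move=> *; apply/andP; split; lra.
Qed.
End MeasureTheory.

Lemma mhom_mdist (R : realType) (P Q : measured_alg R) (f : measured_hom P Q) x y :
  mdist (f x) (f y) = mdist x y.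
Proof. by rewrite /mdist -mhomI -mhomU !mhom_mu. Qed.

Definition nonprincipal (I : Type) (U : set_system I) : Prop :=
  forall i, ~ U [set i].

Lemma ultra_cvg_bounded (R : realType) (I : Type) (U : set_system I) {UU : UltraFilter U}
    (u : I -> R) (a b : R) :
  (forall i, a <= u i <= b) -> cvg (u @ U).
Proof.
move=> uab.
have [p [_ pcl]] : `[a, b] `&` cluster (u @ U) !=set0.
  apply: (@segment_compact R a b (u @ U)).
  by apply: (@filterE _ U) => i /=; rewrite in_itv/= uab.
apply/cvg_ex; exists p => B Bp.
have [//|UB] := in_ultra_setVsetC (u @^-1` B) UU.
by have [x []] := pcl (~` B) B UB Bp.
Qed.

Lemma ultra_mu_cvg (R : realType) (I : Type) (U : set_system I) {UU : UltraFilter U}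
    (P : I -> measured_alg R) (x : forall i, P i) : cvg (mu (x i) @[i --> U]).
Proof. by apply: (@ultra_cvg_bounded _ _ _ _ _ 0 1) => i; rewrite mu_ge0 mu_le1. Qed.

Section Ultraproduct.
Context (R : realType) (I : Type) (U : set_system I) (UU : UltraFilter U).
Context (P : I -> measured_alg R).

Definition uprod_base := forall i, P i.

HB.instance Definition _ := Choice.on uprod_base.

Implicit Types x y z : uprod_base.

Definition ueq x y : bool := `[< mdist (x i) (y i) @[i --> U] --> (0 : R) >].

Lemma ueq_squeeze (u v : I -> R) : (forall i, 0 <= u i <= v i) ->
  v @ U --> (0 : R) -> u @ U --> (0 : R).
Proof.
move=> uv v0; apply: (@squeeze_cvgr _ _ _ _ (cst 0) v) => //; last exact: cvg_cst.
by apply: filterE => i.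
Qed.

Lemma ueq_equiv : equiv_class_of ueq.
Proof.
split.
- move=> x; apply/asboolP; under eq_cvg do rewrite mdistxx; exact: cvg_cst.
- by move=> x y; congr asbool; under eq_fun do rewrite mdistC.
- move=> y x z /asboolP xy /asboolP yz; apply/asboolP.
  apply: (@ueq_squeeze _ (fun i => mdist (x i) (y i) + mdist (y i) (z i))).
    by move=> i; rewrite mdist_ge0 mdist_triangle.
  by rewrite -(addr0 0); exact: cvgD.
Qed.
Canonical ueq_equiv_rel := EquivRelPack ueq_equiv.
Canonical ueq_encModRel := defaultEncModRel ueq.

Definition uprod_type := {eq_quot ueq}.
HB.instance Definition _ : EqQuotient _ ueq uprod_type := EqQuotient.on uprod_type.
HB.instance Definition _ := Choice.on uprod_type.


Notation "[u x ]" := (\pi_uprod_type x) (at level 0, format "[u  x ]").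

Lemma upiP x y : [u x] = [u y] <-> mdist (x i) (y i) @[i --> U] --> (0 : R).
Proof. by split=> [/eqmodP/asboolP//|?]; apply/eqmodP/asboolP. Qed.

Lemma repr_upi x : mdist (repr [u x] i) (x i) @[i --> U] --> (0 : R).
Proof. by apply/upiP; rewrite reprK. Qed.

Lemma upi_ind (Q : uprod_type -> Prop) : (forall x, Q [u x]) -> forall a, Q a.
Proof. by move=> Qu a; rewrite -[a]reprK. Qed.

Lemma upi_ext x y : (forall i, x i = y i) -> [u x] = [u y].
Proof. by move=> xy; congr \pi; exact: functional_extensionality_dep. Qed.

Definition ujoin (a b : uprod_type) : uprod_type :=
  [u fun i => (repr a i `|` repr b i)%O].
Definition umeet (a b : uprod_type) : uprod_type :=
  [u fun i => (repr a i `&` repr b i)%O].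
Definition ucompl (a : uprod_type) : uprod_type := [u fun i => (~` repr a i)%O].
Definition ubot : uprod_type := [u fun i => \bot%O].
Definition utop : uprod_type := [u fun i => \top%O].
Definition ule (a b : uprod_type) : bool := umeet a b == a.
Definition ult (a b : uprod_type) : bool := (b != a) && ule a b.

Lemma ujoinE x y : ujoin [u x] [u y] = [u fun i => (x i `|` y i)%O].
Proof.
apply/upiP; apply: (@ueq_squeeze _
  (fun i => mdist (repr [u x] i) (x i) + mdist (repr [u y] i) (y i))).
  by move=> i; rewrite mdist_ge0 mdistU.
by rewrite -(addr0 0); apply: cvgD (repr_upi x) (repr_upi y).
Qed.

Lemma umeetE x y : umeet [u x] [u y] = [u fun i => (x i `&` y i)%O].
Proof.
apply/upiP; apply: (@ueq_squeeze _
  (fun i => mdist (repr [u x] i) (x i) + mdist (repr [u y] i) (y i))).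
  by move=> i; rewrite mdist_ge0 mdistI.
by rewrite -(addr0 0); apply: cvgD (repr_upi x) (repr_upi y).
Qed.

Lemma ucomplE x : ucompl [u x] = [u fun i => (~` x i)%O].
Proof.
apply/upiP; apply: ueq_squeeze (repr_upi x) => i.
by rewrite mdist_ge0 mdist_compl lexx.
Qed.

Definition uopE := (ujoinE, umeetE, ucomplE).

Lemma umeetC : commutative umeet.
Proof.
elim/upi_ind=> x; elim/upi_ind=> y; rewrite !uopE.
by apply: upi_ext => i; rewrite meetC.
Qed.
Lemma ujoinC : commutative ujoin.
Proof.
elim/upi_ind=> x; elim/upi_ind=> y; rewrite !uopE.
by apply: upi_ext => i; rewrite joinC.
Qed.
Lemma umeetA : associative umeet.
Proof.
elim/upi_ind=> x; elim/upi_ind=> y; elim/upi_ind=> z; rewrite !uopE.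
by apply: upi_ext => i; rewrite meetA.
Qed.
Lemma ujoinA : associative ujoin.
Proof.
elim/upi_ind=> x; elim/upi_ind=> y; elim/upi_ind=> z; rewrite !uopE.
by apply: upi_ext => i; rewrite joinA.
Qed.
Lemma ujoinKI b a : umeet a (ujoin a b) = a.
Proof.
elim/upi_ind: a => x; elim/upi_ind: b => y; rewrite !uopE.
by apply: upi_ext => i; rewrite joinKI.
Qed.
Lemma umeetKU b a : ujoin a (umeet a b) = a.
Proof.
elim/upi_ind: a => x; elim/upi_ind: b => y; rewrite !uopE.
by apply: upi_ext => i; rewrite meetKU.
Qed.
Lemma umeetUl : left_distributive umeet ujoin.
Proof.
elim/upi_ind=> x; elim/upi_ind=> y; elim/upi_ind=> z; rewrite !uopE.
by apply: upi_ext => i; rewrite meetUl.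
Qed.
Lemma umeetxx : idempotent_op umeet.
Proof.
elim/upi_ind=> x; rewrite !uopE.
by apply: upi_ext => i; rewrite meetxx.
Qed.

Fact uprod_display : Order.disp_t. Proof. exact: Order.Disp tt tt. Qed.

HB.instance Definition _ := Order.isMeetJoinDistrLattice.Build
  uprod_display uprod_type (fun _ _ => erefl) (fun _ _ => erefl)
  umeetC ujoinC umeetA ujoinA ujoinKI umeetKU umeetUl umeetxx.

Lemma ule0x (a : uprod_type) : (ubot <= a)%O.
Proof.
elim/upi_ind: a => x; apply/eqP; rewrite [LHS]umeetE.
by apply: upi_ext => i; rewrite meet0x.
Qed.
HB.instance Definition _ := Order.hasBottom.Build uprod_display uprod_type ule0x.

Lemma ulex1 (a : uprod_type) : (a <= utop)%O.
Proof.
elim/upi_ind: a => x; apply/eqP; rewrite [LHS]umeetE.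
by apply: upi_ext => i; rewrite meetx1.
Qed.
HB.instance Definition _ := Order.hasTop.Build uprod_display uprod_type ulex1.

Lemma ujoinxC (a : uprod_type) : (a `|` ucompl a = \top)%O.
Proof.
elim/upi_ind: a => x; rewrite ucomplE [LHS]ujoinE.
by apply: upi_ext => i; rewrite joinxC.
Qed.
Lemma umeetxC (a : uprod_type) : (a `&` ucompl a = \bot)%O.
Proof.
elim/upi_ind: a => x; rewrite ucomplE [LHS]umeetE.
by apply: upi_ext => i; rewrite meetxC.
Qed.
HB.instance Definition _ := Order.TBDistrLattice_hasComplement.Build
  uprod_display uprod_type ujoinxC umeetxC.

Definition umu (a : uprod_type) : R := lim (mu (repr a i) @[i --> U]).

Lemma umu_cvg x : mu (x i) @[i --> U] --> umu [u x].
Proof.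
rewrite /umu; set a := [u x].
have h : (mu (x i) - mu (repr a i)) @[i --> U] --> (0 : R).
  apply/cvgr0Pnorm_le => /=; rewrite /= => e e0.
  have /cvgr0Pnorm_le/(_ e e0) := repr_upi x.
  apply: filterS => i; apply: le_trans; rewrite -/a (ger0_norm (mdist_ge0 _ _)).
  by rewrite distrC mu_mdist.
have := cvgD h (@ultra_mu_cvg R I U UU P (repr a)).
rewrite add0r => h2.
have -> : (fun i => mu (x i)) = (fun i => mu (x i) - mu (repr a i) + mu (repr a i)).
  by apply/funext => i; rewrite subrK.
exact: h2.
Qed.

Lemma umuE x : umu [u x] = lim (mu (x i) @[i --> U]).
Proof. by apply/esym/cvg_lim => //; exact: umu_cvg. Qed.

Lemma umu_ge0 a : 0 <= umu a.
Proof.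
elim/upi_ind: a => x; rewrite umuE; apply: limr_ge; first exact: ultra_mu_cvg.
by apply: filterE => i; exact: mu_ge0.
Qed.
Lemma umu_le1 a : umu a <= 1.
Proof.
elim/upi_ind: a => x; rewrite umuE; apply: limr_le; first exact: ultra_mu_cvg.
by apply: filterE => i; exact: mu_le1.
Qed.
Lemma umu_modular (a b : uprod_type) :
  umu (a `|` b)%O + umu (a `&` b)%O = umu a + umu b.
Proof.
elim/upi_ind: a => x; elim/upi_ind: b => y.
rewrite [X in umu X + _]ujoinE [X in _ + umu X]umeetE.
rewrite !umuE -!limD; do ?exact: ultra_mu_cvg.
congr (lim (_ @ U)); apply/funext => i; exact: mu_modular.
Qed.
Lemma umu_bot : umu \bot%O = 0.
Proof.
rewrite [LHS]umuE; apply/cvg_lim => //.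
by under eq_cvg do rewrite mu_bot; exact: cvg_cst.
Qed.
Lemma umu_top : umu \top%O = 1.
Proof.
rewrite [LHS]umuE; apply/cvg_lim => //.
by under eq_cvg do rewrite mu_top; exact: cvg_cst.
Qed.

Definition uprod : measured_alg R := @MeasuredAlg R uprod_display uprod_type
  umu umu_ge0 umu_le1 umu_modular umu_bot umu_top.

End Ultraproduct.

Section UltraproductMap.
Context (R : realType) (I : Type) (U : set_system I) (UU : UltraFilter U).
Context (P Q : I -> measured_alg R) (f : forall i, measured_hom (P i) (Q i)).

Definition umap (a : uprod UU P) : uprod UU Q :=
  \pi_(uprod_type UU Q) (fun i => f i (repr a i)).

Lemma umapE (x : uprod_base P) :
  umap (\pi_(uprod_type UU P) x) = \pi_(uprod_type UU Q) (fun i => f i (x i)).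
Proof.
apply/upiP; apply: ueq_squeeze (repr_upi UU x) => i.
by rewrite mdist_ge0 mhom_mdist lexx.
Qed.

Lemma umapI : Order.meet_morphism umap.
Proof.
elim/upi_ind=> x; elim/upi_ind=> y.
rewrite [X in umap X]umeetE !umapE [RHS]umeetE.
by apply: upi_ext => i; rewrite mhomI.
Qed.

Lemma umapU : Order.join_morphism umap.
Proof.
elim/upi_ind=> x; elim/upi_ind=> y.
rewrite [X in umap X]ujoinE !umapE [RHS]ujoinE.
by apply: upi_ext => i; rewrite mhomU.
Qed.

Lemma umap_bot : umap \bot%O = \bot%O.
Proof. by rewrite [LHS]umapE; apply: upi_ext => i; rewrite mhom_bot. Qed.

Lemma umap_top : umap \top%O = \top%O.
Proof. by rewrite [LHS]umapE; apply: upi_ext => i; rewrite mhom_top. Qed.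

Lemma umap_mu a : mu (umap a) = mu a.
Proof.
elim/upi_ind: a => x; rewrite umapE /= !umuE.
by congr (lim (_ @ U)); apply/funext => i; rewrite mhom_mu.
Qed.

Definition uprod_hom : measured_hom (uprod UU P) (uprod UU Q) :=
  MeasuredHom umapI umapU umap_bot umap_top umap_mu.

End UltraproductMap.

Record measured_galg (R : realType) (G : groupType) := MeasuredGAlg {
  galg_alg :> measured_alg R;
  gact : G -> measured_hom galg_alg galg_alg;
  gact1 : forall x, gact 1%g x = x;
  gactM : forall g h x, gact (g * h)%g x = gact g (gact h x)
}.

Section UltraproductAction.
Context (R : realType) (G : groupType) (I : Type).
Context (U : set_system I) (UU : UltraFilter U) (P : I -> measured_galg R G).

Definition uprod_act (g : G) : measured_hom (uprod UU P) (uprod UU P) :=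
  uprod_hom UU (fun i => gact (P i) g).

Lemma uprod_act1 a : uprod_act 1%g a = a.
Proof.
by elim/upi_ind: a => x; rewrite [LHS]umapE; apply: upi_ext => i; rewrite gact1.
Qed.

Lemma uprod_actM g h a : uprod_act (g * h)%g a = uprod_act g (uprod_act h a).
Proof.
elim/upi_ind: a => x; rewrite [LHS]umapE [X in uprod_act g X]umapE [RHS]umapE.
by apply: upi_ext => i; rewrite gactM.
Qed.

Definition uprod_galg : measured_galg R G :=
  MeasuredGAlg uprod_act1 uprod_actM.
End UltraproductAction.

Definition contained (R : realType) (G : groupType) (P Q : measured_galg R G) :=
  exists f : measured_hom P Q, forall g x, f (gact P g x) = gact Q g (f x).

Definition weakly_contained (R : realType) (G : groupType)
    (P : measured_galg R G) (F : measured_galg R G -> Prop) : Prop :=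
  exists (I : Type) (U : set_system I) (UU : UltraFilter U)
         (Q : I -> measured_galg R G),
    [/\ nonprincipal U, forall i, F (Q i) & contained P (uprod_galg UU Q)].

Section Subsets.
Context (R : realType) (T : choiceType).
Hypotheses (Tfin : finite_set [set: T]) (T0 : [set: T] !=set0).

Definition count_mu (X : set T) : R :=
  #|` fset_set X|%:R / #|` fset_set [set: T]|%:R.

Let finT (X : set T) : finite_set X.
Proof. exact: sub_finite_set Tfin. Qed.

Let cardT_gt0 : (0 : R) < #|` fset_set [set: T]|%:R.
Proof.
rewrite ltr0n cardfs_gt0; apply/fset0Pn; have [x _] := T0; exists x.
by rewrite in_fset_set// inE.
Qed.

Let card_le (X Y : set T) : X `<=` Y -> (#|` fset_set X| <= #|` fset_set Y|)%N.
Proof.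
by move=> XY; apply/fsubset_leq_card/fsubsetP => x; rewrite !in_fset_set// !inE; exact: XY.
Qed.

Lemma count_mu_ge0 X : 0 <= count_mu X.
Proof. by rewrite divr_ge0. Qed.

Lemma count_mu_le1 X : count_mu X <= 1.
Proof. by rewrite ler_pdivrMr// mul1r ler_nat card_le. Qed.

Lemma count_mu_modular X Y :
  count_mu (X `|` Y)%O + count_mu (X `&` Y)%O = count_mu X + count_mu Y.
Proof.
rewrite /count_mu -!mulrDl -!natrD; congr (_%:R / _).
by rewrite [fset_set (_ `|` _)%O]fset_setU// [fset_set (_ `&` _)%O]fset_setI// cardfsUI.
Qed.

Lemma count_mu_bot : count_mu \bot%O = 0.
Proof. by rewrite /count_mu [fset_set \bot%O]fset_set0 cardfs0 mul0r. Qed.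

Lemma count_mu_top : count_mu \top%O = 1.
Proof. by rewrite /count_mu divff// gt_eqF. Qed.

Definition subset_alg : measured_alg R := @MeasuredAlg R _ (set T : ctbDistrLatticeType _)
  count_mu count_mu_ge0 count_mu_le1 count_mu_modular count_mu_bot count_mu_top.

Section Image.
Variables (s : T -> T) (s_bij : bijective s).

Let s_inj : injective s. Proof. exact: bij_inj. Qed.

Let im (X : subset_alg) : subset_alg := (s @` (X : set T)).

Lemma image_meet : Order.meet_morphism im.
Proof.
move=> X Y; apply/seteqP; split=> [_ [x [Xx Yx] <-]|_ [[x Xx <-] [y Yy /s_inj yx]]].
  by split; exists x.
by exists x => //; split=> //; rewrite -yx.
Qed.

Lemma image_join : Order.join_morphism im.
Proof. move=> X Y; exact: image_setU. Qed.

Lemma image_bot : im \bot%O = \bot%O.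
Proof. exact: image_set0. Qed.

Lemma image_top : im \top%O = \top%O.
Proof.
have [t st ts] := s_bij; apply/seteqP; split=> // x _; by exists (t x).
Qed.

Lemma image_mu X : mu (im X) = mu X.
Proof.
congr (_%:R / _); rewrite fset_set_image//; exact: card_imfset.
Qed.

Definition image_hom : measured_hom subset_alg subset_alg :=
  MeasuredHom image_meet image_join image_bot image_top image_mu.
End Image.

Lemma image_mdist (s t : T -> T) (sb : bijective s) (tb : bijective t)
    (X : subset_alg) :
  mdist (image_hom sb X) (image_hom tb X) <= 2 * count_mu [set x | s x != t x].
Proof.
have h (u v : T -> T) : bijective u ->
    count_mu ((u @` (X : set T)) `\` (v @` (X : set T))) <= count_mu [set x | u x != v x].
  move=> ub; rewrite ler_pM2r ?invr_gt0// ler_nat.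
  apply: (@leq_trans #|` fset_set (u @` [set x | u x != v x])|).
    apply: card_le => _ [[x Xx <-]] /= nv; exists x => //=.
    by apply/eqP => uv; apply: nv; exists x.
  by rewrite fset_set_image// card_imfset//; exact: bij_inj.
have h1 := h s t sb; have h2 := h t s tb.
have e : [set x | t x != s x] = [set x | s x != t x].
  by apply/seteqP; split=> x /=; rewrite eq_sym.
rewrite e in h2; rewrite mdistE mulr2n mulrDl mul1r; exact: lerD.
Qed.
End Subsets.

(* [coset_rel x y] means that xL = yL, so that [cosets] is G/L with the action
   of G by left translation. *)
Section Cosets.
Context (G : groupType) (L : groupClosed G).

Definition coset_rel (x y : G) : bool := (x^-1 * y)%g \in L.

Lemma coset_rel_equiv : equiv_class_of coset_rel.
Proof.
rewrite /coset_rel; split=> [x|x y|y x z xy yz].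
- by rewrite mulVg gpred1.
- by rewrite -gpredV invMg invgK.
- by have := gpredM _ _ xy yz; rewrite mulgA mulgK.
Qed.
Canonical coset_rel_equiv_rel := EquivRelPack coset_rel_equiv.
Canonical coset_rel_encModRel := defaultEncModRel coset_rel.

Definition cosets := {eq_quot coset_rel}.
HB.instance Definition _ : EqQuotient _ coset_rel cosets := EqQuotient.on cosets.
HB.instance Definition _ := Choice.on cosets.

Definition coset_act (g : G) (c : cosets) : cosets := \pi_cosets (g * repr c)%g.

Lemma coset_actE g x : coset_act g (\pi_cosets x) = \pi_cosets (g * x)%g.
Proof.
have /eqmodP : \pi_cosets (repr (\pi_cosets x)) = \pi_cosets x by rewrite reprK.
by move=> h; apply/eqmodP; rewrite /= /coset_rel invMg -mulgA mulKg.
Qed.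

Lemma coset_act1 c : coset_act 1%g c = c.
Proof. by rewrite -[c]reprK coset_actE mul1g. Qed.

Lemma coset_actM g h c : coset_act (g * h)%g c = coset_act g (coset_act h c).
Proof.
rewrite -[c]reprK; set x := repr c.
by rewrite [coset_act h _]coset_actE [LHS]coset_actE [RHS]coset_actE mulgA.
Qed.

Lemma coset_act_bij g : bijective (coset_act g).
Proof.
exists (coset_act g^-1%g) => c; rewrite -coset_actM ?mulVg ?mulgV coset_act1 //.
Qed.

Lemma cosets_neq0 : [set: cosets] !=set0.
Proof. by exists (\pi_cosets 1%g). Qed.
End Cosets.

Record finite_index_subgroup (G : groupType) := FiniteIndexSubgroup {
  fis_subgroup :> groupClosed G;
  fis_finite : finite_set [set: cosets fis_subgroup]
}.

Section TransitiveAction.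
Context (R : realType) (G : groupType) (L : finite_index_subgroup G).

Definition coset_alg : measured_alg R :=
  subset_alg R (fis_finite L) (cosets_neq0 L).

Definition coset_hom (g : G) : measured_hom coset_alg coset_alg :=
  image_hom R (fis_finite L) (cosets_neq0 L) (coset_act_bij L g).

Lemma coset_hom1 X : coset_hom 1%g X = X.
Proof.
rewrite /= (_ : coset_act 1%g = id) ?image_id//.
by apply/funext => c; exact: coset_act1.
Qed.

Lemma coset_homM g h X : coset_hom (g * h)%g X = coset_hom g (coset_hom h X).
Proof.
rewrite /= [RHS]image_comp; congr (image X).
by apply/funext => c; exact: coset_actM.
Qed.

Definition coset_galg : measured_galg R G := MeasuredGAlg coset_hom1 coset_homM.
End TransitiveAction.

Definition finite_action (R : realType) (G : groupType)
    (P : measured_galg R G) : Prop := finite_set [set: P].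

Definition finite_transitive_action (R : realType) (G : groupType)
    (P : measured_galg R G) : Prop :=
  exists L : finite_index_subgroup G, P = coset_galg R L.

Definition hamming (R : realType) (n : nat) (s t : 'S_n) : R :=
  #|[pred i | s i != t i]|%:R / n%:R.

(* The product of permutations is composed from left to right, so that
   [(s * t)%g i = t (s i)]. *)
Record sofic_approximation (R : realType) (G : groupType) := SoficApprox {
  sa_deg : nat -> nat;
  sa_deg_gt0 : forall n, (0 < sa_deg n)%N;
  sa_map : forall n, G -> 'S_(sa_deg n);
  sa_mul : forall g h : G,
    hamming R (sa_map n (g * h)%g) (sa_map n h * sa_map n g)%g
      @[n --> \oo] --> (0 : R);
  sa_free : forall g : G, g <> 1%g ->
    hamming R 1%g (sa_map n g) @[n --> \oo] --> (1 : R)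
}.

Definition sofic (R : realType) (G : groupType) : Prop :=
  inhabited (sofic_approximation R G).

Section LimitAction.
Context (R : realType) (G : groupType) (S : sofic_approximation R G).
Context (U : set_system nat) (UU : UltraFilter U) (Unp : nonprincipal U).

Lemma ord_neq0 n : (0 < n)%N -> [set: 'I_n] !=set0.
Proof. by case: n => // n _; exists ord0. Qed.

Definition perm_alg (n : nat) : measured_alg R :=
  subset_alg R (@finite_finset _ [set: 'I_(sa_deg S n)]) (ord_neq0 (sa_deg_gt0 S n)).

Lemma perm_bij n (s : 'S_n) : bijective s.
Proof. by exists (s^-1)%g; [exact: permK | exact: permKV]. Qed.

Definition perm_hom (n : nat) (s : 'S_(sa_deg S n)) :
    measured_hom (perm_alg n) (perm_alg n) :=
  image_hom R _ _ (perm_bij s).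

Definition limit_hom (g : G) : measured_hom (uprod UU perm_alg) (uprod UU perm_alg) :=
  uprod_hom UU (fun n => perm_hom (sa_map S n g)).

Lemma perm_mdist n (s t : 'S_(sa_deg S n)) X :
  mdist (perm_hom s X) (perm_hom t X) <= 2 * hamming R s t.
Proof.
apply: le_trans (image_mdist _ _ _) _.
rewrite ler_pM2l// /hamming /count_mu.
have e (D : pred 'I_(sa_deg S n)) : #|` fset_set [set x | D x]| = #|D|.
  rewrite -card_finset; congr #|` _|; apply/fsetP => x.
  rewrite in_fset_set; last exact: finite_finset.
  apply/idP/idP => [/set_mem /= Dx|]; first by rewrite !inE.
  by move=> Dx; apply/mem_set => /=; move: Dx; rewrite !inE.
have eT : #|` fset_set [set: 'I_(sa_deg S n)]| = sa_deg S n.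
  rewrite -[RHS]card_ord -[RHS](e predT); congr #|` fset_set _|.
  by apply/seteqP; split.
by rewrite (e [pred i | s i != t i]) eT.
Qed.

Lemma nonprincipal_oo : (\oo : set_system nat) `<=` U.
Proof.
move=> A [n _ nA].
suff Um m : U (~` `I_m) by apply: filterS (Um n) => k /= /negP; rewrite -leqNgt; exact: nA.
elim: m => [|m IH]; first by apply: filterE => k.
have : U (~` [set m]) by have [/Unp|] := in_ultra_setVsetC [set m] UU.
apply: filterS2 IH => k /= km /eqP nkm; apply/negP; rewrite ltnS leq_eqVlt (negbTE nkm).
exact/negP.
Qed.

Lemma hamming_limit (s t : forall n, 'S_(sa_deg S n)) (x : uprod_base perm_alg) :
  hamming R (s n) (t n) @[n --> \oo] --> (0 : R) ->
  \pi_(uprod_type UU perm_alg) (fun n => perm_hom (s n) (x n)) =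
  \pi_(uprod_type UU perm_alg) (fun n => perm_hom (t n) (x n)).
Proof.
move=> st; apply/upiP.
apply: (@ueq_squeeze _ _ _ _ _ (fun n => 2 * hamming R (s n) (t n))).
  by move=> n; rewrite mdist_ge0 perm_mdist.
rewrite -(mulr0 2); apply: cvgMr.
exact: cvg_trans (cvg_app _ nonprincipal_oo) st.
Qed.

Lemma limit_homM g h a : limit_hom (g * h)%g a = limit_hom g (limit_hom h a).
Proof.
elim/upi_ind: a => x; rewrite [LHS]umapE [X in limit_hom g X]umapE [RHS]umapE.
rewrite (hamming_limit _ (sa_mul S g h)); apply: upi_ext => n /=.
rewrite [RHS]image_comp; congr (image (x n)).
by apply/funext => i; rewrite permM.
Qed.

Lemma limit_hom1 a : limit_hom 1%g a = a.
Proof.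
elim/upi_ind: a => x; rewrite [LHS]umapE.
rewrite (@hamming_limit _ (fun n => 1%g)).
  by apply: upi_ext => n /=; rewrite (_ : fun_of_perm 1%g = id) ?image_id//; apply/funext => i; rewrite perm1.
have := sa_mul S 1%g 1%g; rewrite mul1g; apply: cvg_trans.
apply: near_eq_cvg; apply: filterE => n /=; rewrite /hamming; congr (_%:R / _).
apply: eq_card => i; rewrite !inE permM perm1 (inj_eq perm_inj) eq_sym.
by [].
Qed.

Definition limit_action : measured_galg R G := MeasuredGAlg limit_hom1 limit_homM.
End LimitAction.

Definition stable_in_finite_actions (R : realType) (G : groupType) : Prop :=
  forall (S : sofic_approximation R G) (U : set_system nat) (UU : UltraFilter U)
         (Unp : nonprincipal U),
    weakly_contained (limit_action S UU Unp) (@finite_action R G).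

Definition residually_finite (G : groupType) : Prop :=
  forall g : G, g <> 1%g ->
    exists (H : finGroupType) (f : {multiplicative G -> H}), f g <> 1%g.

Record central_extension (A : finZmodType) (E G : groupType)
    (iota : A -> E) (p : E -> G) : Prop := CentralExtension {
  ce_iotaD : {morph iota : a b / a + b >-> (a * b)%g};
  ce_pM : {morph p : x y / (x * y)%g};
  ce_inj : injective iota;
  ce_surj : forall g, exists x, p x = g;
  ce_exact : forall x, p x = 1%g <-> exists a, iota a = x;
  ce_central : forall a x, (iota a * x = x * iota a)%g
}.

Section Presentation.
Context (K : choiceType) (rel : {freeg K} -> Prop).

Definition rel_span : {pred {freeg K}} := fun x =>
  `[< forall S : zmodClosed {freeg K}, (forall r, rel r -> r \in S) -> x \in S >].

Lemma rel_span_closed : zmod_closed rel_span.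
Proof.
split=> [|x y /asboolP Sx /asboolP Sy]; apply/asboolP => S relS.
  exact: rpred0.
by rewrite rpredB ?Sx ?Sy.
Qed.
HB.instance Definition _ := GRing.isZmodClosed.Build _ rel_span rel_span_closed.

Definition presented : zmodType := Quotient.quot rel_span.

Definition gen (k : K) : presented := \pi_presented (<< k >> : {freeg K}).

(* The additive map that sends [gen k] to [f k]; it is meant for families [f]
   satisfying the relations. *)
Definition presented_lift (V : zmodType) (f : K -> V) (x : presented) : V :=
  fglift (f : K -> zmodule V) (repr x).

Section Lift.
Context (V : zmodType) (f : K -> V).
Hypothesis frel : forall r, rel r -> fglift (f : K -> zmodule V) r = 0.

Let ker : {pred {freeg K}} := fun x => fglift (f : K -> zmodule V) x == 0.

Let liftB : {morph fglift (f : K -> zmodule V) : x y / x - y}.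
Proof. exact: lift_is_additive. Qed.

Lemma presented_lift_pi (x : {freeg K}) :
  presented_lift f (\pi_presented x) = fglift (f : K -> zmodule V) x.
Proof.
have kc : zmod_closed ker.
  split=> [|y z /eqP y0 /eqP z0]; rewrite unfold_in /ker.
    by rewrite -(subrr 0) liftB subrr.
  by rewrite liftB y0 z0 subrr.
pose km := GRing.isZmodClosed.Build _ ker kc.
pose kS : zmodClosed {freeg K} := HB.pack ker km.
have : (repr (\pi_presented x) - x) \in rel_span.
  by rewrite Quotient.idealrBE reprK.
move=> /asboolP/(_ kS) h; apply/eqP; rewrite -subr_eq0 -liftB.
by apply: h => r /frel r0; rewrite unfold_in; apply/eqP.
Qed.

Lemma presented_lift_gen k : presented_lift f (gen k) = f k.
Proof. by rewrite presented_lift_pi liftU scale1r. Qed.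

Lemma presented_lift_zmod_morphism : zmod_morphism (presented_lift f).
Proof.
move=> a b; rewrite -[a]reprK -[b]reprK; set x := repr a; set y := repr b.
have -> : \pi_presented x - \pi_presented y = \pi_presented (x - y).
  by rewrite raddfB.
by rewrite !presented_lift_pi liftB.
Qed.
End Lift.
End Presentation.

Section Tensor.
Context (R : realType) (P : measured_alg R) (A : finZmodType).

(* [tensor] is the group P(A), and [pure X a] its generator X (x) a. *)
Definition tensor_rel (r : {freeg P * A}) : Prop :=
  exists (X Y : P) (a b : A),
    r = << (X, a) >> + << (Y, b) >>
        - (<< ((X `\` Y)%O, a) >> + << ((Y `\` X)%O, b) >>
           + << ((X `&` Y)%O, a + b) >>).

Definition tensor : zmodType := presented tensor_rel.

Definition pure (X : P) (a : A) : tensor := gen tensor_rel (X, a).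

Definition disjoint_form (x : tensor) (X : {ffun A -> P}) : Prop :=
  (forall a b, a != 0 -> b != 0 -> a != b -> (X a `&` X b)%O = \bot%O) /\
  x = \sum_(a : A | a != 0) pure (X a) a.

(* [X a] for [a != 0] does not depend on the disjoint form that is chosen. *)
Definition tensor_mu (x : tensor) : R :=
  \sum_(a : A | a != 0) mu (xget [ffun=> \bot%O] [set X | disjoint_form x X] a).
End Tensor.

Definition tensor_act (R : realType) (G : groupType) (P : measured_galg R G)
    (A : finZmodType) (g : G) : tensor P A -> tensor P A :=
  presented_lift (fun Xa => pure (gact P g Xa.1) Xa.2).

(* An abstract simplicial complex with a simplicial action of G. *)
Record simplicial_gcomplex (G : groupType) := SimplicialGComplex {
  vertex : choiceType;
  face : pred {fset vertex};
  face_neq0 : forall s, face s -> s != fset0;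
  face1 : forall v, face [fset v]%fset;
  face_sub : forall s t, face s -> (t `<=` s)%fset -> t != fset0 -> face t;
  vact : G -> vertex -> vertex;
  vact1 : forall v, vact 1%g v = v;
  vactM : forall g h v, vact (g * h)%g v = vact g (vact h v);
  face_act : forall g s, face s -> face [fset vact g v | v in s]%fset
}.

Section Simplicial.
Context (G : groupType) (E : simplicial_gcomplex G).

Lemma vact_inj g : injective (@vact _ E g).
Proof.
move=> v w /(congr1 (@vact _ E g^-1%g)).
by rewrite -!vactM mulVg !vact1.
Qed.

Definition face_image (g : G) (s : {fset vertex E}) : {fset vertex E} :=
  [fset vact g v | v in s]%fset.

Lemma face_image1 s : face_image 1%g s = s.
Proof.
apply/fsetP => v; apply/imfsetP/idP => [[w ws ->]|vs]; first by rewrite vact1.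
by exists v; rewrite ?vact1.
Qed.

Lemma face_imageM g h s : face_image (g * h)%g s = face_image g (face_image h s).
Proof.
apply/fsetP => v; apply/imfsetP/imfsetP => [[w ws ->]|[_ /imfsetP[w ws ->] ->]].
  by exists (vact h w); rewrite ?vactM//; apply/imfsetP; exists w.
by exists w; rewrite ?vactM.
Qed.

Lemma card_face_image g s : #|` face_image g s| = #|` s|.
Proof. by rewrite card_imfset//; exact: vact_inj. Qed.

(* An element fixing a simplex setwise fixes its barycenter, so this is freeness
   of the action on the geometric realization. *)
Definition free_action : Prop :=
  forall g s, face s -> face_image g s = s -> g = 1%g.

Definition simplex (i : nat) := {s : {fset vertex E} | face s && (#|` s| == i.+1)}.
HB.instance Definition _ i := Choice.on (simplex i).

Definition orbit_rel i (s t : simplex i) : bool :=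
  `[< exists g, face_image g (val s) = val t >].

Lemma orbit_rel_equiv i : equiv_class_of (@orbit_rel i).
Proof.
have sym (s t : simplex i) : orbit_rel s t -> orbit_rel t s.
  move=> /asboolP[g gs]; apply/asboolP; exists g^-1%g.
  by rewrite -gs -face_imageM mulVg face_image1.
split=> [s|s t|t s u /asboolP[g gs] /asboolP[h ht]].
- by apply/asboolP; exists 1%g; rewrite face_image1.
- by apply/idP/idP; exact: sym.
- by apply/asboolP; exists (h * g)%g; rewrite face_imageM gs.
Qed.
Canonical orbit_rel_equiv_rel i := EquivRelPack (orbit_rel_equiv i).
Canonical orbit_rel_encModRel i := defaultEncModRel (@orbit_rel i).

(* The i-simplices of the quotient E/G. *)
Definition qsimplex (i : nat) := {eq_quot (@orbit_rel i)}.
HB.instance Definition _ i : EqQuotient _ (@orbit_rel i) (qsimplex i) :=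
  EqQuotient.on (qsimplex i).
HB.instance Definition _ i := Choice.on (qsimplex i).

Definition finite_quotient : Prop :=
  (exists d, forall s, @face _ E s -> (#|` s| <= d)%N) /\
  (forall i, finite_set [set: qsimplex i]).

Definition vset (t : seq (vertex E)) : {fset vertex E} := [fset v in t]%fset.

Lemma mem_vset t v : (v \in vset t) = (v \in t).
Proof. by rewrite !inE. Qed.

Definition is_osimplex i (t : i.+1.-tuple (vertex E)) : bool :=
  uniq t && face (vset t).

Definition osimplex (i : nat) := {t : i.+1.-tuple (vertex E) | is_osimplex t}.
HB.instance Definition _ i := Choice.on (osimplex i).

Lemma reorder_subproof i (t : osimplex i) (p : 'S_i.+1) :
  is_osimplex [tuple tnth (val t) (p k) | k < i.+1].
Proof.
case: t => t /= /andP[ut ft]; apply/andP; split.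
  rewrite map_inj_uniq ?enum_uniq// => j k /tuple_uniqP h.
  by apply: (@perm_inj _ p); apply: h; rewrite ?ut.
rewrite (_ : vset _ = vset t)//.
apply/fsetP => v; rewrite !mem_vset; apply/mapP/tnthP => [[k _ ->]|[k ->]].
  by exists (p k).
by exists (p^-1%g k); rewrite ?mem_enum// permKV.
Qed.
Definition reorder i (t : osimplex i) (p : 'S_i.+1) : osimplex i :=
  exist (@is_osimplex i) _ (reorder_subproof t p).

Lemma ofacet_subproof i (t : osimplex i.+1) (j : 'I_i.+2) :
  is_osimplex [tuple tnth (val t) (lift j k) | k < i.+1].
Proof.
case: t => t /= /andP[ut ft]; apply/andP; split.
  rewrite map_inj_uniq ?enum_uniq// => h k /tuple_uniqP e.
  by apply: (@lift_inj _ j); apply: e; rewrite ?ut.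
apply: face_sub ft _ _.
  apply/fsubsetP => v; rewrite !mem_vset => /mapP[k _ ->]; exact: mem_tnth.
apply/fset0Pn; exists (tnth t (lift j ord0)); rewrite mem_vset.
by apply/mapP; exists ord0; rewrite ?mem_enum.
Qed.
Definition ofacet i (t : osimplex i.+1) (j : 'I_i.+2) : osimplex i :=
  exist (@is_osimplex i) _ (ofacet_subproof t j).

Lemma oact_subproof i (g : G) (t : osimplex i) :
  is_osimplex [tuple of map (@vact _ E g) (val t)].
Proof.
case: t => t /= /andP[ut ft]; rewrite /is_osimplex/= map_inj_uniq ?ut/=; last exact: vact_inj.
rewrite (_ : vset _ = face_image g (vset t)); first exact: face_act.
apply/fsetP => v; rewrite mem_vset; apply/mapP/imfsetP => -[w /= wt ->]; exists w => //.
  by rewrite /= mem_vset.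
by move: wt; rewrite /= mem_vset.
Qed.
Definition oact i (g : G) (t : osimplex i) : osimplex i :=
  exist (@is_osimplex i) _ (oact_subproof g t).

(* [v_p(0), ..., v_p(i)] = sgn(p) [v_0, ..., v_i]. *)
Definition chain_rel i (r : {freeg (osimplex i)}) : Prop :=
  exists (t : osimplex i) (p : 'S_i.+1),
    r = << reorder t p >> - << t >> *~ (-1) ^+ p.

Definition chain (i : nat) : zmodType := presented (@chain_rel i).

Definition chain_act i (g : G) : chain i -> chain i :=
  presented_lift (fun t => gen (@chain_rel i) (oact g t)).

Definition boundary i : chain i.+1 -> chain i :=
  presented_lift (fun t =>
    \sum_(j < i.+2) gen (@chain_rel i) (ofacet t j) *~ (-1) ^+ j).

Lemma orient_subproof i (s : simplex i) : size (enum_fset (val s)) == i.+1.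
Proof. by case: s => s /= /andP[]. Qed.
Lemma orient_subproof2 i (s : simplex i) :
  is_osimplex (Tuple (orient_subproof s)).
Proof.
case: s => s /= sP; rewrite /is_osimplex /= fset_uniq /=.
by rewrite (_ : vset _ = s) ?(andP sP).1//; apply/fsetP => v; rewrite mem_vset.
Qed.
(* The ordering is arbitrary: it only affects the sign of the oriented simplex,
   and [tensor_mu] is invariant under opposites. *)
Definition orient i (s : simplex i) : osimplex i :=
  exist (@is_osimplex i) _ (orient_subproof2 s).

End Simplicial.

Section Realization.
Context (R : realType) (G : groupType) (E : simplicial_gcomplex G).

(* Barycentric coordinates; [s] is any simplex containing the point. *)
Definition barycentric (t : vertex E -> R) : Prop :=
  exists s : {fset vertex E},
    [/\ face s, forall v, v \notin s -> t v = 0, forall v, 0 <= t v &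
        \sum_(v <- s) t v = 1].

Definition realization := {t : vertex E -> R | `[< barycentric t >]}.
HB.instance Definition _ := Choice.on realization.

Definition in_simplex (s : {fset vertex E}) (x : realization) : Prop :=
  forall v, v \notin s -> val x v = 0.

(* The weak topology: a set is open when its trace on every closed simplex is
   open for the Euclidean topology of that simplex. *)
Definition weak_open (O : set realization) : Prop :=
  forall s x, face s -> in_simplex s x -> O x ->
    exists2 e : R, 0 < e & forall y, in_simplex s y ->
      (forall v, v \in s -> `|val y v - val x v| < e) -> O y.

Lemma weak_openT : weak_open setT.
Proof. by move=> s x _ _ _; exists 1. Qed.

Lemma weak_openI : setI_closed weak_open.
Proof.
move=> A B Ao Bo s x fs xs [Ax Bx].
have [e e0 eA] := Ao s x fs xs Ax; have [d d0 dB] := Bo s x fs xs Bx.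
exists (Num.min e d) => [|y ys yx]; first by rewrite lt_min e0.
by split; [apply: eA | apply: dB] => // v /yx; rewrite lt_min => /andP[].
Qed.

Lemma weak_open_bigU (I : Type) (f : I -> set realization) :
  (forall i, weak_open (f i)) -> weak_open (\bigcup_i f i).
Proof.
move=> fo s x fs xs [i _ fx]; have [e e0 ef] := fo i s x fs xs fx.
by exists e => // y ys yx; exists i => //; exact: ef.
Qed.

HB.instance Definition _ := isOpenTopological.Build realization
  weak_openT weak_openI weak_open_bigU.
Lemma realization_openE : @open realization = weak_open.
Proof. by []. Qed.
End Realization.

Definition contractible (R : realType) (X : topologicalType) : Prop :=
  exists (p : X) (H : X * R -> X),
    [/\ {within [set: X] `*` `[0, 1], continuous H},
        forall x, H (x, 0) = x & forall x, H (x, 1) = p].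

(* E is a model of EG such that BG = E/G is finite. *)
Definition finite_model (R : realType) (G : groupType)
    (E : simplicial_gcomplex G) : Prop :=
  [/\ contractible R (realization R E), free_action E & finite_quotient E].

Definition finite_type (R : realType) (G : groupType) : Prop :=
  exists E : simplicial_gcomplex G, finite_model R E.

Section Cohomology.
Context (R : realType) (G : groupType) (E : simplicial_gcomplex G).
Context (P : measured_galg R G) (A : finZmodType).

Definition cochain (i : nat) : set (chain E i -> tensor P A) :=
  [set c | zmod_morphism c /\
    forall g x, c (chain_act g x) = tensor_act g (c x)].

Definition cocycle (i : nat) : set (chain E i -> tensor P A) :=
  [set c | cochain c /\ forall x, c (boundary x) = 0].

Definition coboundary (i : nat) : set (chain E i -> tensor P A) :=
  match i with
  | 0 => [set cst 0]
  | j.+1 => [set c | exists2 b, cochain b & c = b \o @boundary _ E j]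
  end.

(* A cohomology class is a coset of the coboundaries in the cocycles; the zero
   class is [coboundary i] itself. *)
Definition cohomology (i : nat) : set (set (chain E i -> tensor P A)) :=
  [set [set c' | cocycle c' /\ coboundary (c' \- c)] | c in @cocycle i].

Definition cochain_norm i (nu : qsimplex E i -> R) (c : chain E i -> tensor P A) : R :=
  \sum_(x \in [set: qsimplex E i])
    tensor_mu (c (gen (@chain_rel _ E i) (orient (repr x)))) * nu x.

Definition class_norm i (nu : qsimplex E i -> R)
    (alpha : set (chain E i -> tensor P A)) : R :=
  inf [set cochain_norm nu c | c in alpha].
End Cohomology.
Arguments cochain {R G} E P A i _.
Arguments cocycle {R G} E P A i _.
Arguments coboundary {R G} E P A i _.
Arguments cohomology {R G} E P A i _.

(* If there are no i-simplices there is no probability measure, and the empty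
   family is used. *)
Definition faithful_probability (R : realType) (G : groupType)
    (E : simplicial_gcomplex G) (i : nat) (nu : qsimplex E i -> R) : Prop :=
  (forall x, 0 < nu x) /\
  ([set: qsimplex E i] !=set0 -> \sum_(x \in [set: qsimplex E i]) nu x = 1).

Definition cosystolic_inequality (R : realType) (G : groupType) (i : nat)
    (F : measured_galg R G -> Prop) (A : finZmodType) : Prop :=
  exists (E : simplicial_gcomplex G) (nu : qsimplex E i -> R) (eps : R),
    [/\ finite_model R E, faithful_probability nu, 0 < eps &
      forall P : measured_galg R G, F P ->
        forall alpha, cohomology E P A i alpha -> alpha <> coboundary E P A i ->
          eps <= class_norm nu alpha].

(* Main.v *)
Require Import Defs.
From HB Require Import structures.
From mathcomp Require Import freeg.
From mathcomp Require Import all_boot all_order all_fingroup all_algebra.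
From mathcomp Require Import generic_quotient ring_quotient finmap.
From mathcomp Require Import all_classical all_reals all_analysis.
From mathcomp Require Import zify lra.
Import Defs.

Set Implicit Arguments.
Unset Strict Implicit.
Unset Printing Implicit Defensive.

Import Order.Theory GRing.Theory Num.Theory.
Import numFieldNormedType.Exports.

Local Open Scope classical_set_scope.
Local Open Scope ring_scope.
Local Open Scope quotient_scope.

(* Suppose that the extension E of G by A is sofic. On almost all points of a
   sofic approximation of E the finite group A acts honestly and freely;
   dividing by A gives a sofic approximation of G, and a transversal of the
   A-orbits gives an A-valued 1-cochain on E that trivialises the extension class
   in the cohomology of G with coefficients P(A), where P is the limit action.
   By stability this trivialisation can be moved to an ultraproduct of finite
   actions, hence to a single finite action up to an error of measure < eps, and
   then, by averaging over an atom, to a finite transitive action G/L. By the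
   cosystolic inequality the extension class vanishes in H^2(G, P^{G/L}(A)) =
   H^2(L, A), so the extension splits over L. The image of the splitting is a
   subgroup of finite index of E which meets A trivially, so E is residually
   finite since G is.

   The extension class is represented on the simplicial complex K = EG by a
   section of E -> G chosen along the edges, inverse to itself under reversal of
   edges. Contractibility of K is used only through connectedness and H^1 = 0,
   both proved by lifting along the paths of the contraction. *)

(** * Contractible complexes *)

(** An identity in an ultraproduct gives only approximate identities in the factors, while a cochain
    must be exactly alternating and equivariant on infinitely many simplices. The 1-cochain is
    therefore carried as a family of partitions indexed by A, and in a factor it is rebuilt from one
    choice of disjoint sets for each lifted edge, moved by G by means of equivariant vertex labels
    and edge orientations, which exist because the action on K is free. Both conditions then hold
    exactly. What remains approximate is one equation for each orbit of triangles; these orbits are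
    finitely many, so all failures fit into a set D of measure < eps. The weights of the triangles
    form a probability, so the corrected cocycle has norm at most the measure of D, and eps can be
    the constant of the cosystolic inequality itself. The transitive action comes from an orbit:
    with L the kernel of the finite action and x an atom, a cochain is read on G/L through its
    values on the translates of x. A suitable x keeps the proportion of translates under D below
    eps. *)

Lemma segment_ind (R : realType) (Q : R -> R -> Prop) :
  (forall t, 0 <= t -> t <= 1 -> exists2 d, 0 < d &
     forall r s, 0 <= r -> r <= s -> s <= 1 -> t - d < r -> s < t + d -> Q r s) ->
  (forall r s t, 0 <= r -> r <= s -> s <= t -> t <= 1 -> Q r s -> Q s t -> Q r t) ->
  Q 0 1.
Proof.
(* The supremum of the [t] with [Q 0 t] does the work of a finite subdivision of the segment. *)
move=> loc tr; pose S := [set t : R | [/\ 0 <= t, t <= 1 & Q 0 t]].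
have S0 : S 0.
  have [d d0 dQ] := loc 0 (lexx _) ler01.
  by split=> //; apply: dQ; rewrite ?ler01 ?sub0r ?oppr_lt0 ?add0r.
have bS : has_sup S by split; [exists 0 | exists 1 => t []].
have c0 : 0 <= sup S by apply: ub_le_sup => //; exact: bS.2.
have c1 : sup S <= 1 by apply: ge_sup; [exists 0 | move=> t []].
have [d d0 dQ] := loc _ c0 c1.
have [t [t0 t1 Qt] ct] := sup_adherent d0 bS.
have tc : t <= sup S by apply: ub_le_sup => //; exact: bS.2.
(* Halving [d] keeps [s] in the interval where [dQ] applies, and the cap keeps it in the segment. If
   the cap is not attained, [s] is a point of [S] beyond its supremum. *)
pose s := Num.min 1 (sup S + d / 2).
have s1 : s <= 1 by rewrite /s ge_min lexx.
have ts : t <= s by rewrite /s le_min t1 /=; lra.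
have sd : s < sup S + d by rewrite /s gt_min; apply/orP; right; lra.
have Qs : Q 0 s by apply: tr Qt (dQ _ _ _ _ _ _ _).
have sS : s <= sup S by apply: ub_le_sup; [exact: bS.2 | split=> //; lra].
have [c1d|c1d] := leP 1 (sup S + d / 2); first by rewrite /s (min_idPl c1d) in Qs.
by move: sS; rewrite /s (min_idPr (ltW c1d)); lra.
Qed.

Section Realization.
Context (R : realType) (G : groupType) (E : simplicial_gcomplex G).
Local Notation X := (realization R E).
Implicit Types (x : X) (v w z : vertex E).

Definition supp x v : Prop := 0 < val x v.

(** Repetitions are allowed: an edge is written [in_face v w w], and [v = w] is included. *)
Definition in_face (v w z : vertex E) : Prop :=
  exists2 s, @face _ E s & [/\ v \in s, w \in s & z \in s].

Lemma supp_face x v w z : supp x v -> supp x w -> supp x z -> in_face v w z.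
Proof.
have /asboolP[s [fs s0 _ _]] := valP x => xv xw xz.
have h y : supp x y -> y \in s.
  by move=> xy; apply: contraPT xy => /s0; rewrite /supp => ->; rewrite ltxx.
by exists s => //; split; exact: h.
Qed.

Lemma supp_neq0 x : exists v, supp x v.
Proof.
have /asboolP[s [_ _ x0 x1]] := valP x; apply/not_existsP => nx.
have : \sum_(v <- s) val x v = 0.
  apply: big1 => v _; apply/eqP; rewrite eq_le x0 andbT leNgt.
  by apply/negP/nx.
by rewrite x1 => /eqP; rewrite oner_eq0.
Qed.

(** These open stars cover the space by [supp_neq0], and by [supp_face] any three vertices whose
    stars share a point lie in a common face. *)
Lemma star_open v : open [set x | supp x v].
Proof.
rewrite realization_openE => s x fs xs; rewrite /= /supp => xv.
exists (val x v) => // y ys yx.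
have vs : v \in s by apply: contraPT xv => /xs ->; rewrite ltxx.
have := yx v vs; rewrite ltr_norml => /andP[+ _].
by rewrite /= /supp; set p := val x v; set q := val y v; lra.
Qed.

Lemma vertex_pt_subproof v : `[< barycentric (fun w : vertex E => (w == v)%:R : R) >].
Proof.
apply/asboolP; exists [fset v]%fset; split; first exact: face1.
- by move=> w; rewrite inE => /negbTE ->.
- by move=> w; rewrite ler0n.
- by rewrite big_seq_fset1 eqxx.
Qed.
Definition vertex_pt v : X :=
  exist (fun t => `[< barycentric t >]) _ (vertex_pt_subproof v).

Definition edge_coord v w (r : R) z : R := (1 - r) * (z == v)%:R + r * (z == w)%:R.
Definition edge_pt v w (r : R) : X := insubd (vertex_pt v) (edge_coord v w r).

Lemma edge_ptE v w r : v != w -> face [fset v; w]%fset -> 0 <= r -> r <= 1 ->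
  val (edge_pt v w r) = edge_coord v w r.
Proof.
move=> vw fvw r0 r1; rewrite val_insubd; case: asboolP => // -[].
exists [fset v; w]%fset; split=> //.
- move=> z; rewrite !inE negb_or /edge_coord => /andP[/negbTE -> /negbTE ->].
  by rewrite !mulr0 addr0.
- by move=> z; rewrite /edge_coord addr_ge0// mulr_ge0// subr_ge0.
- rewrite big_fsetU1 ?inE//= big_seq_fset1 /edge_coord !eqxx (negbTE vw).
  by rewrite eq_sym (negbTE vw) !mulr0 !mulr1 addr0 add0r subrK.
Qed.

Lemma edge_pt_supp v w r z : v != w -> face [fset v; w]%fset -> 0 <= r -> r <= 1 ->
  supp (edge_pt v w r) z -> (z == v) || (z == w).
Proof.
move=> vw fvw r0 r1; rewrite /supp edge_ptE// /edge_coord.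
by case: (z == v) => //; case: (z == w) => //; rewrite !mulr0 addr0 ltxx.
Qed.

Lemma edge_pt_near v w t (Q : set X) : v != w -> face [fset v; w]%fset ->
  0 <= t -> t <= 1 -> nbhs (edge_pt v w t) Q ->
  exists2 d, 0 < d &
    forall r, 0 <= r -> r <= 1 -> `|r - t| < d -> Q (edge_pt v w r).
Proof.
move=> vw fvw t0 t1; rewrite nbhsE; case=> O [Oo Ot] OQ.
have es r : 0 <= r -> r <= 1 -> in_simplex [fset v; w]%fset (edge_pt v w r).
  move=> r0 r1 z; rewrite edge_ptE// !inE negb_or /edge_coord.
  by move=> /andP[/negbTE -> /negbTE ->]; rewrite !mulr0 addr0.
move: Oo; rewrite realization_openE => /(_ _ _ fvw (es _ t0 t1) Ot)[e e0 eO].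
exists e => // r r0 r1 rt; apply: OQ; apply: eO; first exact: es.
move=> z _; rewrite !edge_ptE// /edge_coord; apply: le_lt_trans rt.
case: (eqVneq z v) => [->|_]; rewrite ?(negbTE vw) ?mulr0 ?mulr1 ?addr0 ?add0r.
  rewrite distrC (_ : 1 - t - (1 - r) = r - t)//; lra.
by case: (z == w); rewrite ?mulr1 ?mulr0 ?subrr ?normr0.
Qed.

Section Contractible.
Hypothesis Ec : contractible R X.

(** Continuity of the contraction is used in this form only: the preimage of an open star contains,
    around each of its points, a neighbourhood of [x] times an interval around [t]. *)
Lemma contractible_nearby : exists (p : X) (H : X -> R -> X),
  [/\ forall x, H x 0 = x, forall x, H x 1 = p &
     forall x t, 0 <= t -> t <= 1 -> forall v, supp (H x t) v ->
       exists2 d, 0 < d &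
         \forall y \near x, forall r, 0 <= r -> r <= 1 -> t - d < r -> r < t + d ->
           supp (H y r) v].
Proof.
have [p [H [Hc H0 H1]]] := Ec; exists p, (fun x t => H (x, t)); split=> //.
move=> x t t0 t1 v xv.
have := (iffLR (subspace_continuousP _ _) Hc) (x, t).
have tI : ([set: X] `*` `[0, 1])%classic (x, t) by split=> //=; rewrite in_itv/= t0 t1.
move=> /(_ tI [set y | supp y v]) [];
  first by apply: open_nbhs_nbhs; split; [exact: star_open | exact: xv].
move=> [N D] /= [Nx [d /= d0 dD]] ND.
exists d => //.
apply: filterS Nx => y Ny r r0 r1 tr rt.
apply: (ND (y, r)) => //=; last by split => //=; rewrite in_itv/= r0 r1.
split=> //=; apply: dD => /=; rewrite ltr_norml; apply/andP; split; lra.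
Qed.

(** Connectedness. The contraction moves each vertex along a path to [p]; nearby points of the path
    share a vertex of their supports, so [h] keeps its value along the path. *)
Lemma face_const (T : Type) (h : vertex E -> T) :
  (forall v w, in_face v w w -> h v = h w) -> forall v w, h v = h w.
Proof.
move=> hf; have [p [H [H0 H1 Hn]]] := contractible_nearby.
have [w0 pw0] := supp_neq0 p.
suff h0 v : h v = h w0 by move=> v w; rewrite !h0.
pose x := vertex_pt v.
have := @segment_ind R (fun r s => forall a b, supp (H x r) a -> supp (H x s) b -> h a = h b).
rewrite H0 H1; apply=> //; last by rewrite /x /supp /= eqxx.
- move=> t t0 t1; have [c xc] := supp_neq0 (H x t).
  have [d d0 /nbhs_singleton dH] := Hn _ _ t0 t1 _ xc; exists d => // r s r0 rs s1 tr st a b ra sb.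
  transitivity (h c).
    by apply/hf/(supp_face ra); apply: dH => //; lra.
  by apply/hf/(supp_face _ sb) => //; apply: dH => //; lra.
- move=> r s t r0 rs st t1 Q1 Q2 a b ra tb; have [c sc] := supp_neq0 (H x s).
  by rewrite (Q1 a c)// (Q2 c b).
Qed.

Context (A : zmodType) (u : vertex E -> vertex E -> A).
Hypothesis uflat : forall v w z, in_face v w z -> u v w + u w z = u v z.

(** A lift of the path [c] over [r, s] to the covering with fibre A that [u] glues from the open
    stars: [l t v] is the coordinate at time [t] in the chart of [v]. The first clause is the change
    of charts, the second constancy within a chart. *)
Let lift (c : R -> X) (r s : R) (l : R -> vertex E -> A) : Prop :=
  (forall t, r <= t -> t <= s -> forall v w, supp (c t) v -> supp (c t) w ->
     l t v + u v w = l t w) /\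
  (forall t t' v, r <= t -> t <= t' -> t' <= s ->
     (forall t'', t <= t'' -> t'' <= t' -> supp (c t'') v) -> l t v = l t' v).

(** Agreement at time [s] in the single chart [w] forces agreement in all charts there, by the
    change of charts. *)
Let lift_cat (c : R -> X) r s t l1 l2 w : r <= s -> s <= t ->
  lift c r s l1 -> lift c s t l2 -> supp (c s) w -> l1 s w = l2 s w ->
  exists l, [/\ lift c r t l, forall z, l r z = l1 r z &
    forall z, supp (c t) z -> l t z = l2 t z].
Proof.
move=> rs st [c1 k1] [c2 k2] sw e.
have es z : supp (c s) z -> l1 s z = l2 s z.
  by move=> sz; rewrite -(c1 s rs (lexx s) w z sw sz) -(c2 s (lexx s) st w z sw sz) e.
exists (fun y : R => if y <= s then l1 y else l2 y); split; last 2 first.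
- by move=> z; rewrite rs.
- move=> z tz; case: ifP => // ts; have ets : t = s by lra.
  by rewrite ets; apply: es; rewrite -ets.
split=> [y ry yt v z xv xz|y y' v ry yy' y't yv].
  by case: leP => ys; [apply: c1 | apply: c2] => //; exact: ltW.
case: (leP y' s) => ys; first by rewrite (le_trans yy' ys); exact: k1.
case: leP => xs; last by apply: k2 => //; exact: ltW.
have sv : supp (c s) v by apply: yv => //; exact: ltW.
rewrite (k1 y s)//; last by move=> t'' h1 h2; apply: yv => //; lra.
by rewrite es//; apply: k2 => // [|t'' h1 h2]; [exact: ltW | apply: yv; lra].
Qed.

(** H^1 = 0: the covering glued by [u] is trivial. Each point is joined to [p] by its path of
    contraction; the initial values of the lifts that end at 0 form a global section [F], and [f v]
    is its coordinate at the vertex [v]. *)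
Lemma face_exact : exists f, forall v w, in_face v w w -> u v w = f w - f v.
Proof.
have [p [H [H0 H1 Hn]]] := contractible_nearby.
have [w0 pw0] := supp_neq0 p.
have u0 v : u v v = 0.
  apply: (addrI (u v v)); rewrite addr0; apply: uflat.
  exists [fset v]%fset; first exact: face1.
  by rewrite !inE eqxx.
(* All paths end at [p], so the lifts are normalised at time 1 in the chart of [w0]. Each piece is
   built with its final value prescribed. *)
have lex x : exists l, lift (H x) 0 1 l /\ l 1 w0 = 0.
  have := @segment_ind R (fun r s => forall w a, supp (H x s) w ->
    exists l, lift (H x) r s l /\ l s w = a).
  rewrite H1; apply=> //.
  - move=> t t0 t1; have [c xc] := supp_neq0 (H x t).
    have [d d0 /nbhs_singleton dH] := Hn _ _ t0 t1 _ xc.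
    exists d => // r s r0 rs s1 tr st w a sw.
    have dc (y : R) : r <= y -> y <= s -> supp (H x y) c by move=> *; apply: dH => //; lra.
    exists (fun _ z => a + u w c + u c z); split; last first.
      by rewrite -addrA uflat ?u0 ?addr0//; exact: supp_face sw (dc s rs (lexx s)) (sw).
    split=> // y ry ys v z yv yz; rewrite -addrA uflat//.
    exact: supp_face (dc _ ry ys) yv yz.
  - move=> r s t r0 rs st t1 Q1 Q2 w a tw; have [c sc] := supp_neq0 (H x s).
    have [l2 [ll2 e2]] := Q2 w a tw; have [l1 [ll1 e1]] := Q1 c (l2 s c) sc.
    have [l [ll _ e]] := lift_cat rs st ll1 ll2 sc e1.
    by exists l; split=> //; rewrite e.
pose F x := projT1 (cid (lex x)) 0.
have Fc x v w : supp x v -> supp x w -> F x v + u v w = F x w.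
  rewrite /F; case: cid => l [[lc lk] lw] /= xv xw.
  by apply: lc; rewrite ?H0 ?ler01.
(* Local constancy of [F]: the lifts over [x] and a nearby [y] agree at time 1, where both vanish in
   the chart [w0], and the agreement is carried back to time 0. *)
have Fn x : \forall y \near x, forall v, supp x v -> supp y v -> F x v = F y v.
  pose agree y r := exists v, [/\ supp (H x r) v, supp (H y r) v &
    projT1 (cid (lex x)) r v = projT1 (cid (lex y)) r v].
  have : \forall y \near x, agree y 1 -> agree y 0.
    apply: (@segment_ind R (fun r s => \forall y \near x, agree y s -> agree y r)).
      move=> t t0 t1; have [c xc] := supp_neq0 (H x t).
      have [d d0 dH] := Hn _ _ t0 t1 _ xc; exists d => // r s r0 rs s1 tr st.
      have dx := nbhs_singleton dH; apply: filterS dH => y dy [w [xw yw]].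
      rewrite /agree; case: (cid (lex x)) => l [[lc lk] lw] /=.
      case: (cid (lex y)) => l' [[lc' lk'] lw'] /= e.
      have xyc (z : R) : r <= z -> z <= s -> supp (H x z) c /\ supp (H y z) c.
        by move=> ? ?; split; [apply: dx | apply: dy] => //; lra.
      have s0 := le_trans r0 rs; have [xsc ysc] := xyc s rs (lexx _).
      have [xrc yrc] := xyc r (lexx _) rs; exists c; split=> //.
      rewrite (lk r s c r0 rs s1) => [|z rz zs]; last by have [] := xyc z rz zs.
      rewrite (lk' r s c r0 rs s1) => [|z rz zs]; last by have [] := xyc z rz zs.
      by rewrite -(lc s s0 s1 w c xw xsc) -(lc' s s0 s1 w c yw ysc) e.
    by move=> r s t _ _ _ _; apply: filterS2 => y Q1 Q2 /Q2.
  apply: filterS => y; rewrite /agree !H0 !H1 => -[].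
    exists w0; split=> //.
    by case: (cid (lex x)) => l [ll /= ->]; case: (cid (lex y)) => l' [ll' /= ->].
  move=> w [xw yw]; rewrite -/(F x) -/(F y) => e v xv yv.
  by rewrite -(Fc x w)// -(Fc y w)// e.
exists (fun v => F (vertex_pt v) v) => v w vw.
have [->|nvw] := eqVneq v w; first by rewrite u0 subrr.
have fvw : face [fset v; w]%fset.
  have [s fs [vs ws _]] := vw; apply: face_sub fs _ _.
    by apply/fsubsetP => z; rewrite !inE => /orP[] /eqP ->.
  by apply/fset0Pn; exists v; rewrite !inE eqxx.
have wv : in_face w v w.
  by have [s fs [vs ws _]] := vw; exists s.
(* The coordinate of [F] in the chart of [v] is followed along the whole edge, up to the end [w],
   where [v] has left the support but [u w v] still makes sense. *)
have := @segment_ind R (fun r s => forall a b,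
  supp (edge_pt v w r) a -> supp (edge_pt v w s) b ->
  F (edge_pt v w r) a + u a v = F (edge_pt v w s) b + u b v).
have e0 : edge_pt v w 0 = vertex_pt v.
  apply: val_inj; rewrite edge_ptE ?ler01//; apply/funext => z /=.
  by rewrite /edge_coord mul0r addr0 subr0 mul1r.
have e1 : edge_pt v w 1 = vertex_pt w.
  apply: val_inj; rewrite edge_ptE ?ler01//; apply/funext => z /=.
  by rewrite /edge_coord subrr mul0r add0r mul1r.
have spt z : supp (vertex_pt z) z by rewrite /supp /= eqxx.
rewrite e0 e1 => h; have {}h := h _ _ v w (spt v) (spt w).
have uvw : u v w = - u w v.
  apply/eqP; rewrite -addr_eq0 uflat ?u0//; by have [s fs [? ? _]] := vw; exists s.
suff key : F (vertex_pt v) v + u v v = F (vertex_pt w) w + u w v.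
  by move: key; rewrite u0 addr0 uvw => ->; rewrite opprD addrA subrr add0r.
apply: h.
- move=> t t0 t1; set x := edge_pt v w t; have [c xc] := supp_neq0 x.
  have [d d0 dH] := edge_pt_near nvw fvw t0 t1
    (filterI (open_nbhs_nbhs (conj (@star_open c) xc)) (Fn x)).
  exists d => // r s r0 rs s1 tr st.
  have rep y b : 0 <= y -> y <= 1 -> t - d < y -> y < t + d -> supp (edge_pt v w y) b ->
      F (edge_pt v w y) b + u b v = F x c + u c v.
    move=> y0 y1 ty yt yb; have [|yc Fe] := dH y y0 y1; first by rewrite ltr_norml; lra.
    rewrite (Fe c xc yc) -(Fc _ c b yc yb) -addrA uflat//.
    have vwe z : supp (edge_pt v w y) z -> z \in [fset v; w]%fset.
      by move=> yz; rewrite !inE (edge_pt_supp nvw fvw _ _ yz).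
    by exists [fset v; w]%fset => //; split; rewrite ?(vwe _ yc) ?(vwe _ yb)// !inE eqxx.
  by move=> a b ra sb; rewrite !rep//; lra.
- move=> r s t _ _ _ _ Q1 Q2 a b ra tb; have [c sc] := supp_neq0 (edge_pt v w s).
  by rewrite (Q1 a c)// (Q2 c b).
Qed.
End Contractible.
End Realization.

(** * Descent of permutation models along a central extension *)

Lemma perm_extend (T : finType) (f : T -> T) (D : {set T}) :
  {in D &, injective f} -> exists s : {perm T}, {in D, s =1 f}.
Proof.
suff ext (l : seq T) : {in l &, injective f} -> exists s : {perm T}, {in l, s =1 f}.
  move=> inj; have [|s sf] := ext (enum D).
    by move=> x y; rewrite !mem_enum; exact: inj.
  by exists s => x xD; apply: sf; rewrite mem_enum.
elim: l => [_|x l IH inj]; first by exists 1%g.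
have [|s sf] := IH; first by move=> y z yl zl; apply: inj; rewrite !inE ?yl ?zl orbT.
have [xl|xl] := boolP (x \in l).
  by exists s => y; rewrite inE => /predU1P[->|]; exact: sf.
exists (s * tperm (s x) (f x))%g => y; rewrite permM inE => /predU1P[->|yl].
  by rewrite tpermL.
have nxy : x != y by apply: contraNneq xl => ->.
rewrite tpermD ?(inj_eq perm_inj)//; first exact: sf.
rewrite sf//; apply: contraNneq nxy => /inj; rewrite !inE eqxx yl orbT.
by move=> /(_ isT isT) ->.
Qed.

Section CentralExtension.
Context (A : finZmodType) (E G : groupType) (iota : A -> E) (p : E -> G).
Hypothesis ext : central_extension iota p.

Lemma ce_p1 : p 1%g = 1%g.
Proof. by apply: (mulgI (p 1%g)); rewrite -(ce_pM ext) !mulg1. Qed.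

Lemma ce_pV x : p x^-1%g = (p x)^-1%g.
Proof. by apply: (mulgI (p x)); rewrite -(ce_pM ext) !mulgV ce_p1. Qed.

Lemma ce_p_iota a : p (iota a) = 1%g.
Proof. by apply/(ce_exact ext); exists a. Qed.

Lemma ce_iota0 : iota 0 = 1%g.
Proof. by apply: (mulgI (iota 0)); rewrite -(ce_iotaD ext) addr0 mulg1. Qed.

Lemma ce_iotaN a : iota (- a) = (iota a)^-1%g.
Proof. by apply: (mulgI (iota a)); rewrite -(ce_iotaD ext) subrr mulgV ce_iota0. Qed.

Definition fiber_coord (x : E) : A := xget 0 [set a | iota a = x].

Lemma fiber_coordK x : p x = 1%g -> iota (fiber_coord x) = x.
Proof. by move=> /(ce_exact ext)[a ax]; apply: (@xgetPex _ 0 [set a | iota a = x]); exists a. Qed.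

Definition section_of (g : G) : E := xget 1%g [set x | p x = g].

Lemma section_ofK g : p (section_of g) = g.
Proof. exact: (xgetPex 1%g (ce_surj ext g)). Qed.
End CentralExtension.

(* A permutation model of the extension group: on the points [Z] where A acts
   honestly and freely, quotienting by A gives a permutation model of G, and
   trivialising the free A-action along a transversal gives the coordinates
   [coord] and the A-valued cocycle [shift]. *)
Section Descent.
Context (A : finZmodType) (E G : groupType) (iota : A -> E) (p : E -> G).
Hypothesis ext : central_extension iota p.
Context (k : nat) (s : E -> 'S_k).
Implicit Types (x : 'I_k) (a b c : A) (g : G) (e : E).

Let al a := s (iota a).
Let sec := section_of p.

Definition free_part : {set 'I_k} :=
  [set x | [forall a, forall b, al a (al b x) == al (a + b) x] &&
           [forall a, (a != 0) ==> (al a x != x)]].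
Local Notation Z := free_part.

Lemma free_partM x a b : x \in Z -> al a (al b x) = al (a + b) x.
Proof. by rewrite inE => /andP[/forallP/(_ a)/forallP/(_ b)/eqP]. Qed.

Lemma free_partF x a : x \in Z -> al a x = x -> a = 0.
Proof.
rewrite inE => /andP[_ /forallP/(_ a)] + /eqP ax.
by rewrite ax implybF negbK => /eqP.
Qed.

Lemma free_part0 x : x \in Z -> al 0 x = x.
Proof. by move=> xZ; apply: (@perm_inj _ (al 0)); rewrite free_partM// addr0. Qed.

Lemma free_part_al x c : x \in Z -> al c x \in Z.
Proof.
move=> xZ; rewrite inE; apply/andP; split.
  by apply/forallP => a; apply/forallP => b; rewrite !(free_partM _ _ xZ) addrA.
apply/forallP => a; apply/implyP; apply: contraNneq => acx; apply/eqP.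
apply: (@free_partF x) => //.
have := congr1 (al (- c)) acx; rewrite !(free_partM _ _ xZ).
by rewrite addrC addrK addNr free_part0.
Qed.

Let orb x := [set al a x | a : A].
Let rp x := odflt x [pick z in orb x].

Let orb_al x c : x \in Z -> orb (al c x) = orb x.
Proof.
move=> xZ; apply/setP => z; apply/imsetP/imsetP => -[a _ ->].
  by exists (a + c); rewrite ?inE// free_partM.
by exists (a - c); rewrite ?inE// free_partM// subrK.
Qed.

Let rpP x : exists2 a, x \in Z -> rp x = al a x & True.
Proof.
rewrite /rp; case: pickP => /= [z /imsetP[a _ ->]|].
  by exists a.
by move=> h; have := h (al 0 x); rewrite imset_f// inE.
Qed.

Let rp_al x c : x \in Z -> rp (al c x) = rp x.
Proof.
move=> xZ; rewrite /rp orb_al//; case: pickP => //= h.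
by have := h (al 0 x); rewrite imset_f// inE.
Qed.

Definition transversal : {set 'I_k} := [set x in Z | rp x == x].
Local Notation m := #|transversal|.

Definition coord (y : 'I_m) a : 'I_k := al a (enum_val y).

Let tZ (y : 'I_m) : enum_val y \in Z.
Proof. by have := enum_valP y; rewrite inE => /andP[]. Qed.

Lemma coord_free y a : coord y a \in Z.
Proof. exact: free_part_al. Qed.

Lemma coord_al y a b : s (iota b) (coord y a) = coord y (b + a).
Proof. by rewrite /coord -/(al b) free_partM. Qed.

Lemma coord_inj y y' a a' : coord y a = coord y' a' -> y = y' /\ a = a'.
Proof.
rewrite /coord => e; have yy' : y = y'.
  apply: enum_val_inj; have := congr1 rp e; rewrite !rp_al//.
  have := enum_valP y; have := enum_valP y'; rewrite !inE.
  by move=> /andP[_ /eqP ->] /andP[_ /eqP ->].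
split=> //; subst y'; apply/eqP; rewrite -subr_eq0; apply/eqP.
apply: (@free_partF (enum_val y)) => //.
have := congr1 (al (- a')) e; rewrite !free_partM// addNr free_part0//.
by rewrite addrC.
Qed.

Lemma coord_surj x : x \in Z -> exists y a, coord y a = x.
Proof.
move=> xZ; have [a /(_ xZ) rx _] := rpP x.
have rT : rp x \in transversal.
  by rewrite inE rx free_part_al//= rp_al// rx.
exists (enum_rank_in rT (rp x)), (- a); rewrite /coord enum_rankK_in// rx.
by rewrite free_partM// addNr free_part0.
Qed.

Lemma card_free_part : #|Z| = (m * #|A|)%N.
Proof.
rewrite -[m in RHS]card_ord -card_prod -(card_imset predT (f := fun ya : 'I_m * A => coord ya.1 ya.2)).
  apply: eq_card => x; apply/idP/imsetP => [xZ|[[y a] _ ->]]; last exact: coord_free.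
  by have [y [a <-]] := coord_surj xZ; exists (y, a).
by move=> [y a] [y' a'] /coord_inj[/= -> ->].
Qed.

Definition equivariant_part e : {set 'I_k} :=
  [set x in Z | (s e x \in Z) && [forall a, s e (al a x) == al a (s e x)]].

Let step e (y : 'I_m) : 'I_m :=
  odflt y [pick y' | [exists b, s e (coord y 0) == coord y' b]].

Let stepP e y : coord y 0 \in equivariant_part e ->
  exists b, s e (coord y 0) = coord (step e y) b.
Proof.
rewrite inE => /and3P[_ sZ _]; rewrite /step; case: pickP => /= [y' /existsP[b /eqP]|h].
  by exists b.
by have [y' [b yb]] := coord_surj sZ; have /existsP[] := h y'; exists b; rewrite yb.
Qed.

Let step_inj e : {in [set y | coord y 0 \in equivariant_part e]%SET &, injective (step e)}.
Proof.
move=> y y'; rewrite inE => yW; rewrite inE => y'W; have [b yb] := stepP yW; have [b' yb'] := stepP y'W.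
move=> yy'; rewrite -yy' in yb'.
(* By equivariance the point of the orbit of [y] with coordinate [b' - b] has the same image as
   [coord y' 0]. *)
have : s e (coord y' 0) = s e (coord y (b' - b)).
  rewrite yb'; have := yW; rewrite inE => /and3P[_ _ /forallP/(_ (b' - b))/eqP].
  by rewrite yb /al !coord_al subrK addr0 => ->.
by move/perm_inj/coord_inj => -[].
Qed.

(** A sofic approximation consists of permutations, whereas [step] is known to be injective only
    where the lift of [g] is equivariant; elsewhere the extension is arbitrary. *)
Definition quotient_perm (g : G) : 'S_m := projT1 (cid (perm_extend (@step_inj (sec g)))).

Let quotient_permE g y : coord y 0 \in equivariant_part (sec g) ->
  quotient_perm g y = step (sec g) y.
Proof. by move=> yW; rewrite /quotient_perm; case: cid => t /= h; apply: h; rewrite inE. Qed.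

Definition shift e (y : 'I_m) : A :=
  odflt 0 [pick b | s e (coord y 0) == coord (quotient_perm (p e) y) b].

Let rest e : A := fiber_coord iota ((sec (p e))^-1 * e)%g.

(** [quotient_perm] is defined through the chosen lift of [p e], so two things can go wrong at [e]:
    this lift may fail to respect the A-orbits, or [s e] may differ from the lift composed with the
    element [rest e] of A. *)
Definition bad_points e : {set 'I_k} :=
  ~: equivariant_part (sec (p e)) :&: Z :|:
  [set x | s e x != s (sec (p e)) (s (iota (rest e)) x)].

Definition good e (y : 'I_m) : Prop :=
  forall a, s e (coord y a) = coord (quotient_perm (p e) y) (a + shift e y).

Definition bad e : {set 'I_m} := [set y | [exists a, coord y a \in bad_points e]].

Lemma goodP e y : y \notin bad e -> good e y.
Proof.
rewrite inE negb_exists => /forallP nb.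
have yW : coord y 0 \in equivariant_part (sec (p e)).
  have := nb 0; rewrite finset.in_setU finset.in_setI finset.in_setC coord_free andbT.
    by rewrite negb_or negbK => /andP[].
have [b yb] := stepP yW; rewrite -quotient_permE// in yb.
have W : forall a, s (sec (p e)) (al a (coord y 0)) = al a (s (sec (p e)) (coord y 0)).
  by move=> a; have := yW; rewrite inE => /and3P[_ _ /forallP/(_ a)/eqP].
have E1 a : s e (coord y a) = coord (quotient_perm (p e) y) (a + (rest e + b)).
  have := nb a; rewrite finset.in_setU negb_or => /andP[_].
  rewrite inE negbK => /eqP ->.
  have -> : s (iota (rest e)) (coord y a) = al (rest e + a) (coord y 0).
    by rewrite /al !coord_al addr0.
  rewrite W yb /al coord_al.
  by rewrite addrA (addrC a).
rewrite /good => a; rewrite E1; congr (coord _ (a + _)).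
rewrite /shift E1 add0r; case: pickP => /= [b' /eqP/coord_inj[]//|/(_ (rest e + b))].
by rewrite eqxx.
Qed.

Lemma card_bad e : (#|bad e| <= #|bad_points e|)%N.
Proof.
pose f (y : 'I_m) := coord y (odflt 0 [pick a | coord y a \in bad_points e]).
rewrite -(card_imset _ (f := f)); last by move=> y y' /coord_inj[].
apply: subset_leq_card; apply/fintype.subsetP => _ /imsetP[y + ->]; rewrite inE => /existsP[a ya].
by rewrite /f; case: pickP => //= /(_ a); rewrite ya.
Qed.

Lemma good_cocycle e e' y :
  good e' y -> good e (quotient_perm (p e') y) -> good (e * e')%g y ->
  s (e * e')%g (coord y 0) = s e (s e' (coord y 0)) ->
  quotient_perm (p (e * e')%g) y = quotient_perm (p e) (quotient_perm (p e') y) /\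
  shift (e * e')%g y = shift e' y + shift e (quotient_perm (p e') y).
Proof. by move=> h1 h2 h3; rewrite h3 h1 h2 !add0r => /coord_inj[]. Qed.

Lemma good_iota a y : good (iota a) y ->
  quotient_perm 1%g y = y /\ shift (iota a) y = a.
Proof.
move=> /(_ 0); rewrite coord_al (ce_p_iota ext) add0r addr0.
by move=> /coord_inj[<- <-].
Qed.

Lemma good_fixed e y : good e y -> quotient_perm (p e) y = y ->
  s e (coord y 0) = s (iota (shift e y)) (coord y 0).
Proof. by move=> -> ->; rewrite coord_al addrC. Qed.
End Descent.

(** Density tending to 0, stated without division so that cardinalities over the different degrees
    of E and G can be compared directly, as in [small_card]. *)
Definition small (d : nat -> nat) (B : forall n, {set 'I_(d n)}) : Prop :=
  forall N : nat, \forall n \near \oo, (N * #|B n| <= d n)%N.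

Section Small.
Context (d : nat -> nat).
Implicit Types B C : forall n, {set 'I_(d n)}.

Lemma small_card (d' : nat -> nat) (B : forall n, {set 'I_(d n)})
    (B' : forall n, {set 'I_(d' n)}) (c : nat) :
  (\forall n \near \oo, (d' n <= c * d n)%N) -> (forall n, (#|B n| <= #|B' n|)%N) ->
  (0 < c)%N -> small B' -> small B.
Proof.
move=> dd BB c0 sB' N; apply: filterS2 dd (sB' (c * N)%N) => n dn Bn.
rewrite -(leq_pmul2l c0) (leq_trans _ dn)// (leq_trans _ Bn)// mulnA.
by rewrite leq_mul2l BB orbT.
Qed.

Lemma smallS B C : (forall n, B n \subset C n) -> small C -> small B.
Proof.
move=> BC sC; apply: (@small_card d B C 1) sC => // [|n]; last exact: subset_leq_card.
by apply: filterE => n; rewrite mul1n.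
Qed.

Lemma small_exists (I : finType) (B : I -> forall n, {set 'I_(d n)}) :
  (forall i, small (B i)) -> small (fun n => [set x | [exists i, x \in B i n]]%SET).
Proof.
move=> sB N; have := filter_forall _ (fun i => sB i (#|I| * N)%N).
move=> nB; near=> n; have Bn : forall i, (#|I| * N * #|B i n| <= d n)%N by near: n; exact: nB.
have [/eqP I0|I0] := posnP #|I|.
  rewrite (_ : [set x | _]%SET = finset.set0) ?cards0 ?muln0//.
  apply/setP => x; rewrite !inE; apply/negbTE/existsPn => i.
  by move: I0; rewrite (cardD1 i).
rewrite -(leq_pmul2l I0); apply: (@leq_trans (\sum_(i : I) #|I| * N * #|B i n|)).
  rewrite mulnA -big_distrr/= leq_mul2l; apply/orP; right.
  have -> : [set x | [exists i, x \in B i n]]%SET = (\bigcup_(i : I) B i n)%SET.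
    apply/setP => x; rewrite inE; apply/existsP/bigcupP => [[i xi]|[i _ xi]]; exists i => //.
  elim/big_ind2: _ => [|a b a' b' h h'|//]; first by rewrite cards0.
  by rewrite (leq_trans (leq_card_setU _ _))// leq_add.
by rewrite -[X in (_ <= X)%N]sum_nat_const; apply: leq_sum => i _.
Unshelve. all: by end_near. Qed.

Lemma smallU B C : small B -> small C -> small (fun n => B n :|: C n)%SET.
Proof.
move=> sB sC; apply: smallS (small_exists (B := fun b : bool => if b then B else C) _); last by case.
by move=> n; apply/fintype.subsetP => x; rewrite !inE => /orP[] xB;
  apply/existsP; [exists true | exists false].
Qed.

Lemma small_preim B (t : forall n, 'S_(d n)) :
  small B -> small (fun n => t n @^-1: B n)%SET.
Proof.
move=> sB; apply: (@small_card d _ B 1) sB => // [|n].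
  by apply: filterE => n; rewrite mul1n.
rewrite -(card_imset _ (@perm_inj _ (t n))); apply: subset_leq_card.
by apply/fintype.subsetP => _ /imsetP[x + ->]; rewrite inE.
Qed.

Context (R : realType).
Hypothesis d0 : forall n, (0 < d n)%N.

Lemma small_cvg B : small B <-> (#|B n|%:R / (d n)%:R : R) @[n --> \oo] --> (0 : R).
Proof.
split=> [sB|].
  apply/cvgr0Pnorm_le => e e0 /=.
  apply: filterS (sB (Num.truncn e^-1).+1) => n hn.
  rewrite ger0_norm ?divr_ge0// ler_pdivrMr ?ltr0n//.
  have : ((Num.truncn e^-1).+1%:R * #|B n|%:R <= (d n)%:R :> R) by rewrite -natrM ler_nat.
  move=> h; rewrite -(ler_pM2l (x := e^-1)) ?invr_gt0// mulKf ?gt_eqF//.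
  apply: le_trans h; apply: ler_wpM2r => //.
  by rewrite ltW// Num.Theory.truncnS_gt.
move=> /cvgr0Pnorm_le c [|N]; first by apply: filterE => n; rewrite mul0n.
have /c : (0 : R) < N.+1%:R^-1 by rewrite invr_gt0 ltr0n.
apply: filterS => n; rewrite ger0_norm ?divr_ge0// ler_pdivrMr ?ltr0n//.
by rewrite ler_pdivlMl ?ltr0n// -natrM ler_nat.
Qed.

Lemma small_hamming (s t : forall n, 'S_(d n)) :
  small (fun n => [set x | s n x != t n x]%SET) <->
  hamming R (s n) (t n) @[n --> \oo] --> (0 : R).
Proof.
rewrite small_cvg; set f := (fun n => _); set g := (fun n => _).
suff -> : f = g by [].
by apply/funext => n; rewrite /f /g /hamming; congr (_%:R / _); apply: eq_card => x; rewrite !inE.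
Qed.

Lemma small_fixed (s : forall n, 'S_(d n)) :
  small (fun n => [set x | s n x == x]%SET) <->
  hamming R 1%g (s n) @[n --> \oo] --> (1 : R).
Proof.
rewrite small_cvg; set f := (fun n => _); set g := (fun n => _).
have fg : f = fun n => 1 - g n.
  apply/funext => n; rewrite /f /g /hamming.
  have := cardC [pred x | s n x == x]; rewrite card_ord => e.
  have -> : #|[set x | s n x == x]%SET| = #|[pred x | s n x == x]|.
    by apply: eq_card => x; rewrite !inE.
  have -> : #|[pred i | (1%g : 'S_(d n)) i != s n i]| = #|predC [pred x | s n x == x]|.
    by apply: eq_card => x; rewrite !inE perm1 eq_sym.
  have dn : (d n)%:R != 0 :> R by rewrite pnatr_eq0 -lt0n.
  apply/eqP; rewrite eq_sym subr_eq -mulrDl -natrD e; apply/eqP; by rewrite divff.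
split=> h.
  have -> : g = fun n => 1 - f n by apply/funext => n; rewrite fg subKr.
  by rewrite -[X in _ --> X]subr0; apply: cvgB h; exact: cvg_cst.
by rewrite fg -[X in _ --> X](subrr 1); apply: cvgB h; exact: cvg_cst.
Qed.
End Small.

Lemma near_shift (P : nat -> Prop) (m : nat) :
  (\forall n \near \oo, P n) -> \forall n \near \oo, P (m + n)%N.
Proof.
by move=> [N _ NP]; exists N => // n Nn; apply: NP => /=; rewrite (leq_trans Nn)// leq_addl.
Qed.

(** * The quotient of a sofic approximation by the central subgroup *)

Section SoficDescent.
Context (R : realType) (A : finZmodType) (E G : groupType).
Context (iota : A -> E) (p : E -> G) (ext : central_extension iota p).
Context (d : nat -> nat) (s : forall n, E -> 'S_(d n)).
Hypothesis d0 : forall n, (0 < d n)%N.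
Hypothesis smul : forall e e',
  small (fun n => [set x | s n (e * e')%g x != s n e (s n e' x)]%SET).
Hypothesis sfree : forall e, e <> 1%g -> small (fun n => [set x | s n e x == x]%SET).

(** As A is finite, [free_part] is defined by finitely many conditions, each of which holds outside
    a small set. *)
Lemma small_not_free : small (fun n => ~: free_part iota (s n))%SET.
Proof.
pose B1 (ab : A * A) n : {set 'I_(d n)} :=
  [set x | s n (iota ab.1 * iota ab.2)%g x != s n (iota ab.1) (s n (iota ab.2) x)]%SET.
pose B2 (a : A) n : {set 'I_(d n)} := [set x | (a != 0) && (s n (iota a) x == x)]%SET.
have s1 : small (fun n => [set x | [exists i, x \in B1 i n]]%SET).
  by apply: small_exists => ab; exact: smul.
have s2 : small (fun n => [set x | [exists i, x \in B2 i n]]%SET).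
  apply: small_exists => a; have [a0|na0] := eqVneq a 0.
    move=> N; apply: filterE => n; rewrite (_ : B2 a n = finset.set0) ?cards0 ?muln0//.
    by apply/setP => x; rewrite !inE a0 eqxx.
  have ia : iota a <> 1%g by rewrite -(ce_iota0 ext) => /(ce_inj ext); exact/eqP.
  by apply: smallS (sfree ia) => n; apply/fintype.subsetP => x; rewrite !inE => /andP[].
apply: smallS (smallU s1 s2) => n; apply/fintype.subsetP => x.
rewrite !inE negb_and => /orP[] /existsP[a].
  move=> /existsP[b ab]; apply/orP; left; apply/existsP; exists (a, b).
  by rewrite inE/= -(ce_iotaD ext) eq_sym.
rewrite negb_imply negbK => ha; apply/orP; right; apply/existsP; exists a.
by rewrite inE.
Qed.

Lemma small_bad_points e : small (fun n => bad_points iota p (s n) e).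
Proof.
(* Used for the relation between an element of A and the chosen lift, which commute in E. *)
have seq e1 e2 e3 e4 : (e1 * e2 = e3 * e4)%g ->
    small (fun n => [set x | s n e1 (s n e2 x) != s n e3 (s n e4 x)]%SET).
  move=> ee; apply: smallS (smallU (smul e1 e2) (smul e3 e4)) => n.
  apply/fintype.subsetP => x; rewrite !inE ee; apply: contraNT.
  by rewrite negb_or !negbK => /andP[/eqP <- /eqP <-].
apply: smallU.
  set e' := section_of p (p e).
  pose B a n : {set 'I_(d n)} :=
    [set x | s n e' (s n (iota a) x) != s n (iota a) (s n e' x)]%SET.
  have s1 : small (fun n => [set x | [exists i, x \in B i n]]%SET).
    by apply: small_exists => a; apply: seq; rewrite (ce_central ext).
  have s2 := small_preim (fun n => s n e') small_not_free.
  apply: smallS (smallU s1 s2) => n; apply/fintype.subsetP => x.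
  rewrite finset.in_setI finset.in_setC => /andP[+ xZ].
  rewrite finset.in_set xZ/= negb_and finset.in_setU => /orP[h|/existsP[a ha]].
    by apply/orP; right; rewrite finset.in_set finset.in_setC.
  by apply/orP; left; rewrite finset.in_set; apply/existsP; exists a; rewrite inE.
pose e' := section_of p (p e).
apply: smallS (smul e' (iota (fiber_coord iota (e'^-1 * e)%g))) => n.
apply/fintype.subsetP => x; rewrite !finset.in_set (fiber_coordK ext) ?mulVKg//.
by rewrite (ce_pM ext) (ce_pV ext) (section_ofK ext) mulVg.
Qed.

(** With this bound the degree of the quotient is at least [d n] divided by [2 * #|A|], so small
    sets stay small, and the transversal is nonempty at every index. *)
Hypothesis dZ : forall n, (d n <= 2 * #|free_part iota (s n)|)%N.

Let m n := #|transversal iota (s n)|.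
Let tau n : G -> 'S_(m n) := quotient_perm iota p (s n).

Lemma transversal_gt0 n : (0 < m n)%N.
Proof.
by have := leq_trans (d0 n) (dZ n); rewrite card_free_part !muln_gt0 => /andP[_ /andP[]].
Qed.

Let dm : \forall n \near \oo, (d n <= 2 * #|A| * m n)%N.
Proof.
by apply: filterE => n; rewrite -mulnA (mulnC #|A|) -card_free_part dZ.
Qed.

Let A0 : (0 < 2 * #|A|)%N.
Proof. by rewrite muln_gt0 /=; apply/card_gt0P; exists 0. Qed.

Lemma small_bad e : small (fun n => bad iota p (s n) e).
Proof.
exact: (small_card dm (fun n => card_bad iota p (s n) e) A0 (small_bad_points e)).
Qed.

Lemma small_coord (B : forall n, {set 'I_(d n)}) : small B ->
  small (fun n => [set y : 'I_(m n) | coord y 0 \in B n]%SET).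
Proof.
move=> sB; apply: (small_card dm _ A0 sB) => n.
rewrite -(card_imset _ (f := fun y : 'I_(m n) => coord y 0)); last first.
  by move=> y y' /coord_inj[].
by apply: subset_leq_card; apply/fintype.subsetP => _ /imsetP[x + ->]; rewrite inE.
Qed.

Lemma small_not_cocycle e e' : small (fun n => [set y : 'I_(m n) |
  ~~ ((tau n (p (e * e')%g) y == tau n (p e) (tau n (p e') y)) &&
      (shift p (e * e')%g y == shift p e' y + shift p e (tau n (p e') y)))]%SET).
Proof.
apply: smallS (smallU (smallU (small_bad e') (small_preim (fun n => tau n (p e')) (small_bad e)))
  (smallU (small_bad (e * e')%g) (small_coord (smul e e')))) => n.
apply/fintype.subsetP => y; rewrite finset.in_set; apply: contraNT.
rewrite !finset.in_setU !negb_or => /andP[/andP[/goodP h1 h2] /andP[/goodP h3 h4]].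
move: h2; rewrite inE => /goodP h2; move: h4; rewrite !inE negbK => /eqP h4.
by have [-> ->] := good_cocycle h1 h2 h3 h4; rewrite !eqxx.
Qed.

Lemma small_not_iota a : small (fun n => [set y : 'I_(m n) |
  ~~ ((tau n 1%g y == y) && (shift p (iota a) y == a))]%SET).
Proof.
apply: smallS (small_bad (iota a)) => n; apply/fintype.subsetP => y.
by rewrite finset.in_set; apply: contraNT => /goodP/(good_iota ext)[-> ->]; rewrite !eqxx.
Qed.

Lemma quotient_mul g h : hamming R (tau n (g * h)%g) (tau n h * tau n g)%g
  @[n --> \oo] --> (0 : R).
Proof.
apply/(small_hamming R transversal_gt0).
apply: smallS (small_not_cocycle (section_of p g) (section_of p h)) => n.
apply/fintype.subsetP => y; rewrite !finset.in_set permM (ce_pM ext) !(section_ofK ext).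
by apply: contra => /andP[].
Qed.

(** If [g] fixes the A-orbit [y], a lift [e] moves the base point of the orbit as some [iota b]
    does, so [(iota b)^-1 * e] nearly fixes a point. This element is not 1, and there are finitely
    many [b]. *)
Lemma quotient_free g : g <> 1%g ->
  hamming R 1%g (tau n g) @[n --> \oo] --> (1 : R).
Proof.
move=> g1; apply/(small_fixed R transversal_gt0); pose e := section_of p g.
pose B b n : {set 'I_(d n)} :=
  ([set x | s n (iota b * ((iota b)^-1 * e))%g x != s n (iota b) (s n ((iota b)^-1 * e)%g x)]
   :|: [set x | s n ((iota b)^-1 * e)%g x == x])%SET.
have sB : small (fun n => [set x | [exists i, x \in B i n]]%SET).
  apply: small_exists => b; apply: smallU; first exact: smul.
  apply: sfree => be; apply: g1; rewrite -(section_ofK ext g) -/e.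
  by rewrite -(mulVKg (iota b) e) be mulg1 (ce_p_iota ext).
apply: smallS (smallU (small_bad e) (small_coord sB)) => n; apply/fintype.subsetP => y.
rewrite finset.in_set finset.in_setU => /eqP ty; case: (boolP (y \in bad iota p (s n) e)) => //= yb.
rewrite !finset.in_set; apply/existsP; exists (shift p e y); rewrite /B finset.in_setU.
have := good_fixed (goodP yb); rewrite {1}/e (section_ofK ext) => /(_ ty) fx.
rewrite !finset.in_set mulVKg fx (inj_eq perm_inj) eq_sym.
by case: eqP.
Qed.

Definition quotient_approx : sofic_approximation R G :=
  SoficApprox transversal_gt0 quotient_mul quotient_free.

End SoficDescent.

(** * Cocycles in limit actions *)

Section UltraproductOrder.
Context (R : realType) (I : Type) (U : set_system I) (UU : UltraFilter U).
Context (P : I -> measured_alg R).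
Notation "[u x ]" := (\pi_(uprod_type UU P) x : uprod UU P) (at level 0, format "[u  x ]").

Lemma uprod_le (x y : uprod_base P) :
  mu (x i `\` y i)%O @[i --> U] --> (0 : R) -> ([u x] <= [u y])%O.
Proof.
move=> h; rewrite leEmeet [X in X == _]umeetE; apply/eqP/upiP.
apply: ueq_squeeze h => i; rewrite mdist_ge0 /mdist.
have -> : ((x i `&` y i) `|` x i)%O = x i by rewrite joinC meetKU.
have -> : ((x i `&` y i) `&` x i)%O = (x i `&` y i)%O by rewrite meetAC meetxx.
rewrite -[in X in X - _](joinIB (y i) (x i)) mu_disjoint; last exact: meetIB.
by rewrite addrAC subrr add0r lexx.
Qed.

Lemma uprod_bigjoin (J : Type) (r : seq J) (C : pred J) (x : J -> uprod_base P) :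
  (\join_(j <- r | C j) [u x j])%O = [u fun i => \join_(j <- r | C j) x j i]%O.
Proof.
elim: r => [|j r IH]; first by rewrite big_nil; apply: upi_ext => i; rewrite big_nil.
rewrite big_cons IH; case: ifP => Cj; last by apply: upi_ext => i; rewrite big_cons Cj.
by rewrite [LHS]ujoinE; apply: upi_ext => i; rewrite big_cons Cj.
Qed.
End UltraproductOrder.

(** [B e a] is the set where an element beta(e) of P(A) takes the value [a]. The third clause is the
    crossed homomorphism rule beta(e e') = beta(e) + p(e) beta(e'), the fourth says that beta is the
    inclusion of constants on A. Such a beta trivialises the extension class in P(A). *)
Definition cocycle_partition (R : realType) (A : finZmodType) (E G : groupType)
    (iota : A -> E) (p : E -> G) (P : measured_galg R G) (B : E -> A -> P) : Prop :=
  [/\ forall e a b, a != b -> (B e a `&` B e b)%O = \bot%O,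
      forall e, (\join_(a : A) B e a)%O = \top%O,
      forall e e' a a', (B e a `&` gact P (p e) (B e' a') <= B (e * e')%g (a + a'))%O &
      forall a, B (iota a) a = \top%O].

Lemma mhom_bigjoin (R : realType) (P Q : measured_alg R) (f : measured_hom P Q)
    (J : Type) (r : seq J) (C : pred J) (x : J -> P) :
  f (\join_(j <- r | C j) x j)%O = (\join_(j <- r | C j) f (x j))%O.
Proof. by apply: big_morph; [exact: mhomU | exact: mhom_bot]. Qed.

Lemma mhom_le (R : realType) (P Q : measured_alg R) (f : measured_hom P Q) (x y : P) :
  (x <= y)%O -> (f x <= f y)%O.
Proof. by rewrite !leEmeet -mhomI => /eqP ->. Qed.

Lemma cocycle_partition_contained (R : realType) (A : finZmodType) (E G : groupType)
    (iota : A -> E) (p : E -> G) (P Q : measured_galg R G) (B : E -> A -> P) :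
  contained P Q -> cocycle_partition iota p B ->
  exists B' : E -> A -> Q, cocycle_partition iota p B'.
Proof.
move=> [f fe] [d j c i]; exists (fun e a => f (B e a)); split.
- by move=> e a b ab; rewrite -mhomI d// mhom_bot.
- by move=> e; rewrite -mhom_bigjoin j mhom_top.
- by move=> e e' a a'; rewrite -fe -mhomI; apply: mhom_le.
- by move=> a; rewrite i mhom_top.
Qed.

Lemma count_mu_le (R : realType) (n : nat) (X : set 'I_n) (D : {set 'I_n}) :
  (forall x, X x -> x \in D) -> count_mu R X <= #|D|%:R / n%:R.
Proof.
move=> XD; rewrite /count_mu.
have cardE (C : pred 'I_n) : #|` fset_set [set x | C x]| = #|C|.
  rewrite -card_finset; congr #|` _|; apply/fsetP => x.
  rewrite in_fset_set; last exact: finite_finset.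
  by rewrite !inE; apply/asboolP/idP.
have -> : [set: 'I_n] = [set x | predT x] by apply/seteqP.
rewrite cardE card_ord ler_wpM2r ?invr_ge0// ler_nat -(cardE (mem D)).
apply/fsubset_leq_card/fsubsetP => x.
by rewrite !in_fset_set ?inE; [exact: XD | exact: finite_finset | exact: finite_finset].
Qed.

Section LimitCocycle.
Context (R : realType) (A : finZmodType) (E G : groupType).
Context (iota : A -> E) (p : E -> G) (ext : central_extension iota p).
Context (d : nat -> nat) (s : forall n, E -> 'S_(d n)).
Hypothesis d0 : forall n, (0 < d n)%N.
Hypothesis smul : forall e e',
  small (fun n => [set x | s n (e * e')%g x != s n e (s n e' x)]%SET).
Hypothesis sfree : forall e, e <> 1%g -> small (fun n => [set x | s n e x == x]%SET).
Hypothesis dZ : forall n, (d n <= 2 * #|free_part iota (s n)|)%N.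
Context (U : set_system nat) (UU : UltraFilter U) (Unp : nonprincipal U).

Let S : sofic_approximation R G := quotient_approx R ext d0 smul sfree dZ.
Let tau n : G -> 'S_(sa_deg S n) := sa_map S n.

Let limit_le (x y : uprod_base (perm_alg S)) (D : forall n, {set 'I_(sa_deg S n)}) :
  (forall n z, (x n : set _) z -> ~ (y n : set _) z -> z \in D n) -> small D ->
  (\pi_(uprod_type UU (perm_alg S)) x <= (\pi_(uprod_type UU (perm_alg S)) y : limit_action S UU Unp))%O.
Proof.
move=> xyD sD; apply: uprod_le.
apply: (@ueq_squeeze _ _ _ _ _ (fun n => #|D n|%:R / (sa_deg S n)%:R)).
  move=> n; rewrite mu_ge0/=; apply: count_mu_le => z [xz yz]; exact: xyD xz yz.
have /(small_cvg R (sa_deg_gt0 S)) := sD.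
by apply: cvg_trans; apply: cvg_app; exact: nonprincipal_oo.
Qed.

(** The shift is indexed by the end point [z] of the move and not by its start: as sets are moved by
    direct images, this turns the rule of [good_cocycle] into the rule for a left crossed
    homomorphism. *)
Definition limit_cocycle (e : E) (a : A) : limit_action S UU Unp :=
  \pi_(uprod_type UU (perm_alg S))
    (fun n => [set z | shift p e ((tau n (p e))^-1%g z) = a]).

Lemma limit_cocycle_partition : cocycle_partition iota p limit_cocycle.
Proof.
split.
- move=> e a b ab; rewrite [LHS]umeetE; apply: upi_ext => n.
  by apply/seteqP; split=> // z [/= -> e']; rewrite e' eqxx in ab.
- move=> e; rewrite [LHS]uprod_bigjoin; apply: upi_ext => n.
  apply/eqP; rewrite eq_le lex1/= subsetEset => z _.
  have := @joins_sup _ (perm_alg S n) A (shift p e ((tau n (p e))^-1%g z)) predT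
    (fun a => [set z | shift p e ((tau n (p e))^-1%g z) = a]) isT.
  by rewrite subsetEset; apply.
- move=> e e' a a'; rewrite [X in (_ `&` X)%O]umapE [X in (X <= _)%O]umeetE.
  (* The cocycle rule concerns the starting point of two successive moves, so its exceptional set is
     transported to the end point. *)
  apply: limit_le (small_preim (fun n => (tau n (p e))^-1 * (tau n (p e'))^-1)%g
    (small_not_cocycle ext smul sfree dZ e e')) => n _ [/= <- [w <- <-]].
  apply: contra_notT; rewrite !inE permM permK negbK -/(tau n).
  set y := ((tau n (p e'))^-1)%g w => /andP[/eqP h1 /eqP h2].
  have wy : w = tau n (p e') y by rewrite permKV.
  have -> : tau n (p e) w = tau n (p (e * e')%g) y by rewrite h1 -wy.
  by rewrite permK h2 addrC wy.
- move=> a; apply/eqP; rewrite eq_le lex1/=.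
  apply: limit_le (small_preim (fun n => (tau n 1)^-1)%g (small_not_iota ext smul sfree dZ a)) => n z _.
  apply: contra_notT; rewrite !inE negbK /= (ce_p_iota ext) -/(tau n).
  by move=> /andP[_ /eqP].
Qed.
End LimitCocycle.

Lemma sofic_limit_cocycle (R : realType) (A : finZmodType) (E G : groupType)
    (iota : A -> E) (p : E -> G) (U : set_system nat) (UU : UltraFilter U)
    (Unp : nonprincipal U) :
  central_extension iota p -> sofic R E ->
  exists (S : sofic_approximation R G) (B : E -> A -> limit_action S UU Unp),
    cocycle_partition iota p B.
Proof.
move=> ext [S].
have smul e e' : small (fun n =>
    [set x | sa_map S n (e * e')%g x != sa_map S n e (sa_map S n e' x)]%SET).
  have /(small_hamming R (sa_deg_gt0 S)) := sa_mul S e e'.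
  by apply: smallS => n; apply/fintype.subsetP => x; rewrite !inE permM.
have sfree e : e <> 1%g -> small (fun n => [set x | sa_map S n e x == x]%SET).
  by move=> e1; apply/(small_fixed R (sa_deg_gt0 S)); exact: sa_free.
(* Smallness with factor 2 makes at least half of the points free from the index [N] on. The earlier
   terms are dropped, since the bound is required at every index. *)
have [N _ NZ] := small_not_free ext smul sfree 2.
have dZ n : (sa_deg S (N + n) <= 2 * #|free_part iota (sa_map S (N + n))|)%N.
  have := NZ (N + n)%N (leq_addr _ _); rewrite /= cardsCs finset.setCK card_ord.
  have := max_card (mem (free_part iota (sa_map S (N + n)))); rewrite card_ord.
  move: (sa_deg S (N + n)) #|_| => d' z; lia.
pose d n := sa_deg S (N + n); pose s n := sa_map S (N + n).
exists (@quotient_approx R A E G iota p ext d s (fun n => sa_deg_gt0 S (N + n))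
  (fun e e' K => near_shift N (smul e e' K)) (fun e e1 K => near_shift N (sfree e e1 K)) dZ).
by eexists; exact: limit_cocycle_partition.
Qed.

(** * From finite actions to finite transitive actions *)

Section FiniteAction.
Context (R : realType) (G : groupType) (Q : measured_galg R G).
Hypothesis Qfin : finite_action Q.

Definition act_kernel : {pred G} := fun g => `[< forall y, gact Q g y = y >].

Lemma act_kernel_closed : group_closed act_kernel.
Proof.
split=> [|g h /asboolP gK /asboolP hK]; apply/asboolP => y; first exact: gact1.
have hV : gact Q h^-1%g y = y by rewrite -{1}(hK y) -gactM mulVg gact1.
by rewrite gactM hV gK.
Qed.
HB.instance Definition _ := isMulClosed.Build G act_kernel (group_closedM act_kernel_closed).
HB.instance Definition _ := isMul1Closed.Build G act_kernel act_kernel_closed.1.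
HB.instance Definition _ := isInvClosed.Build G act_kernel (group_closedV act_kernel_closed).

Lemma act_kernel_finite : finite_set [set: cosets act_kernel].
Proof.
pose F : finType := fset_set [set: Q].
have QF y : y \in fset_set [set: Q] by rewrite in_fset_set// mem_setT.
pose f (c : cosets act_kernel) : {ffun F -> F} :=
  [ffun y : F => [` QF (gact Q (repr c) (val y))]%fset].
have -> : [set: cosets act_kernel] = f @^-1` [set: {ffun F -> F}] by apply/seteqP.
apply: finite_preimage; last exact: finite_finset.
move=> c c' _ _ cc'; rewrite -[c]reprK -[c']reprK; apply/eqmodP/asboolP => y.
have /ffunP/(_ [` QF y]%fset) := cc'; rewrite !ffunE => /(congr1 val)/= e.
by rewrite gactM -e -gactM mulVg gact1.
Qed.

Definition act_kernel_fis : finite_index_subgroup G := FiniteIndexSubgroup act_kernel_finite.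

(** The two representatives [g * repr c] and [repr (coset_act g c)] differ by an element of the
    kernel, which acts trivially. This gives the equivariance of cochains read along an orbit. *)
Lemma act_kernel_repr g (c : cosets act_kernel_fis) y :
  gact Q (repr (coset_act g c))^-1%g (gact Q g y) = gact Q (repr c)^-1%g y.
Proof.
have /eqmodP : \pi_(cosets act_kernel) (g * repr c)%g = \pi_(cosets act_kernel) (repr (coset_act g c)).
  by rewrite reprK.
move=> /asboolP/(_ (gact Q (repr (coset_act g c))^-1%g (gact Q g y))).
by rewrite -!gactM invMg -!mulgA mulVKg mulVg mulg1 => <-.
Qed.

Lemma fset_set_count (T : choiceType) (C : pred T) : finite_set [set: T] ->
  \sum_(c <- fset_set [set: T]) (C c)%:R = #|` fset_set [set c | C c]|%:R :> R.
Proof.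
move=> Tfin; have Cfin : finite_set [set c | C c] by exact: sub_finite_set Tfin.
rewrite card_fset_sum1 natr_sum.
have -> : fset_set [set c | C c] = [fset c in fset_set [set: T] | C c]%fset.
  apply/fsetP => c; rewrite in_fset_set// !inE in_fset_set// mem_setT andTb.
  by apply/asboolP/idP.
rewrite -big_fset_condE [RHS]big_mkcond/=; apply: eq_bigr => c _; by case: (C c).
Qed.

(* Let [h x] be the sum of [mu (x /\ g^-1 D)] over the cosets [g]. As [h] and [mu]
   are additive, a minimal [x] with [h x < eps * N * mu x] is an atom. *)
Lemma small_atom (D : Q) (eps : R) : mu D < eps ->
  exists x : Q, [/\ x != \bot%O, forall y, (x <= y)%O \/ (x `&` y)%O = \bot%O &
    count_mu R [set c : cosets act_kernel_fis | (x <= gact Q (repr c)^-1%g D)%O] < eps].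
Proof.
move=> Deps; pose T := cosets act_kernel_fis.
pose N : R := #|` fset_set [set: T]|%:R.
have N0 : 0 < N.
  rewrite ltr0n cardfs_gt0; apply/fset0Pn; have [c _] := cosets_neq0 act_kernel_fis.
  by exists c; rewrite in_fset_set ?inE//; exact: act_kernel_finite.
pose h x := \sum_(c <- fset_set [set: T]) mu (x `&` gact Q (repr c)^-1%g D)%O.
have muD (x y : Q) : mu x = mu (x `&` y)%O + mu (x `\` y)%O.
  by rewrite -[in LHS](joinIB y x) mu_disjoint//; exact: meetIB.
have hD (x y : Q) : h x = h (x `&` y)%O + h (x `\` y)%O.
  rewrite -big_split/=; apply: eq_bigr => c _.
  by rewrite [LHS](muD _ y) meetAC; congr (_ + _); rewrite !diffE meetAC.
pose K x := `[< h x < eps * N * mu x >].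
pose sz (x : Q) := #|` fset_set [set z : Q | (z <= x)%O]|.
have sfin (x : Q) : finite_set [set z : Q | (z <= x)%O] by exact: sub_finite_set Qfin.
have KT : K \top%O.
  apply/asboolP; rewrite mu_top mulr1 /h.
  under eq_bigr do rewrite meet1x mhom_mu.
  rewrite big_const_seq count_predT iter_addr addr0 -mulr_natr -/N.
  by rewrite ltr_pM2r.
have : exists n, `[< exists2 x, K x & sz x = n >].
  by exists (sz \top%O); apply/asboolP; exists \top%O.
case/ex_minnP => _ /asboolP[x Kx <-] minx.
have Kmin y : (y <= x)%O -> K y -> y = x.
  move=> yx Ky; have le : (sz x <= sz y)%N by apply: minx; apply/asboolP; exists y.
  have sub : (fset_set [set z : Q | (z <= y)%O] `<=` fset_set [set z : Q | (z <= x)%O])%fset.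
    apply/fsubsetP => z; rewrite !(in_fset_set (sfin _)) => /set_mem/= zy.
    apply/mem_set => /=; exact: le_trans zy yx.
  have /fsetP/(_ x) : fset_set [set z : Q | (z <= y)%O] = fset_set [set z : Q | (z <= x)%O].
    by apply/eqP; rewrite eqEfcard sub.
  rewrite !(in_fset_set (sfin _)) => xy.
  have {}xy : x \in [set z : Q | (z <= y)%O] by rewrite xy; apply/mem_set => /=.
  by apply/eqP; rewrite eq_le yx; exact: set_mem xy.
have atom y : (x <= y)%O \/ (x `&` y)%O = \bot%O.
  have : K (x `&` y)%O \/ K (x `\` y)%O.
    have /asboolP := Kx; rewrite (hD x y) (muD x y) => lt.
    have [|ge1] := boolP (K (x `&` y)%O); [by left | right].
    by apply/asboolP; move/asboolPn: ge1 => /negP; rewrite -leNgt; move: lt; rewrite mulrDr; lra.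
  move=> [/(Kmin _ (leIl _ _))|/(Kmin _ (leBx _ _))] e; [left|right].
    by rewrite leEmeet e.
  by rewrite meetC -e diffKI.
(* Each term of [h x] is [mu x] or 0 because [x] is an atom; dividing by [N * mu x] leaves the
   proportion of cosets. *)
have hx : h x = mu x * #|` fset_set [set c : T | (x <= gact Q (repr c)^-1%g D)%O]|%:R.
  rewrite -fset_set_count; last exact: act_kernel_finite.
  rewrite mulr_sumr; apply: eq_bigr => c _.
  have [xD|xD] := atom (gact Q (repr c)^-1%g D).
    by rewrite xD mulr1 (meet_idPl xD).
  rewrite xD mu_bot; case: (boolP (x <= _)%O) => [/meet_idPl|_]; last by rewrite mulr0.
  by rewrite xD => <-; rewrite mu_bot mul0r.
have := Kx => /asboolP; rewrite hx => lt.
have mx : 0 < mu x.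
  rewrite lt_neqAle mu_ge0 andbT eq_sym; apply: contraTneq lt => ->.
  by rewrite mul0r mulr0 ltxx.
exists x; split=> //; first by apply: contraTneq mx => ->; rewrite mu_bot ltxx.
rewrite /count_mu ltr_pdivrMr//.
by move: lt; rewrite [X in _ < X]mulrC ltr_pM2l.
Qed.
End FiniteAction.

Lemma cover_le (d : Order.disp_t) (L : tbDistrLatticeType d) (J : finType) (Y : J -> L) (z y : L) :
  (\join_j Y j)%O = \top%O -> (forall j, (Y j `&` z <= y)%O) -> (z <= y)%O.
Proof.
move=> Y1 Yz; rewrite -[z]meet1x -Y1.
rewrite (big_morph (fun x => (x `&` z)%O) (id1 := \bot%O) (op1 := Order.join)); last 2 first.
- by move=> a b; rewrite meetUl.
- by rewrite meet0x.
by apply/joinsP => j _; exact: Yz.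
Qed.

(** * Lifts of edges to the extension and the partitions attached to them *)

Section EdgeLift.
Context (R : realType) (A : finZmodType) (E G : groupType).
Context (iota : A -> E) (p : E -> G) (ext : central_extension iota p).
Context (V : Type) (phi : V -> G) (o : V -> V -> bool).
Implicit Types (v w : V).

Let base v w : E := section_of p ((phi v)^-1 * phi w)%g.

(** A section of [p] need not commute with inversion, so it is applied to one orientation of each
    edge only. The value depends on the labels through [(phi v)^-1 * phi w], which is invariant
    under left translation. *)
Definition edge_lift v w : E := if o v w then base v w else (base w v)^-1%g.

Lemma p_edge_lift v w : p (edge_lift v w) = ((phi v)^-1 * phi w)%g.
Proof.
rewrite /edge_lift; case: ifP => _; rewrite ?(ce_pV ext) (section_ofK ext)//.
by rewrite invMg invgK.
Qed.

Lemma edge_liftV v w : o w v = ~~ o v w -> edge_lift w v = (edge_lift v w)^-1%g.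
Proof. by rewrite /edge_lift => ->; case: (o v w); rewrite ?invgK. Qed.

(** The holonomy of [edge_lift] around a triangle lies over 1, hence in A; as a function of
    triangles it represents the extension class. *)
Definition face_defect v0 v1 v2 : A :=
  fiber_coord iota (edge_lift v0 v1 * edge_lift v1 v2 * edge_lift v2 v0)%g.

Lemma face_defectK v0 v1 v2 :
  iota (face_defect v0 v1 v2) = (edge_lift v0 v1 * edge_lift v1 v2 * edge_lift v2 v0)%g.
Proof.
apply: (fiber_coordK ext); rewrite !(ce_pM ext) !p_edge_lift.
by rewrite -!mulgA !mulVKg mulVg.
Qed.

Section Cocycle.
Context (P : measured_galg R G) (B : E -> A -> P).
Hypothesis Bc : cocycle_partition iota p B.

Let B1 a : a != 0 -> B 1%g a = \bot%O.
Proof.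
have [d _ _ i] := Bc; move=> a0; rewrite -[LHS]meetx1 -(i 0) (ce_iota0 ext); exact: d.
Qed.

(** The rule beta(e) + p(e) beta(e^-1) = 0. Pieces with other values meet inside some [B 1 a'] with
    [a' != 0], which is empty, so each side is covered by the other. *)
Lemma cocycle_partitionV e a : gact P (p e) (B e^-1%g (- a)) = B e a.
Proof.
have [d j c _] := Bc; apply/eqP; rewrite eq_le; apply/andP; split.
  apply: (cover_le (j e)) => a'; have [->|aa'] := eqVneq a' a; first exact: leIl.
  apply: le_trans (c _ _ _ _) _; rewrite mulgV B1 ?le0x// subr_eq0//.
have je : (\join_a gact P (p e) (B e^-1%g a))%O = \top%O by rewrite -mhom_bigjoin j mhom_top.
apply: (cover_le je) => a'; have [->|aa'] := eqVneq a' (- a); first exact: leIl.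
by rewrite meetC; apply: le_trans (c _ _ _ _) _; rewrite mulgV B1 ?le0x// addrC addr_eq0.
Qed.

Definition edge_part v w a : P := gact P (phi v) (B (edge_lift v w) a).

Lemma edge_part_cover v w : (\join_a edge_part v w a)%O = \top%O.
Proof. by have [_ j _ _] := Bc; rewrite -mhom_bigjoin j mhom_top. Qed.

(** By the crossed homomorphism rule the three edge values add up to the value of beta at the
    holonomy of the triangle, and on A that value is the constant given by the last clause of
    [cocycle_partition]. *)
Lemma edge_part_face v0 v1 v2 a0 a1 a2 : a0 + a1 + a2 != face_defect v0 v1 v2 ->
  (edge_part v0 v1 a0 `&` edge_part v1 v2 a1 `&` edge_part v2 v0 a2)%O = \bot%O.
Proof.
move=> ne; have [d _ c i] := Bc.
have e1 : phi v1 = (phi v0 * p (edge_lift v0 v1))%g by rewrite p_edge_lift mulVKg.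
have e2 : phi v2 = (phi v0 * p (edge_lift v0 v1 * edge_lift v1 v2)%g)%g.
  by rewrite (ce_pM ext) !p_edge_lift -!mulgA !mulVKg.
rewrite /edge_part e1 e2 !gactM -!mhomI.
apply/eqP; rewrite -lex0 -(mhom_bot (gact P (phi v0))); apply: mhom_le.
have <- : B (iota (face_defect v0 v1 v2)) (a0 + a1 + a2) = \bot%O.
  by rewrite -[LHS]meetx1 -(i (face_defect v0 v1 v2)) d.
rewrite face_defectK.
apply: le_trans (c _ _ _ _); apply: leI2 => //; exact: c.
Qed.
End Cocycle.
End EdgeLift.

(** * Transfer from an ultraproduct to a single factor *)

Section Transfer.
Context (R : realType) (I : Type) (U : set_system I) (UU : UltraFilter U).

(** Cutting the union of the other representatives out of each one makes disjointness exact without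
    changing the classes. *)
Lemma disjoint_reprs (P : I -> measured_alg R) (A : finType) (x : A -> uprod UU P) :
  (forall a b, a != b -> (x a `&` x b)%O = \bot%O) ->
  exists X : A -> uprod_base P,
    (forall a b i, a != b -> (X a i `&` X b i)%O = \bot%O) /\
    forall a, \pi_(uprod_type UU P) (X a) = x a.
Proof.
move=> d; pose r a := repr (x a : uprod_type UU P).
have rx a : \pi_(uprod_type UU P) (r a) = x a by rewrite reprK.
exists (fun a i => (r a i `&` ~` (\join_(b | b != a) r b i))%O); split=> [a b i ab|a].
  apply/eqP; rewrite -lex0; apply: le_trans (leI2 (leIl _ _) (leIr _ _)) _.
  rewrite -diffE leBLR joinx0.
  exact: (@joins_sup _ _ A a (fun c => c != b) (fun c => r c i)).
rewrite -[LHS]umeetE -[X in umeet _ X]ucomplE -uprod_bigjoin rx -[LHS]/(x a `&` ~` _)%O.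
rewrite -diffE; apply/eqP; rewrite eq_le leBx/=.
suff e : (x a `&` \join_(b | b != a) \pi_(uprod_type UU P) (r b))%O = \bot%O.
  rewrite -[X in (X <= _)%O](joinIB (\join_(b | b != a) \pi_(uprod_type UU P) (r b))%O (x a)).
  by rewrite e join0x.
rewrite (big_morph (fun y => (x a `&` y)%O) (id1 := \bot%O) (op1 := Order.join)).
- by apply: big1 => b ab; rewrite rx d// eq_sym.
- by move=> y z; rewrite meetUr.
- by rewrite meetx0.
Qed.

Lemma uprod_bot_mu (P : I -> measured_alg R) (x : uprod_base P) (eps : R) :
  \pi_(uprod_type UU P) x = (\bot%O : uprod UU P) -> 0 < eps ->
  \forall i \near U, mu (x i) < eps.
Proof.
move=> x0 e0; have := @umu_cvg R I U UU P x; rewrite x0 [umu _](@umu_bot R I U UU P).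
move=> /cvgr0Pnorm_lt/(_ _ e0); apply: filterS => i; apply: le_lt_trans; exact: ler_norm.
Qed.
End Transfer.

(** Disjointness, equivariance and antisymmetry are exact in the factor. The sets need not cover,
    and the triangle equations may fail; for the listed triangles both defects are absorbed by
    [D]. *)
Lemma finite_action_model (R : realType) (A : finZmodType) (E G : groupType)
    (iota : A -> E) (p : E -> G) (ext : central_extension iota p)
    (V : Type) (act : G -> V -> V) (phi : V -> G) (o : V -> V -> bool)
    (phi_act : forall g v, phi (act g v) = (g * phi v)%g)
    (o_act : forall g v w, o (act g v) (act g w) = o v w)
    (P : measured_galg R G) (B : E -> A -> P) (Bc : cocycle_partition iota p B)
    (F : measured_galg R G -> Prop) (PF : weakly_contained P F)
    (J : eqType) (r : seq J) (t0 t1 t2 : J -> V) (eps : R) (eps0 : 0 < eps) :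
  exists (Q : measured_galg R G) (Y : V -> V -> A -> Q) (D : Q),
    [/\ F Q, mu D < eps, forall v w a b, a != b -> (Y v w a `&` Y v w b)%O = \bot%O,
        forall g v w a, Y (act g v) (act g w) a = gact Q g (Y v w a) &
        (forall v w a, o w v = ~~ o v w -> Y w v (- a) = Y v w a) /\
        (forall j, j \in r -> (~` D <=
           \join_(a : A * A * A | (a.1.1 + a.1.2 + a.2)%R ==
               face_defect iota p phi o (t0 j) (t1 j) (t2 j))
             (Y (t0 j) (t1 j) a.1.1 `&` Y (t1 j) (t2 j) a.1.2 `&` Y (t2 j) (t0 j) a.2))%O)].
Proof.
have [I [U [UU [Q [Unp FQ PQ]]]]] := PF.
have [B' B'c] := cocycle_partition_contained PQ Bc.
have [d _ _ _] := B'c.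
have /choice[X Xp] : forall e, exists X : A -> uprod_base Q,
    (forall a b i, a != b -> (X a i `&` X b i)%O = \bot%O) /\
    forall a, \pi_(uprod_type UU Q) (X a) = B' e a.
  by move=> e; apply: disjoint_reprs => a b; exact: d.
pose s v w := section_of p ((phi v)^-1 * phi w)%g.
(* Reversed edges reuse the sets of the oriented ones with the opposite index; independent
   representatives would be antisymmetric only up to small measure. *)
pose Y v w a : uprod_base Q := fun i =>
  if o v w then gact (Q i) (phi v) (X (s v w) a i) else gact (Q i) (phi w) (X (s w v) (- a) i).
have YE v w a : \pi_(uprod_type UU Q) (Y v w a) = edge_part p phi o B' v w a.
  rewrite /edge_part /Y; have := p_edge_lift ext phi o v w; rewrite /edge_lift.
  case: (o v w) => pe; first by rewrite -/(s v w) -(Xp _).2 [RHS]umapE.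
  rewrite -(cocycle_partitionV ext B'c) -gactM pe mulVKg invgK -/(s w v) -(Xp _).2.
  by rewrite [RHS]umapE.
pose good j i := (\join_(a : A * A * A | (a.1.1 + a.1.2 + a.2)%R ==
      face_defect iota p phi o (t0 j) (t1 j) (t2 j))
   (Y (t0 j) (t1 j) a.1.1 i `&` Y (t1 j) (t2 j) a.1.2 i `&` Y (t2 j) (t0 j) a.2 i))%O.
have goodE j : \pi_(uprod_type UU Q) (good j) = (\top%O : uprod UU Q).
  rewrite -[LHS]uprod_bigjoin; apply/eqP; rewrite eq_le lex1/=.
  apply: (cover_le (edge_part_cover phi o B'c (t2 j) (t0 j))) => a2.
  apply: (cover_le (edge_part_cover phi o B'c (t1 j) (t2 j))) => a1.
  apply: (cover_le (edge_part_cover phi o B'c (t0 j) (t1 j))) => a0.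
  rewrite meetx1 meetA.
  have [ga|] := eqVneq (a0 + a1 + a2) (face_defect iota p phi o (t0 j) (t1 j) (t2 j)); last first.
    by move=> ne; rewrite (edge_part_face ext B'c ne) le0x.
  apply: le_trans (joins_sup (j := (a0, a1, a2)) _ _); last by rewrite /= ga.
  by rewrite -!YE /= -[X in (_ <= X)%O]umeetE -[X in (_ <= umeet X _)%O]umeetE.
(* A finite join of sets that are null in the ultraproduct, hence of measure < [eps] in some
   factor. *)
pose D i := (\join_(j <- r) ~` good j i)%O.
have DE : \pi_(uprod_type UU Q) D = (\bot%O : uprod UU Q).
  rewrite -[LHS]uprod_bigjoin; apply: big1 => j _.
  by rewrite -[LHS]ucomplE goodE; exact: compl1.
have [i Di] := @filter_ex _ U _ _ (uprod_bot_mu DE eps0).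
exists (Q i), (fun v w a => Y v w a i), (D i); split=> //.
- move=> v w a b ab; rewrite /Y; case: (o v w); rewrite -mhomI (Xp _).1 ?mhom_bot ?eqr_opp//.
- move=> g v w a; rewrite /Y o_act !phi_act /s !phi_act !invMg -!mulgA !mulKg.
  by case: (o v w); rewrite gactM.
split=> [v w a|j jr].
  by rewrite /Y => ->; case: (o v w); rewrite ?opprK.
rewrite leCx; exact: (@joins_sup_seq _ _ J r predT (fun j => (~` good j i)%O) j jr isT).
Qed.

(** * Tensors over coset algebras *)

Section ZmodMorphism.
Context (V W : zmodType) (f : V -> W) (fB : zmod_morphism f).

Let fa : {additive V -> W} := HB.pack f (GRing.isZmodMorphism.Build V W f fB).

Lemma zmod_morph0 : f 0 = 0. Proof. exact: (raddf0 fa). Qed.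
Lemma zmod_morphN x : f (- x) = - f x. Proof. exact: (raddfN fa). Qed.
Lemma zmod_morphD x y : f (x + y) = f x + f y. Proof. exact: (raddfD fa). Qed.
Lemma zmod_morphMz x n : f (x *~ n) = f x *~ n. Proof. exact: (raddfMz fa). Qed.
Lemma zmod_morph_sum (I : Type) (r : seq I) (C : pred I) (F : I -> V) :
  f (\sum_(i <- r | C i) F i) = \sum_(i <- r | C i) f (F i).
Proof. exact: (raddf_sum fa). Qed.
End ZmodMorphism.

Section Presented.
Context (K : choiceType) (rel : {freeg K} -> Prop).

Lemma presented_rel r : rel r -> \pi_(presented rel) r = 0.
Proof.
move=> rr; have -> : (0 : presented rel) = \pi_(presented rel) 0 by rewrite raddf0.
apply/eqP; rewrite -subr_eq0 -raddfB subr0 -(raddf0 (\pi_(presented rel))).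
rewrite -Quotient.idealrBE subr0; apply/asboolP => S; exact.
Qed.

Lemma presented_ext (V : zmodType) (f g : presented rel -> V) :
  zmod_morphism f -> zmod_morphism g -> (forall k, f (gen rel k) = g (gen rel k)) -> f =1 g.
Proof.
move=> fB gB fg x; rewrite -[x]reprK -(freeg_sumE (repr x)) raddf_sum.
rewrite (zmod_morph_sum fB) (zmod_morph_sum gB); apply: eq_bigr => k _.
have -> : << coeff k (repr x) *g k >> = << k >> *~ coeff k (repr x) :> {freeg K}.
  by rewrite freegU_mulz intz.
by rewrite raddfMz (zmod_morphMz fB) (zmod_morphMz gB) -/(gen rel k) fg.
Qed.
End Presented.

Section FgLift.
Context (K : choiceType) (V : zmodType) (f : K -> V).
Local Notation lift := (fglift (f : K -> zmodule V)).

Lemma fgliftB x y : lift (x - y) = lift x - lift y.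
Proof. exact: lift_is_additive. Qed.
Lemma fgliftD x y : lift (x + y) = lift x + lift y.
Proof. exact: (zmod_morphD fgliftB). Qed.
Lemma fglift1 k : lift << k >> = f k.
Proof. by rewrite liftU scale1r. Qed.
Lemma fgliftMz x n : lift (x *~ n) = lift x *~ n.
Proof. exact: (zmod_morphMz fgliftB). Qed.
End FgLift.

Section Tensor.
Context (R : realType) (P : measured_alg R) (A : finZmodType).
Implicit Types (X Y : P) (a b : A).

Lemma pure_relation X Y a b :
  pure X a + pure Y b = pure (X `\` Y)%O a + pure (Y `\` X)%O b + pure (X `&` Y)%O (a + b).
Proof.
apply/eqP; rewrite -subr_eq0 /pure /gen -!raddfD -raddfB; apply/eqP/presented_rel.
by exists X, Y, a, b.
Qed.

Lemma pure_bot a : pure (\bot%O : P) a = 0.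
Proof.
have := pure_relation \bot%O \bot%O a 0; rewrite !diff0x meet0x addr0.
by rewrite -[X in X = _]addr0 => /addrI/esym.
Qed.

Lemma pureD X a b : pure X (a + b) = pure X a + pure X b.
Proof. by rewrite pure_relation meetxx !diffxx !pure_bot !add0r. Qed.

Lemma pure0 X : pure X (0 : A) = 0.
Proof. by apply: (addrI (pure X 0)); rewrite -pureD !addr0. Qed.

Lemma pureN X a : pure X (- a) = - pure X a.
Proof. by apply/eqP; rewrite -addr_eq0 -pureD addNr pure0. Qed.

Lemma pureU X Y a : (X `&` Y)%O = \bot%O -> pure (X `|` Y)%O a = pure X a + pure Y a.
Proof.
move=> XY; have := pure_relation (X `|` Y)%O Y a 0; rewrite pure0 !addr0.
have -> : ((X `|` Y) `\` Y)%O = X by rewrite joinBK; apply: disj_diffl; apply/eqP.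
have -> : ((X `|` Y) `&` Y)%O = Y by rewrite meetC joinKIC.
by move=> ->; rewrite pure0 addr0.
Qed.
End Tensor.

Section TensorAction.
Context (R : realType) (G : groupType) (P : measured_galg R G) (A : finZmodType).

Lemma mhom_diff (Q Q' : measured_alg R) (f : measured_hom Q Q') x y :
  f (x `\` y)%O = (f x `\` f y)%O.
Proof.
apply/esym/eqP; rewrite eq_diff -mhomU diffKU -mhomI diffIK mhom_bot eqxx andbT.
by apply/andP; split; apply: mhom_le; rewrite ?leBx ?leUr.
Qed.

Lemma act_relation g (r : {freeg P * A}) : @tensor_rel R P A r ->
  fglift ((fun Xa => pure (gact P g Xa.1) Xa.2) : P * A -> zmodule (tensor P A)) r = 0.
Proof.
move=> [X [Y [a [b ->]]]]; rewrite fgliftB !fgliftD !fglift1 /= !mhom_diff mhomI.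
by rewrite pure_relation subrr.
Qed.

Lemma tensor_act_zmod g : zmod_morphism (@tensor_act R G P A g).
Proof. exact: presented_lift_zmod_morphism (@act_relation g). Qed.

Lemma tensor_act_pure g X (a : A) : tensor_act g (pure X a) = pure (gact P g X) a.
Proof. exact: presented_lift_gen (@act_relation g) _. Qed.
End TensorAction.

Section CosetTensor.
Context (R : realType) (G : groupType) (L : finite_index_subgroup G) (A : finZmodType).
Local Notation C := (cosets L).
Local Notation P := (coset_galg R L).
Implicit Types (F : C -> A) (c : C).

Let all_cosets := fset_set [set: C].

Let mem_cosets c : c \in all_cosets.
Proof. by rewrite in_fset_set ?inE//; exact: fis_finite. Qed.

(** Over the subsets of a finite set, P(A) is the group of A-valued functions: this is the tensor of
    a function, and [tensor_eval] recovers its values. *)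
Definition coset_tensor F : tensor P A := \sum_(c <- all_cosets) pure ([set c] : P) (F c).

Lemma coset_tensorB F F' : coset_tensor (fun c => F c - F' c) = coset_tensor F - coset_tensor F'.
Proof. by rewrite /coset_tensor -sumrB; apply: eq_bigr => c _; rewrite pureD pureN. Qed.

Lemma coset_tensorD F F' : coset_tensor (fun c => F c + F' c) = coset_tensor F + coset_tensor F'.
Proof. by rewrite /coset_tensor -big_split/=; apply: eq_bigr => c _; rewrite pureD. Qed.

Lemma coset_tensorN F : coset_tensor (fun c => - F c) = - coset_tensor F.
Proof. by rewrite /coset_tensor -sumrN; apply: eq_bigr => c _; rewrite pureN. Qed.

Lemma coset_tensor_ext F F' : F =1 F' -> coset_tensor F = coset_tensor F'.
Proof. by move=> e; apply: eq_bigr => c _; rewrite e. Qed.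

Lemma coset_tensor_act g F F' : (forall c, F' (coset_act g c) = F c) ->
  tensor_act g (coset_tensor F) = coset_tensor F'.
Proof.
move=> FF'; rewrite /coset_tensor (zmod_morph_sum (@tensor_act_zmod _ _ _ _ g)).
have act_inj : injective (coset_act (L := L) g) by exact/bij_inj/coset_act_bij.
have im : [fset coset_act g c | c in all_cosets]%fset = all_cosets.
  apply/fsetP => c; rewrite mem_cosets; apply/imfsetP.
  have [h gh hg] := coset_act_bij L g.
  by exists (h c); rewrite ?hg//= mem_cosets.
rewrite -[in RHS]im big_imfset/=; last by move=> ? ? _ _; exact: act_inj.
apply: eq_bigr => c _; rewrite tensor_act_pure FF'; congr (pure (_ : P) _).
exact: image_set1.
Qed.

Let pure_uniq (s : seq C) (a : A) : uniq s ->
  pure ([set c | c \in s] : P) a = \sum_(c <- s) pure ([set c] : P) a.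
Proof.
elim: s => [_|x s IH /= /andP[xs us]].
  by rewrite big_nil -[RHS](pure_bot P a); congr (pure (_ : P) a); apply/seteqP; split.
rewrite big_cons -IH// -[RHS]pureU.
  congr (pure (_ : P) a); apply/seteqP; split=> c /=; rewrite inE.
    by move=> /orP[/eqP ->|]; [left|right].
  by move=> [->|cs]; rewrite ?eqxx ?cs ?orbT.
by apply/seteqP; split=> // c [/= -> cs]; rewrite cs in xs.
Qed.

Let tensor_level F : coset_tensor F =
  \sum_(a : A | a != 0) pure ([set c | F c = a] : P) a.
Proof.
rewrite (eq_bigr (fun a => \sum_(c <- all_cosets | F c == a) pure ([set c] : P) a)); last first.
  move=> a _; rewrite -big_filter -pure_uniq ?filter_uniq ?fset_uniq//.
  congr (pure (_ : P) a); apply/seteqP; split=> c /=; rewrite mem_filter mem_cosets andbT.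
    by move=> ->.
  by move=> /eqP.
under eq_bigr do rewrite big_mkcond.
rewrite exchange_big/= /coset_tensor; apply: eq_bigr => c _.
have [Fc|Fc] := eqVneq (F c) 0.
  by rewrite Fc pure0 big1// => a /negbTE; rewrite eq_sym => ->.
rewrite (bigD1 (F c))//= eqxx big1 ?addr0// => a /andP[_].
by rewrite eq_sym => /negbTE ->.
Qed.

Let eval_at c (Xa : P * A) : A := if `[< (Xa.1 : set C) c >] then Xa.2 else 0.

Let eval_relation c (r : {freeg P * A}) : @tensor_rel R P A r ->
  fglift (eval_at c : P * A -> zmodule A) r = 0.
Proof.
move=> [X [Y [a [b ->]]]]; rewrite fgliftB !fgliftD !fglift1 /eval_at /=.
rewrite (_ : `[< _ (X `\` Y)%O c >] = `[< (X : set C) c >] && ~~ `[< (Y : set C) c >]); last first.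
  by rewrite -asbool_neg -asbool_and.
rewrite (_ : `[< _ (Y `\` X)%O c >] = `[< (Y : set C) c >] && ~~ `[< (X : set C) c >]); last first.
  by rewrite -asbool_neg -asbool_and.
rewrite (_ : `[< _ (X `&` Y)%O c >] = `[< (X : set C) c >] && `[< (Y : set C) c >]); last first.
  by rewrite -asbool_and.
by case: `[< _ >]; case: `[< _ >] => /=; rewrite !(addr0, add0r) ?subrr ?oppr0 ?addr0.
Qed.

Definition tensor_eval c : tensor P A -> A := presented_lift (eval_at c).

Lemma tensor_eval_zmod c : zmod_morphism (tensor_eval c).
Proof. exact: presented_lift_zmod_morphism (@eval_relation c). Qed.

Lemma tensor_eval_pure c (X : P) a :
  tensor_eval c (pure X a) = if `[< (X : set C) c >] then a else 0.
Proof. by rewrite [LHS](presented_lift_gen (@eval_relation c)). Qed.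

Lemma tensor_eval_coset c F : tensor_eval c (coset_tensor F) = F c.
Proof.
rewrite /coset_tensor (zmod_morph_sum (@tensor_eval_zmod c)).
rewrite (bigD1_seq c) ?mem_cosets ?fset_uniq//= tensor_eval_pure asboolT// big1 ?addr0//.
by move=> c' cc'; rewrite tensor_eval_pure asboolF// => e; rewrite [c]e eqxx in cc'.
Qed.

Lemma tensor_eval_act g c x : tensor_eval (coset_act g c) (tensor_act g x) = tensor_eval c x.
Proof.
move: x; apply: presented_ext.
- move=> x y; rewrite (@tensor_act_zmod _ _ _ _ g) tensor_eval_zmod//.
- exact: tensor_eval_zmod.
move=> [X a]; rewrite -/(pure X a) tensor_act_pure !tensor_eval_pure.
congr (if _ then _ else _); apply/asboolP/asboolP => [[c' Xc' /= e]|Xc].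
  by rewrite -(bij_inj (coset_act_bij L g) e).
by exists c.
Qed.

(** The disjoint form picked by [tensor_mu] is forced: evaluating it at each coset shows that its
    pieces are the level sets of [F]. *)
Lemma coset_tensor_mu F : tensor_mu (coset_tensor F) = count_mu R [set c | F c != 0].
Proof.
pose X0 : {ffun A -> P} := [ffun a => [set c | F c = a]].
have X0E a : X0 a = [set c | F c = a] by rewrite ffunE.
have dX0 : disjoint_form (coset_tensor F) X0.
  split=> [a b _ _ ab|]; last by rewrite tensor_level; apply: eq_bigr => a _; rewrite X0E.
  by rewrite !X0E; apply/seteqP; split=> // c [/= -> e]; rewrite e eqxx in ab.
rewrite /tensor_mu; set X := xget _ _.
have [dX eX] : disjoint_form (coset_tensor F) X.
  by apply: (@xgetPex _ _ [set X | disjoint_form _ X]); exists X0.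
have XE a : a != 0 -> X a = [set c | F c = a].
  move=> a0; apply/seteqP; split=> c /=; rewrite -(tensor_eval_coset c F) eX
    (zmod_morph_sum (@tensor_eval_zmod c)).
    move=> Xc; rewrite (bigD1 a)//= tensor_eval_pure asboolT// big1 ?addr0// => b /andP[b0 ba].
    rewrite tensor_eval_pure asboolF// => Xbc.
    have /seteqP[/(_ c) + _] := dX b a b0 a0 ba; by apply; split.
  have [[b b0 Xbc]|nX] := pselect (exists2 b, b != 0 & (X b : set C) c).
    rewrite (bigD1 b)//= tensor_eval_pure asboolT// big1 ?addr0 => [<-//|b' /andP[b'0 b'b]].
    rewrite tensor_eval_pure asboolF// => Xb'c.
    have /seteqP[/(_ c) + _] := dX b' b b'0 b0 b'b; by apply; split.
  rewrite big1 => [e|b b0]; first by rewrite e eqxx in a0.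
  by rewrite tensor_eval_pure asboolF// => Xbc; apply: nX; exists b.
have Cfin S : finite_set (S : set C) by apply: sub_finite_set (fis_finite L).
rewrite (eq_bigr (fun a => count_mu R [set c | F c = a])); last by move=> a a0; rewrite XE.
rewrite /count_mu -mulr_suml -natr_sum; congr (_%:R / _).
rewrite (eq_bigr (fun a => \sum_(c <- all_cosets | F c == a) 1)%N); last first.
  move=> a _; rewrite card_fset_sum1 [RHS]big_fset_condE; apply: perm_big.
  apply: uniq_perm; rewrite ?fset_uniq// => c; rewrite in_fset_set// !inE mem_cosets.
  by apply/asboolP/eqP.
under eq_bigr do rewrite big_mkcond.
rewrite exchange_big/= card_fset_sum1.
rewrite (_ : fset_set [set c | F c != 0] = [fset c in all_cosets | F c != 0]%fset); last first.
  apply/fsetP => c; rewrite in_fset_set// !inE mem_cosets; exact/asboolP/idP.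
rewrite -big_fset_condE [RHS]big_mkcond/=; apply: eq_bigr => c _.
have [Fc|Fc] := eqVneq (F c) 0.
  by rewrite Fc big1// => a /negbTE; rewrite eq_sym => ->.
rewrite (bigD1 (F c))//= eqxx big1 ?addr0// => a /andP[_].
by rewrite eq_sym => /negbTE ->.
Qed.
End CosetTensor.

Lemma tensor_mu_ge0 (R : realType) (P : measured_alg R) (A : finZmodType) (x : tensor P A) :
  0 <= tensor_mu x.
Proof. by apply: sumr_ge0 => a _; exact: mu_ge0. Qed.

(** * Simplicial chains *)

Section Chains.
Context (G : groupType) (K : simplicial_gcomplex G).

(** Indexing by natural numbers allows numerals in the formulas for low dimensions; beyond [i] the
    value is vertex 0. *)
Definition vtx i (t : osimplex K i) (n : nat) : vertex K := tnth (val t) (inord n).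

Lemma osimplex_eq i (s t : osimplex K i) :
  (forall k : 'I_i.+1, vtx s k = vtx t k) -> s = t.
Proof. by move=> st; apply/val_inj/eq_from_tnth => k; have := st k; rewrite /vtx !inord_val. Qed.

Lemma vtx_reorder i (t : osimplex K i) p (k : 'I_i.+1) : vtx (reorder t p) k = vtx t (p k).
Proof. by rewrite /vtx !inord_val tnth_mktuple. Qed.

Lemma vtx_facet i (t : osimplex K i.+1) j (k : 'I_i.+1) : vtx (ofacet t j) k = vtx t (lift j k).
Proof. by rewrite /vtx !inord_val tnth_mktuple. Qed.

Lemma vtx_act i g (t : osimplex K i) n : vtx (oact g t) n = vact g (vtx t n).
Proof. by rewrite /vtx tnth_map. Qed.

Lemma vtx_eq i (t : osimplex K i) (j k : 'I_i.+1) : (vtx t j == vtx t k) = (j == k).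
Proof.
rewrite /vtx !inord_val; have /andP[/tuple_uniqP ut _] := valP t.
exact: inj_eq.
Qed.

Lemma vtx_face i (t : osimplex K i) (m n k : nat) : in_face (vtx t m) (vtx t n) (vtx t k).
Proof.
have /andP[_ ft] := valP t; exists (vset (val t)) => //.
by rewrite !mem_vset !mem_tnth.
Qed.

Lemma reorderM i (t : osimplex K i) p q : reorder t (p * q)%g = reorder (reorder t q) p.
Proof. by apply: osimplex_eq => k; rewrite !vtx_reorder permM. Qed.

Lemma gen_reorder i (t : osimplex K i) p :
  gen (@chain_rel _ K i) (reorder t p) = gen (@chain_rel _ K i) t *~ (-1) ^+ p.
Proof.
apply/eqP; rewrite -subr_eq0 -raddfMz -raddfB; apply/eqP/presented_rel.
by exists t, p.
Qed.

Definition alternating i (V : zmodType) (f : osimplex K i -> V) : Prop :=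
  forall t p, f (reorder t p) = f t *~ (-1) ^+ p.

Lemma alternating_tperm i (V : zmodType) (f : osimplex K i -> V) :
  (forall t x y, x != y -> f (reorder t (tperm x y)) = - f t) -> alternating f.
Proof.
move=> ft t p; have [ts -> dts] := prod_tpermP p.
elim: ts t dts => [|[x y] ts IH] t /=.
  rewrite big_nil odd_perm1 expr0 mulr1z => _; congr f.
  by apply: osimplex_eq => k; rewrite vtx_reorder perm1.
move=> /andP[xy dts]; rewrite big_cons reorderM ft// IH// odd_permM odd_tperm xy.
by rewrite signr_addb expr1 mulN1r mulrNz.
Qed.

Section ChainLift.
Context (i : nat) (V : zmodType) (f : osimplex K i -> V) (fa : alternating f).

Let chain_relation (r : {freeg osimplex K i}) : chain_rel r ->
  fglift (f : osimplex K i -> zmodule V) r = 0.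
Proof. by move=> [t [p ->]]; rewrite fgliftB fgliftMz !fglift1 fa subrr. Qed.

Definition chain_lift : chain K i -> V := presented_lift f.

Lemma chain_lift_zmod : zmod_morphism chain_lift.
Proof. exact: presented_lift_zmod_morphism chain_relation. Qed.

Lemma chain_lift_gen t : chain_lift (gen (@chain_rel _ K i) t) = f t.
Proof. exact: presented_lift_gen chain_relation t. Qed.
End ChainLift.

Lemma act_alternating i g : alternating (fun t : osimplex K i => gen (@chain_rel _ K i) (oact g t)).
Proof.
move=> t p; rewrite -gen_reorder; congr gen.
by apply: osimplex_eq => k; rewrite vtx_act !vtx_reorder vtx_act.
Qed.

Lemma chain_act_zmod i g : zmod_morphism (@chain_act _ K i g).
Proof. exact: (chain_lift_zmod (act_alternating g)). Qed.

Lemma chain_act_gen i g (t : osimplex K i) :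
  chain_act g (gen (@chain_rel _ K i) t) = gen (@chain_rel _ K i) (oact g t).
Proof. exact: (chain_lift_gen (act_alternating g)). Qed.

(** As in a cofactor expansion: deleting row [j] and column [p j] from the matrix of [p] leaves that
    of [q]. *)
Lemma facet_reorder i (t : osimplex K i.+1) (p : 'S_i.+2) (j : 'I_i.+2) :
  exists q : 'S_i.+1, ofacet (reorder t p) j = reorder (ofacet t (p j)) q /\
    odd_perm p = odd j (+) odd (p j) (+) odd_perm q.
Proof.
have [q pq] : exists q, p = lift_perm j (p j) q.
  pose qf (k : 'I_i.+1) : 'I_i.+1 := odflt k (unlift (p j) (p (lift j k))).
  have qfE k : lift (p j) (qf k) = p (lift j k).
    rewrite /qf; case: unliftP => //= e; case/eqP: (neq_lift j k).
    exact: (@perm_inj _ p).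
  have qi : injective qf.
    move=> k l kl; apply: (@lift_inj _ j); apply: (@perm_inj _ p).
    by rewrite -!qfE kl.
  exists (perm qi); apply/permP => k; case: (unliftP j k) => [l ->|->].
    by rewrite lift_perm_lift permE qfE.
  by rewrite lift_perm_id.
exists q; split; last by rewrite {1}pq odd_lift_perm.
apply: osimplex_eq => k; rewrite vtx_facet vtx_reorder vtx_reorder vtx_facet.
by rewrite {1}pq lift_perm_lift.
Qed.

Lemma boundary_alternating i : alternating (fun t : osimplex K i.+1 =>
  \sum_(j < i.+2) gen (@chain_rel _ K i) (ofacet t j) *~ (-1) ^+ j).
Proof.
move=> t p; rewrite mulrz_suml [in RHS](reindex_inj (@perm_inj _ p)) /=.
apply: eq_bigr => j _; have [q [-> po]] := facet_reorder t p j.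
rewrite gen_reorder -!mulrzA; congr (_ *~ _).
rewrite po !signr_addb -(signr_odd _ j) -(signr_odd _ (p j)) mulrA.
by case: (odd j); case: (odd (p j)); case: (odd_perm q) => /=; rewrite !(expr0, expr1); lia.
Qed.

Lemma boundary_zmod i : zmod_morphism (@boundary _ K i).
Proof. exact: (chain_lift_zmod (@boundary_alternating i)). Qed.

Lemma boundary_gen i (t : osimplex K i.+1) : boundary (gen (@chain_rel _ K i.+1) t) =
  \sum_(j < i.+2) gen (@chain_rel _ K i) (ofacet t j) *~ (-1) ^+ j.
Proof. exact: (chain_lift_gen (@boundary_alternating i)). Qed.

Lemma boundary_act i g (x : chain K i.+1) : boundary (chain_act g x) = chain_act g (boundary x).
Proof.
move: x; apply: presented_ext => [x y|x y|t].
- by rewrite chain_act_zmod boundary_zmod.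
- by rewrite boundary_zmod chain_act_zmod.
rewrite chain_act_gen !boundary_gen (zmod_morph_sum (@chain_act_zmod i g)).
apply: eq_bigr => j _; rewrite (zmod_morphMz (@chain_act_zmod i g)) chain_act_gen.
congr (gen _ _ *~ _); apply: osimplex_eq => k.
by rewrite vtx_act !vtx_facet vtx_act.
Qed.
End Chains.

Section LowDimension.
Context (G : groupType) (K : simplicial_gcomplex G) (V : zmodType).
Implicit Types (f : vertex K -> vertex K -> V) (h : vertex K -> vertex K -> vertex K -> V).

Lemma alternating1 f : (forall v w, v != w -> in_face v w w -> f w v = - f v w) ->
  alternating (fun t : osimplex K 1 => f (vtx t 0) (vtx t 1)).
Proof.
move=> fa; apply: alternating_tperm => t x y xy.
have v01 : vtx t 0 != vtx t 1 by rewrite (vtx_eq t ord0 ord_max).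
rewrite (vtx_reorder _ _ ord0) (vtx_reorder _ _ ord_max) !permE /=.
by case: x y xy => [[|[|x]] hx] [[|[|y]] hy]//= _; rewrite fa//; exact: vtx_face.
Qed.

(** The cyclic rotation and one transposition generate the symmetric group on three letters. *)
Lemma alternating2 h :
  (forall v w z, v != w -> w != z -> v != z -> in_face v w z -> h w v z = - h v w z) ->
  (forall v w z, h w z v = h v w z) ->
  alternating (fun t : osimplex K 2 => h (vtx t 0) (vtx t 1) (vtx t 2)).
Proof.
move=> ha hc; apply: alternating_tperm => t x y xy.
have v01 : vtx t 0 != vtx t 1 by rewrite (vtx_eq t (@Ordinal 3 0 isT) (@Ordinal 3 1 isT)).
have v12 : vtx t 1 != vtx t 2 by rewrite (vtx_eq t (@Ordinal 3 1 isT) (@Ordinal 3 2 isT)).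
have v02 : vtx t 0 != vtx t 2 by rewrite (vtx_eq t (@Ordinal 3 0 isT) (@Ordinal 3 2 isT)).
rewrite (vtx_reorder _ _ (@Ordinal 3 0 isT)) (vtx_reorder _ _ (@Ordinal 3 1 isT)).
rewrite (vtx_reorder _ _ (@Ordinal 3 2 isT)) !permE /=.
have h10 : h (vtx t 1) (vtx t 0) (vtx t 2) = - h (vtx t 0) (vtx t 1) (vtx t 2).
  by rewrite ha//; exact: vtx_face.
have h21 : h (vtx t 0) (vtx t 2) (vtx t 1) = - h (vtx t 0) (vtx t 1) (vtx t 2).
  by rewrite -hc ha ?(eq_sym (vtx t 2)) ?(eq_sym (vtx t 1) (vtx t 0))//; [rewrite hc | exact: vtx_face].
have h20 : h (vtx t 2) (vtx t 1) (vtx t 0) = - h (vtx t 0) (vtx t 1) (vtx t 2).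
  by rewrite -hc h10.
by case: x y xy => [[|[|[|x]]] hx] [[|[|[|y]]] hy].
Qed.

Lemma boundary1 (f : chain K 1 -> V) (t : osimplex K 2) g : zmod_morphism f ->
  (forall s, f (gen (@chain_rel _ K 1) s) = g (vtx s 0) (vtx s 1)) ->
  f (boundary (gen (@chain_rel _ K 2) t)) =
    g (vtx t 1) (vtx t 2) - g (vtx t 0) (vtx t 2) + g (vtx t 0) (vtx t 1).
Proof.
move=> fB fg; rewrite boundary_gen (zmod_morph_sum fB) !big_ord_recl big_ord0 addr0.
rewrite !(zmod_morphMz fB) !fg !(vtx_facet _ _ ord0) !(vtx_facet _ _ ord_max) /=.
by rewrite expr0 expr1 expr2 mulrNN mulr1 !mulr1z mulrN1z addrA.
Qed.

Lemma boundary2 (f : chain K 2 -> V) (t : osimplex K 3) g : zmod_morphism f ->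
  (forall s, f (gen (@chain_rel _ K 2) s) = g (vtx s 0) (vtx s 1) (vtx s 2)) ->
  f (boundary (gen (@chain_rel _ K 3) t)) =
    g (vtx t 1) (vtx t 2) (vtx t 3) - g (vtx t 0) (vtx t 2) (vtx t 3)
    + g (vtx t 0) (vtx t 1) (vtx t 3) - g (vtx t 0) (vtx t 1) (vtx t 2).
Proof.
move=> fB fg; rewrite boundary_gen (zmod_morph_sum fB) !big_ord_recl big_ord0 addr0.
rewrite !(zmod_morphMz fB) !fg !(vtx_facet _ _ (@Ordinal 3 0 isT)).
rewrite !(vtx_facet _ _ (@Ordinal 3 1 isT)) !(vtx_facet _ _ (@Ordinal 3 2 isT)) /=.
by rewrite !(expr0, exprS) !(mulr1, mulN1r, opprK) !mulr1z !mulrN1z !addrA.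
Qed.
End LowDimension.

(** * Equivariant labels and orientations on a free complex *)

Section FreeComplex.
Context (G : groupType) (K : simplicial_gcomplex G) (Kfree : free_action K).

Let orbit_repr i (s : simplex K i) : simplex K i := repr (\pi_(qsimplex K i) s).

Lemma simplex_act_subproof i g (s : simplex K i) :
  face (face_image g (val s)) && (#|` face_image g (val s)| == i.+1).
Proof. by have /andP[fs cs] := valP s; rewrite face_act ?card_face_image. Qed.
Definition simplex_act i g (s : simplex K i) : simplex K i :=
  exist (fun s => face s && (#|` s| == i.+1)) _ (simplex_act_subproof g s).

(* Such a [g] is unique because the action is free. *)
Definition transporter i (s : simplex K i) : G :=
  xget 1%g [set g | face_image g (val (orbit_repr s)) = val s].

Lemma transporterP i (s : simplex K i) :
  face_image (transporter s) (val (orbit_repr s)) = val s.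
Proof.
have /eqmodP/asboolP h : \pi_(qsimplex K i) (orbit_repr s) = \pi_(qsimplex K i) s.
  by rewrite reprK.
exact: (xgetPex 1%g h).
Qed.

Lemma orbit_repr_act i g (s : simplex K i) : orbit_repr (simplex_act g s) = orbit_repr s.
Proof.
congr repr; apply/eqmodP/asboolP; exists g^-1%g.
by rewrite -face_imageM mulVg face_image1.
Qed.

Lemma transporter_act i g (s : simplex K i) :
  transporter (simplex_act g s) = (g * transporter s)%g.
Proof.
apply: (mulgI (g * transporter s)^-1%g); rewrite mulVg.
have /andP[fr _] := valP (orbit_repr s); apply: (Kfree fr).
rewrite face_imageM -[X in face_image _ (face_image _ (val X))](orbit_repr_act g).
rewrite transporterP /= -[X in face_image _ (face_image _ X)]transporterP.
by rewrite -!face_imageM -mulgA mulVg face_image1.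
Qed.

Lemma vertex_simplex_subproof (v : vertex K) : face [fset v]%fset && (#|` [fset v]%fset| == 1%N).
Proof. by rewrite face1 cardfs1. Qed.
Definition vertex_simplex (v : vertex K) : simplex K 0 :=
  exist (fun s => face s && (#|` s| == 1%N)) _ (vertex_simplex_subproof v).

(** By freeness each orbit of vertices is a copy of G; this is the coordinate relative to the chosen
    representative. *)
Definition vertex_label (v : vertex K) : G := transporter (vertex_simplex v).

Lemma vertex_label_act g v : vertex_label (vact g v) = (g * vertex_label v)%g.
Proof.
rewrite -transporter_act; congr transporter; apply: val_inj => /=.
by apply/fsetP => w; rewrite inE; apply/eqP/imfsetP => [->|[x /=]];
  [exists v; rewrite ?inE | rewrite inE => /eqP -> ->].
Qed.

(** The orientation of the representative edge, transported along its orbit. It is well defined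
    because a free action cannot reverse an edge. Pairs that are not edges get [false]. *)
Definition edge_orientation (v w : vertex K) : bool :=
  if insub [fset v; w]%fset is Some s
  then v == vact (transporter (s : simplex K 1)) (vtx (orient (orbit_repr s)) 0)
  else false.

Let face_image2 g (v w : vertex K) : face_image g [fset v; w]%fset = [fset vact g v; vact g w]%fset.
Proof.
apply/fsetP => x; rewrite !inE; apply/imfsetP/orP => [[y /=]|].
  by rewrite !inE => /orP[] /eqP -> ->; [left|right].
by move=> [] /eqP ->; [exists v|exists w]; rewrite ?inE ?eqxx ?orbT.
Qed.

Lemma edge_orientation_act g v w :
  edge_orientation (vact g v) (vact g w) = edge_orientation v w.
Proof.
rewrite /edge_orientation; case: (insubP _ [fset v; w]%fset) => /= [s _ es|ns].
  have e : [fset vact g v; vact g w]%fset = val (simplex_act g s).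
    by rewrite -face_image2 /= es.
  by rewrite e valK orbit_repr_act transporter_act vactM (inj_eq (@vact_inj _ _ g)).
rewrite insubN// -face_image2; apply: contra ns => /andP[fs cs].
rewrite card_face_image in cs; rewrite cs andbT.
have := face_act g^-1%g fs; rewrite -/(face_image _ _) -/(face_image _ _) -face_imageM mulVg.
by rewrite face_image1.
Qed.

Lemma edge_orientationV v w : v != w -> in_face v w w ->
  edge_orientation w v = ~~ edge_orientation v w.
Proof.
move=> vw [s fs [vs ws _]]; rewrite /edge_orientation [[fset w; v]%fset]fsetUC.
have fvw : face [fset v; w]%fset && (#|` [fset v; w]%fset| == 2%N).
  rewrite cardfs2 vw eqxx andbT; apply: face_sub fs _ _.
    by apply/fsubsetP => z; rewrite !inE => /orP[] /eqP ->.
  by apply/fset0Pn; exists v; rewrite !inE eqxx.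
case: insubP => [t _ et|]; last by rewrite fvw.
set x := vact _ _.
have : x \in [fset v; w]%fset.
  rewrite -et -transporterP; apply/imfsetP; exists (vtx (orient (orbit_repr t)) 0) => //=.
  by rewrite /vtx mem_tnth.
rewrite !inE => /orP[] /eqP ->; first by rewrite eqxx eq_sym (negbTE vw).
by rewrite eqxx (negbTE vw).
Qed.

Lemma face_osimplex (v w z : vertex K) : v != w -> w != z -> v != z -> in_face v w z ->
  exists t : osimplex K 2, [/\ vtx t 0 = v, vtx t 1 = w & vtx t 2 = z].
Proof.
move=> vw wz vz [s fs [vs ws zs]].
have h : is_osimplex [tuple v; w; z].
  rewrite /is_osimplex /= !inE negb_or vw vz wz /=; apply: face_sub fs _ _.
    by apply/fsubsetP => x; rewrite mem_vset !inE => /or3P[] /eqP ->.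
  by apply/fset0Pn; exists v; rewrite mem_vset !inE eqxx.
by exists (exist (@is_osimplex _ K 2) _ h); rewrite /vtx !(tnth_nth v) /= !inordK.
Qed.

Definition edge_simplex (v w : vertex K) : option (osimplex K 1) := insub [tuple v; w].

Lemma edge_simplexP v w : v != w -> in_face v w w ->
  exists t, [/\ edge_simplex v w = Some t, vtx t 0 = v & vtx t 1 = w].
Proof.
move=> vw [s fs [vs ws _]].
have h : is_osimplex [tuple v; w].
  rewrite /is_osimplex /= !inE vw /=; apply: face_sub fs _ _.
    by apply/fsubsetP => x; rewrite mem_vset !inE => /orP[] /eqP ->.
  by apply/fset0Pn; exists v; rewrite mem_vset !inE eqxx.
exists (exist (@is_osimplex _ K 1) _ h); rewrite /edge_simplex insubT; split=> //.
all: by rewrite /vtx !(tnth_nth v) /= !inordK.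
Qed.
End FreeComplex.

(** * Residual finiteness of virtually split extensions *)

Section Separation.
Context (G : groupType) (H : groupClosed G) (Hfin : finite_set [set: cosets H]).

Let T : finType := fset_set [set: cosets H].

Let mem_T (c : cosets H) : c \in fset_set [set: cosets H].
Proof. by rewrite in_fset_set ?inE. Qed.

(** The inverse compensates for the composition of permutations from left to right. *)
Let move (g : G) (c : T) : T := [` mem_T (coset_act g^-1%g (val c))]%fset.

Let move_inj g : injective (move g).
Proof.
by move=> c c' /(congr1 val)/= /(bij_inj (coset_act_bij H g^-1%g)); exact: val_inj.
Qed.

Let coset_perm g : {perm T} := perm (@move_inj g).

Let coset_permM : {morph coset_perm : g h / (g * h)%g}.
Proof.
move=> g h; apply/permP => c; rewrite permM !permE; apply: val_inj => /=.
by rewrite invMg coset_actM.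
Qed.

Let coset_morph : {multiplicative G -> {perm T}} :=
  HB.pack coset_perm (isMultiplicative.Build G {perm T} coset_perm coset_permM).

Lemma coset_separation g : g \notin H ->
  exists (F : finGroupType) (f : {multiplicative G -> F}), f g <> 1%g.
Proof.
move=> gH; exists {perm T}, coset_morph => /permP/(_ [` mem_T (\pi_(cosets H) 1%g)]%fset).
rewrite perm1 permE => /(congr1 val)/=; rewrite coset_actE mulg1 => /eqmodP /=.
by rewrite /coset_rel invgK mulg1 (negbTE gH).
Qed.
End Separation.

Section Splitting.
Context (A : finZmodType) (E G : groupType) (iota : A -> E) (p : E -> G).
Hypothesis ext : central_extension iota p.
Context (L : finite_index_subgroup G) (theta : G -> E).
Hypothesis thetaM : {in L &, {morph theta : g h / (g * h)%g}}.
Hypothesis p_theta : forall g, g \in L -> p (theta g) = g.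

Let theta1 : theta 1%g = 1%g.
Proof. by apply: (mulgI (theta 1%g)); rewrite -thetaM ?gpred1// !mulg1. Qed.

Definition split_image : {pred E} := fun x => `[< exists2 g, g \in L & theta g = x >].

Lemma split_image_closed : group_closed split_image.
Proof.
split; first by apply/asboolP; exists 1%g; rewrite ?gpred1.
move=> x y /asboolP[g gL <-] /asboolP[h hL <-]; apply/asboolP.
have ghL : (g * h^-1)%g \in L by rewrite gpredM ?gpredV.
by exists (g * h^-1)%g => //; apply: (mulIg (theta h)); rewrite -thetaM ?mulgVK.
Qed.
HB.instance Definition _ := isMulClosed.Build E split_image (group_closedM split_image_closed).
HB.instance Definition _ := isMul1Closed.Build E split_image split_image_closed.1.
HB.instance Definition _ := isInvClosed.Build E split_image (group_closedV split_image_closed).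

(** Every element of E is a product of the lift of a coset representative, some [theta l] and an
    element of A. The last factor is central, so finitely many pairs of a coset and an element of A
    reach all cosets. *)
Lemma split_image_finite : finite_set [set: cosets split_image].
Proof.
pose f (ca : cosets L * A) : cosets split_image :=
  \pi_(cosets split_image) (section_of p (repr ca.1) * iota ca.2)%g.
have fin : finite_set (f @` [set: cosets L * A]).
  apply: finite_image; rewrite -setXTT; apply: finite_setX; first exact: fis_finite.
  exact: finite_finset.
apply: sub_finite_set fin => d _; pose x := repr d.
have /eqmodP cL : \pi_(cosets L) (repr (\pi_(cosets L) (p x))) = \pi_(cosets L) (p x) by rewrite reprK.
move: cL; rewrite /= /coset_rel; set c := \pi_(cosets L) (p x); set l := (_ * _)%g => lL.
pose y := ((section_of p (repr c) * theta l)^-1 * x)%g.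
have py : p y = 1%g.
  rewrite (ce_pM ext) (ce_pV ext) (ce_pM ext) (section_ofK ext) p_theta// /l.
  by rewrite mulVKg mulVg.
exists (c, fiber_coord iota y) => //; rewrite /f /= -[d]reprK; apply/eqmodP.
apply/asboolP; exists l => //.
have {1}-> : theta l = ((section_of p (repr c))^-1 * x * (iota (fiber_coord iota y))^-1)%g.
  by rewrite (fiber_coordK ext py) /y -/x invMg invgK -!mulgA mulVKg mulKg.
rewrite -(ce_iotaN ext) -(ce_central ext) invMg -(ce_iotaN ext).
by rewrite -!mulgA (ce_central ext).
Qed.

(** Elements outside A are detected in G; a nontrivial element of A is not in the split image, hence
    moves its base coset. *)
Lemma split_residually_finite : residually_finite G -> residually_finite E.
Proof.
move=> rf x x1; have [px|px] := pselect (p x = 1%g).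
  apply: (coset_separation split_image_finite); apply/asboolP => -[g gL gx].
  by apply: x1; rewrite -gx; rewrite -gx p_theta// in px; rewrite px theta1.
have [F [f fx]] := rf _ px.
have fpM : {morph f \o p : y z / (y * z)%g} by move=> y z /=; rewrite (ce_pM ext) gmulfM.
pose fp : {multiplicative E -> F} := HB.pack (f \o p) (isMultiplicative.Build E F (f \o p) fpM).
by exists F, fp.
Qed.
End Splitting.

(** * The extension class *)

Lemma alternating_sum4 (V : zmodType) (a b c d : V) :
  a - b + c - d = 0 <-> a + c = d + b.
Proof.
rewrite -addrA addrACA -opprD (addrC b); split=> [/eqP|->]; last exact: subrr.
by rewrite subr_eq0 => /eqP.
Qed.

(** The coboundary of a coboundary vanishes on a tetrahedron with edge values [x01] to [x23], in the
    sign-free form of [alternating_sum4]. *)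
Lemma alternating_sum6 (V : zmodType) (x01 x02 x03 x12 x13 x23 : V) :
  (x23 - x13 + x12) + (x13 - x03 + x01) = (x12 - x02 + x01) + (x23 - x03 + x02).
Proof.
rewrite (addrAC x23) -(addrA x13) [LHS]addrA subrK (addrAC x12) (addrC _ x02) [RHS]addrA subrK.
by rewrite [RHS]addrACA (addrC x23) (addrC (- x03)).
Qed.

Section ExtensionCochain.
Context (R : realType) (A : finZmodType) (E G : groupType).
Context (iota : A -> E) (p : E -> G) (ext : central_extension iota p).
Context (K : simplicial_gcomplex G) (Kfree : free_action K).
Implicit Types (v w z : vertex K).

Definition vertex_lift := edge_lift p (@vertex_label G K) (@edge_orientation G K).
Definition extension_defect := face_defect iota p (@vertex_label G K) (@edge_orientation G K).
Local Notation sl := vertex_lift.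
Local Notation fd := extension_defect.

Lemma vertex_lift_act g v w : sl (vact g v) (vact g w) = sl v w.
Proof.
rewrite /vertex_lift /edge_lift edge_orientation_act// !vertex_label_act// !invMg.
by rewrite -!mulgA !mulKg.
Qed.

Lemma vertex_liftV v w : v != w -> in_face v w w -> sl w v = (sl v w)^-1%g.
Proof. by move=> vw fvw; apply: edge_liftV; exact: edge_orientationV. Qed.

Lemma extension_defectK v w z : iota (fd v w z) = (sl v w * sl w z * sl z v)%g.
Proof. exact: face_defectK. Qed.

Lemma extension_defect_act g v w z : fd (vact g v) (vact g w) (vact g z) = fd v w z.
Proof. by apply: (ce_inj ext); rewrite !extension_defectK !vertex_lift_act. Qed.

(** Changing the base point conjugates the holonomy by [sl v w], and the holonomy is central. *)
Lemma extension_defect_cycle v w z : fd w z v = fd v w z.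
Proof.
apply: (ce_inj ext); apply: (mulgI (sl v w)).
by rewrite extension_defectK !mulgA -extension_defectK (ce_central ext).
Qed.

Lemma extension_defect_swap v w z : v != w -> w != z -> v != z -> in_face v w z ->
  fd w v z = - fd v w z.
Proof.
move=> vw wz vz [s fs [vs ws zs]]; apply: (ce_inj ext).
have f a b : a \in s -> b \in s -> in_face a b b by exists s.
rewrite (ce_iotaN ext) -(extension_defect_cycle w v z) !extension_defectK.
rewrite (vertex_liftV vw) ?(vertex_liftV wz) ?(vertex_liftV vz); try exact: f.
by rewrite !invMg !invgK !mulgA.
Qed.

Lemma extension_defect_lift v w z : v != z -> in_face v z z ->
  (sl v w * sl w z)%g = (iota (fd v w z) * sl v z)%g.
Proof. by move=> vz fvz; rewrite extension_defectK (vertex_liftV vz)// mulgVK. Qed.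

(** Associativity: the product of the lifts of the edges 01, 12, 23 is reduced to the lift of 03
    with either bracketing, and centrality collects the defects in front. *)
Lemma extension_defect_cocycle (t : osimplex K 3) :
  fd (vtx t 1) (vtx t 2) (vtx t 3) - fd (vtx t 0) (vtx t 2) (vtx t 3)
    + fd (vtx t 0) (vtx t 1) (vtx t 3) - fd (vtx t 0) (vtx t 1) (vtx t 2) = 0.
Proof.
have ne (a b : 'I_4) : a != b -> vtx t a != vtx t b by rewrite vtx_eq.
have n02 := ne (@Ordinal 4 0 isT) (@Ordinal 4 2 isT) isT.
have n03 := ne (@Ordinal 4 0 isT) (@Ordinal 4 3 isT) isT.
have n13 := ne (@Ordinal 4 1 isT) (@Ordinal 4 3 isT) isT.
have f a b : in_face (vtx t a) (vtx t b) (vtx t b) by exact: vtx_face.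
have e1 : (sl (vtx t 0) (vtx t 1) * sl (vtx t 1) (vtx t 2) * sl (vtx t 2) (vtx t 3))%g =
    (iota (fd (vtx t 0) (vtx t 1) (vtx t 2) + fd (vtx t 0) (vtx t 2) (vtx t 3))
      * sl (vtx t 0) (vtx t 3))%g.
  rewrite (extension_defect_lift _ n02)// -mulgA (extension_defect_lift _ n03)//.
  by rewrite mulgA -(ce_iotaD ext).
have e2 : (sl (vtx t 0) (vtx t 1) * sl (vtx t 1) (vtx t 2) * sl (vtx t 2) (vtx t 3))%g =
    (iota (fd (vtx t 1) (vtx t 2) (vtx t 3) + fd (vtx t 0) (vtx t 1) (vtx t 3))
      * sl (vtx t 0) (vtx t 3))%g.
  rewrite -mulgA (extension_defect_lift _ n13)// mulgA -(ce_central ext) -mulgA.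
  by rewrite (extension_defect_lift _ n03)// mulgA -(ce_iotaD ext).
by apply/alternating_sum4; move: e1; rewrite e2 => /mulIg/(ce_inj ext).
Qed.

Lemma chain_lift_cochain i (P : measured_galg R G) (f : osimplex K i -> tensor P A) :
  alternating f -> (forall g t, f (oact g t) = tensor_act g (f t)) ->
  cochain K P A i (chain_lift f).
Proof.
move=> fa fg; split=> [|g x]; first exact: chain_lift_zmod.
move: x; apply: presented_ext => [x y|x y|t].
- by rewrite chain_act_zmod (chain_lift_zmod fa).
- by rewrite (chain_lift_zmod fa) tensor_act_zmod.
by rewrite chain_act_gen !(chain_lift_gen fa) fg.
Qed.

Section Cosets.
Context (L : finite_index_subgroup G).
Local Notation P := (coset_galg R L).
Local Notation Ten := (@coset_tensor R G L A).

(** Constant functions on G/L: the extension cocycle pushed along the inclusion of A in P(A). *)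
Definition class_value (t : osimplex K 2) : tensor P A :=
  Ten (fun=> fd (vtx t 0) (vtx t 1) (vtx t 2)).
Definition class_cochain : chain K 2 -> tensor P A := chain_lift class_value.

Lemma class_value_alternating : alternating class_value.
Proof.
apply: (alternating2 (h := fun v w z => Ten (fun=> fd v w z))) => v w z.
  by move=> vw wz vz fvwz; rewrite -coset_tensorN extension_defect_swap.
by rewrite extension_defect_cycle.
Qed.

Lemma class_cochain_gen t : class_cochain (gen (@chain_rel _ K 2) t) = class_value t.
Proof. exact: chain_lift_gen class_value_alternating _. Qed.

Lemma class_cochain_cochain : cochain K P A 2 class_cochain.
Proof.
apply: chain_lift_cochain; first exact: class_value_alternating.
move=> g t; apply/esym/coset_tensor_act => c.
by rewrite !vtx_act extension_defect_act.
Qed.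

Lemma class_cochain_cocycle : cocycle K P A 2 class_cochain.
Proof.
split; first exact: class_cochain_cochain.
have [cB _] := class_cochain_cochain.
apply: (presented_ext (g := fun=> 0)) => [x y|x y|t].
- by rewrite boundary_zmod cB.
- by rewrite subrr.
rewrite (boundary2 (g := fun v w z => Ten (fun=> fd v w z)) _ cB class_cochain_gen).
rewrite -coset_tensorB -coset_tensorD -coset_tensorB.
rewrite (@coset_tensor_ext R G L A _ (fun=> 0 - 0)) ?coset_tensorB ?subrr// => c.
exact: extension_defect_cocycle.
Qed.

Section EdgeFunction.
Context (b : vertex K -> vertex K -> cosets L -> A).
Hypothesis bV : forall v w c, v != w -> in_face v w w -> b w v c = - b v w c.
Hypothesis b_act : forall g v w c, b (vact g v) (vact g w) (coset_act g c) = b v w c.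

Definition edge_value (t : osimplex K 1) : tensor P A := Ten (b (vtx t 0) (vtx t 1)).
Definition edge_cochain : chain K 1 -> tensor P A := chain_lift edge_value.

Lemma edge_value_alternating : alternating edge_value.
Proof.
apply: (alternating1 (f := fun v w => Ten (b v w))) => v w vw fvw.
by rewrite -coset_tensorN; apply: coset_tensor_ext => c; exact: bV.
Qed.

Lemma edge_cochain_gen t : edge_cochain (gen (@chain_rel _ K 1) t) = edge_value t.
Proof. exact: chain_lift_gen edge_value_alternating _. Qed.

Lemma edge_cochain_cochain : cochain K P A 1 edge_cochain.
Proof.
apply: chain_lift_cochain; first exact: edge_value_alternating.
by move=> g t; apply/esym/coset_tensor_act => c; rewrite !vtx_act b_act.
Qed.

Definition corrected_cochain (x : chain K 2) : tensor P A :=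
  class_cochain x - edge_cochain (boundary x).

Lemma corrected_cochain_gen t : corrected_cochain (gen (@chain_rel _ K 2) t) =
  Ten (fun c => fd (vtx t 0) (vtx t 1) (vtx t 2) -
    (b (vtx t 0) (vtx t 1) c + b (vtx t 1) (vtx t 2) c + b (vtx t 2) (vtx t 0) c)).
Proof.
have [bB _] := edge_cochain_cochain.
rewrite /corrected_cochain class_cochain_gen.
rewrite (boundary1 (g := fun v w => Ten (b v w)) _ bB edge_cochain_gen).
rewrite -coset_tensorB -coset_tensorD -coset_tensorB; apply: coset_tensor_ext => c.
have v02 : vtx t 0 != vtx t 2 by rewrite (vtx_eq t (@Ordinal 3 0 isT) (@Ordinal 3 2 isT)).
rewrite (@bV (vtx t 0) (vtx t 2))//; last exact: vtx_face.
by congr (_ - _); rewrite addrC addrA.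
Qed.

Lemma corrected_cochain_cocycle : cocycle K P A 2 corrected_cochain.
Proof.
have [bB bG] := edge_cochain_cochain; have [cB cG] := class_cochain_cochain.
have dB : zmod_morphism corrected_cochain.
  move=> x y; rewrite /corrected_cochain cB boundary_zmod bB.
  by rewrite [in LHS]opprD addrACA -opprD.
split; first split=> // g x.
  by rewrite /corrected_cochain boundary_act cG bG tensor_act_zmod.
have [_ cK] := class_cochain_cocycle.
move=> x; rewrite /corrected_cochain cK sub0r; apply/eqP; rewrite oppr_eq0; apply/eqP.
move: x; apply: (presented_ext (g := fun=> 0)) => [x y|x y|t].
- by rewrite !boundary_zmod bB.
- by rewrite subrr.
have bdB : zmod_morphism (fun x : chain K 2 => edge_cochain (boundary x)).
  by move=> x y; rewrite boundary_zmod bB.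
rewrite (boundary2 (f := fun x => edge_cochain (boundary x))
  (g := fun v w z => Ten (b w z) - Ten (b v z) + Ten (b v w)) _ bdB); last first.
  by move=> s; rewrite (boundary1 (g := fun v w => Ten (b v w)) _ bB edge_cochain_gen).
apply/alternating_sum4.
exact: alternating_sum6.
Qed.

Lemma corrected_cochain_class :
  coboundary K P A 2 (corrected_cochain \- class_cochain).
Proof.
have [bB bG] := edge_cochain_cochain.
exists (fun x => - edge_cochain x).
  split=> [x y|g x]; first by rewrite bB opprD.
  by rewrite bG (zmod_morphN (@tensor_act_zmod _ _ _ _ g)).
by apply/funext => x; rewrite /= /corrected_cochain addrAC subrr add0r.
Qed.
End EdgeFunction.

Lemma class_cochain_class : coboundary K P A 2 (class_cochain \- class_cochain).
Proof.
exists (fun=> 0); first split=> [x y|g x]; rewrite ?subrr//.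
  by rewrite (zmod_morph0 (@tensor_act_zmod _ _ _ _ g)).
by apply/funext => x /=; rewrite subrr.
Qed.
End Cosets.
End ExtensionCochain.

Lemma atom_join (d : Order.disp_t) (T : tbDistrLatticeType d) (x : T) (J : finType)
    (C : pred J) (F : J -> T) :
  x != \bot%O -> (forall y, (x <= y)%O \/ (x `&` y)%O = \bot%O) ->
  (x <= \join_(j | C j) F j)%O -> exists2 j, C j & (x <= F j)%O.
Proof.
move=> x0 atom xF; apply/not_exists2P => nF; move: x0 => /eqP; apply.
rewrite -(meet_idPl xF).
rewrite (big_morph (fun y => (x `&` y)%O) (id1 := \bot%O) (op1 := Order.join)).
- apply: big1 => j Cj; have [xj|//] := atom (F j).
  by have [] := nF j.
- by move=> y z; rewrite meetUr.
- by rewrite meetx0.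
Qed.

(** * Vanishing of the extension class by the cosystolic inequality *)

Section Vanishing.
Context (R : realType) (A : finZmodType) (E G : groupType).
Context (iota : A -> E) (p : E -> G) (ext : central_extension iota p).
Context (K : simplicial_gcomplex G) (Kfree : free_action K) (Kfin : finite_quotient K).
Context (nu : qsimplex K 2 -> R) (eps : R) (eps0 : 0 < eps).
Hypothesis nuP : faithful_probability nu.
Hypothesis cosys : forall P : measured_galg R G, finite_transitive_action P ->
  forall alpha, cohomology K P A 2 alpha -> alpha <> coboundary K P A 2 ->
    eps <= class_norm nu alpha.
Local Notation fd := (@extension_defect A E G iota p K).

(* The cocycle [a - b d], cohomologous to the class cochain [a], vanishes off [D] on
   every simplex, so its norm is at most the measure of [D]. *)
Lemma class_vanishes (L : finite_index_subgroup G) (b : vertex K -> vertex K -> cosets L -> A)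
    (D : set (cosets L)) :
  (forall v w c, v != w -> in_face v w w -> b w v c = - b v w c) ->
  (forall g v w c, b (vact g v) (vact g w) (coset_act g c) = b v w c) ->
  count_mu R D < eps ->
  (forall (j : qsimplex K 2) (c : cosets L), ~ D c -> let t := orient (repr j) in
     fd (vtx t 0) (vtx t 1) (vtx t 2) =
       b (vtx t 0) (vtx t 1) c + b (vtx t 1) (vtx t 2) c + b (vtx t 2) (vtx t 0) c) ->
  coboundary K (coset_galg R L) A 2 (class_cochain R iota p L).
Proof.
move=> bV b_act Deps bD; set a := class_cochain R iota p L.
pose alpha := [set c' | cocycle K (coset_galg R L) A 2 c' /\
  coboundary K (coset_galg R L) A 2 (c' \- a)].
have aK : cocycle K (coset_galg R L) A 2 a := class_cochain_cocycle R ext Kfree L.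
have aalpha : alpha a by split=> //; exact: class_cochain_class.
(* If the class is zero as a set of cocycles, it contains [a], which is then a coboundary. *)
have [<-//|ne] := pselect (alpha = coboundary K (coset_galg R L) A 2).
have trL : finite_transitive_action (coset_galg R L) by exists L.
have alphaH : cohomology K (coset_galg R L) A 2 alpha by exists a.
have le := cosys trL alphaH ne.
suff lt : class_norm nu alpha < eps by have := le_lt_trans le lt; rewrite ltxx.
pose a' := corrected_cochain R iota p b.
have a'alpha : alpha a'.
  split; first exact: corrected_cochain_cocycle.
  exact: corrected_cochain_class.
have norm_ge0 c : 0 <= cochain_norm nu c :> R.
  rewrite /cochain_norm fsbig_finite; last exact: Kfin.2.
  by apply: sumr_ge0 => j _; rewrite mulr_ge0 ?tensor_mu_ge0// ltW// nuP.1.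
apply: (@le_lt_trans _ _ (cochain_norm nu a')).
  apply: ge_inf; last by exists a'.
  by exists 0 => _ [c _ <-]; exact: norm_ge0.
rewrite /cochain_norm fsbig_finite; last exact: Kfin.2.
have cle (j : qsimplex K 2) : tensor_mu (a' (gen (@chain_rel _ K 2) (orient (repr j)))) <= count_mu R D.
  rewrite /a' (corrected_cochain_gen R ext bV b_act) coset_tensor_mu.
  apply: (@le_mu R (coset_alg R L)); rewrite subsetEset => c /= nc.
  by apply: contrapT => nD; move: nc; rewrite (bD j c nD) subrr eqxx.
apply: (@le_lt_trans _ _ (\sum_(j <- fset_set [set: qsimplex K 2]) count_mu R D * nu j)).
  by apply: ler_sum => j _; apply: ler_wpM2r; [exact/ltW/nuP.1 | exact: cle].
rewrite -mulr_sumr.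
(* Without 2-simplices [nu] has no total mass, but then the sum is empty and 0 < [eps]. *)
have [[j _]|nq] := pselect ([set: qsimplex K 2] !=set0).
  have : \sum_(x \in [set: qsimplex K 2]) nu x = 1 by apply: nuP.2; exists j.
  by rewrite fsbig_finite; [move=> -> | exact: Kfin.2]; rewrite mulr1.
rewrite (_ : [set: qsimplex K 2] = set0) ?fset_set0 ?big_seq_fset0 ?mulr0//.
by apply/seteqP; split=> // j _; apply: nq; exists j.
Qed.

Lemma weakly_contained_vanishes (P : measured_galg R G) (B : E -> A -> P) :
  cocycle_partition iota p B -> weakly_contained P (@finite_action R G) ->
  exists L : finite_index_subgroup G,
    coboundary K (coset_galg R L) A 2 (class_cochain R iota p L).
Proof.
move=> Bc PF; pose t (j : qsimplex K 2) := orient (repr j).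
have [Q [Y [D [Qfin Deps Yd Yact [YV YD]]]]] := finite_action_model ext
  (vertex_label_act Kfree) (edge_orientation_act Kfree) Bc PF
  (fset_set [set: qsimplex K 2]) (fun j => vtx (t j) 0) (fun j => vtx (t j) 1)
  (fun j => vtx (t j) 2) eps0.
have [x [x0 atom cD]] := small_atom Qfin Deps.
exists (act_kernel_fis Qfin); set C := cosets (act_kernel_fis Qfin).
pose tr (c : C) : measured_hom Q Q := gact Q (repr c)^-1%g.
(* The value of the cochain on the translate of the atom [x] by [repr c], or 0 if no piece contains
   that translate. *)
pose b v w (c : C) : A := xget 0 [set a | (x <= tr c (Y v w a))%O].
have bE v w c a : (x <= tr c (Y v w a))%O -> b v w c = a.
  move=> xa; have := xgetPex 0 (ex_intro (fun a => [set a | (x <= tr c (Y v w a))%O] a) a xa).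
  rewrite -/(b v w c) => /= xb; apply/eqP/negP => /negP ne.
  have := lexI x (tr c (Y v w (b v w c))) (tr c (Y v w a)).
  by rewrite xa xb -mhomI Yd// mhom_bot lex0 (negbTE x0).
apply: (class_vanishes (b := b) _ _ cD).
- move=> v w c vw fvw; have Yvw a := YV v w a (edge_orientationV vw fvw).
  have [[a xa]|nx] := pselect (exists a, (x <= tr c (Y v w a))%O).
    by rewrite (bE v w c a xa); apply: bE; rewrite Yvw.
  (* If no piece contains the translate for one orientation, the same holds for the other, and the
     default 0 is its own opposite. *)
  rewrite /b xgetPN => [|a xa]; last by apply: nx; exists (- a); rewrite -Yvw opprK.
  by rewrite xgetPN ?oppr0// => a xa; apply: nx; exists a.
- move=> g v w c; rewrite /b; congr (xget _ _); apply/funext => a; apply/propext => /=.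
  by rewrite Yact /tr act_kernel_repr.
move=> j c /= /negP nD.
have jr : j \in fset_set [set: qsimplex K 2] by rewrite in_fset_set ?inE//; exact: Kfin.2.
have xD : (x <= tr c (~` D))%O.
  have [xD|xD] := atom (tr c D); first by rewrite xD in nD.
  rewrite -(disj_diffl (x := x) (y := tr c D)); last exact/eqP.
  by rewrite leBLR -mhomU joinxC mhom_top lex1.
(* Off [D] the atom lies under the join over all admissible triples, hence under a single one, whose
   entries are the values of [b]. *)
have := le_trans xD (mhom_le (tr c) (YD j jr)); rewrite mhom_bigjoin.
move=> /(atom_join x0 atom)[[[a0 a1] a2] /eqP /= e].
rewrite /extension_defect -/(t j) -e !mhomI !lexI => /andP[/andP[x1 x2] x3].
by rewrite (bE _ _ _ _ x1) (bE _ _ _ _ x2) (bE _ _ _ _ x3).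
Qed.
End Vanishing.

(** * From a trivial class to a splitting over a subgroup of finite index *)

Section Splitting.
Context (R : realType) (A : finZmodType) (E G : groupType).
Context (iota : A -> E) (p : E -> G) (ext : central_extension iota p).
Context (K : simplicial_gcomplex G) (Kfree : free_action K).
Hypothesis Kcontr : contractible R (realization R K).
Context (L : finite_index_subgroup G).
Hypothesis trivial_class : coboundary K (coset_galg R L) A 2 (class_cochain R iota p L).
Local Notation sl := (vertex_lift p (K := K)).
Local Notation fd := (@extension_defect A E G iota p K).
Local Notation base := (\pi_(cosets L) 1%g).

(* Evaluating at the base coset is the Shapiro isomorphism: it turns a cochain
   with values in the functions on G/L into an L-invariant A-valued cochain. *)
Lemma invariant_primitive : exists k : vertex K -> vertex K -> A,
  [/\ forall v w, v != w -> in_face v w w -> k w v = - k v w,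
      forall g v w, g \in L -> v != w -> in_face v w w -> k (vact g v) (vact g w) = k v w &
      forall t : osimplex K 2, fd (vtx t 0) (vtx t 1) (vtx t 2) =
        k (vtx t 1) (vtx t 2) - k (vtx t 0) (vtx t 2) + k (vtx t 0) (vtx t 1)].
Proof.
have [b [bB bG] cb] := trivial_class.
pose f x : A := tensor_eval base (b x).
have fB : zmod_morphism f by move=> x y; rewrite /f bB tensor_eval_zmod.
pose k v w := if edge_simplex v w is Some t then f (gen (@chain_rel _ K 1) t) else 0.
have kE t : f (gen (@chain_rel _ K 1) t) = k (vtx t 0) (vtx t 1).
  have [||t' [e t0 t1]] := @edge_simplexP _ _ (vtx t 0) (vtx t 1).
  - by rewrite (vtx_eq t ord0 ord_max).
  - exact: vtx_face.
  rewrite /k e; congr (f (gen _ _)); apply: osimplex_eq => -[[|[|n]] hn] //=; exact/esym.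
exists k; split.
- move=> v w vw fvw; have [t [_ <- <-]] := edge_simplexP vw fvw.
  have := kE (reorder t (tperm ord0 ord_max)).
  rewrite (vtx_reorder _ _ ord0) (vtx_reorder _ _ ord_max) tpermL tpermR => <-.
  by rewrite gen_reorder odd_tperm /= expr1 (zmod_morphMz fB) kE mulrN1z.
- move=> g v w gL vw fvw; have [t [_ <- <-]] := edge_simplexP vw fvw.
  rewrite -!vtx_act -!kE -chain_act_gen /f bG -[in RHS](tensor_eval_act g).
  congr (tensor_eval _ _); rewrite coset_actE mulg1; apply/eqmodP => /=.
  by rewrite /coset_rel invg1 mul1g.
move=> t; rewrite -(boundary1 (f := f) (g := k) _ fB kE).
have -> : f (boundary (gen (@chain_rel _ K 2) t)) =
    tensor_eval base (class_cochain R iota p L (gen (@chain_rel _ K 2) t)).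
  by rewrite cb.
by rewrite (class_cochain_gen R ext) tensor_eval_coset.
Qed.

(* Over L the lifts of edges can be corrected to a flat E-valued connection,
   which has a global gauge since K is contractible. *)
Lemma invariant_gauge : exists psi : vertex K -> E,
  (forall v, p (psi v) = vertex_label v) /\
  forall g v w, g \in L -> in_face v w w ->
    ((psi (vact g v))^-1 * psi (vact g w) = (psi v)^-1 * psi w)%g.
Proof.
have [k [kV kL kt]] := invariant_primitive.
pose lab v := section_of p (@vertex_label G K v).
have plab v : p (lab v) = vertex_label v by exact: section_ofK ext _.
(* Arbitrary lifts [lab] of the vertex labels give a primitive [q] of the extension cocycle on K,
   which need not be invariant under L, in contrast to [k]. *)
pose q v w := fiber_coord iota ((lab w)^-1 * lab v * sl v w)%g.
have qE v w : sl v w = ((lab v)^-1 * lab w * iota (q v w))%g.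
  rewrite (fiber_coordK ext); first by rewrite -!mulgA mulVKg mulKg.
  by rewrite !(ce_pM ext) (ce_pV ext) !plab (p_edge_lift ext) -!mulgA mulVKg mulVg.
have qV v w : v != w -> in_face v w w -> q w v = - q v w.
  move=> vw fvw; apply: (ce_inj ext); apply: (mulgI ((lab w)^-1 * lab v)%g).
  by rewrite -qE (vertex_liftV p vw fvw) qE !invMg invgK -(ce_iotaN ext) (ce_central ext).
have cM x y a b : ((x * iota a) * (y * iota b) = x * y * iota (a + b))%g.
  by rewrite (ce_iotaD ext) !mulgA -(mulgA x) (ce_central ext a y) mulgA.
have qt v w z : fd v w z = q v w + q w z + q z v.
  apply: (ce_inj ext); rewrite (extension_defectK ext) !qE.
  by rewrite !cM !(ce_iotaD ext) -!mulgA !mulVKg mulKg.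
pose u v w := if v == w then 0 else q v w - k v w.
have uflat v w z : in_face v w z -> u v w + u w z = u v z.
  move=> [s fs [vs ws zs]]; rewrite /u.
  have [->|vw] := eqVneq v w; first by rewrite add0r.
  have [<-|wz] := eqVneq w z; first by rewrite addr0 (negbTE vw).
  have fe a b : a \in s -> b \in s -> in_face a b b by exists s.
  have [<-|vz] := eqVneq v z.
    by rewrite (qV v w vw (fe v w vs ws)) (kV v w vw (fe v w vs ws)) -opprD subrr.
  have [|t [t0 t1 t2]] := face_osimplex vw wz vz; first by exists s.
  have := kt t; rewrite t0 t1 t2 qt (qV v z vz (fe v z vs zs)) => /eqP.
  rewrite subr_eq => /eqP e; rewrite addrACA -opprD e (addrC (k v w)).
  rewrite [k w z - _ + _]addrAC; move: (k w z + k v w) => x.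
  by rewrite addrAC [x - _ - _]addrAC subrr add0r addrC.
have [f fE] := face_exact Kcontr uflat.
exists (fun v => lab v * iota (f v))%g; split=> [v|g v w gL fvw].
  by rewrite (ce_pM ext) (ce_p_iota ext) mulg1.
have [->|vw] := eqVneq v w; first by rewrite !mulVg.
(* The right-hand side is invariant under L, since [sl] is invariant under G and [k] under L. *)
have key x y : x != y -> in_face x y y ->
    ((lab x * iota (f x))^-1 * (lab y * iota (f y)) = sl x y * iota (- k x y))%g.
  move=> xy fxy; have := fE x y fxy; rewrite /u (negbTE xy) => e.
  by rewrite qE invMg -(ce_iotaN ext) (ce_central ext) cM -[RHS]mulgA -(ce_iotaD ext) e addrC.
have gvw : vact g v != vact g w by rewrite (inj_eq (@vact_inj _ _ g)).
have [s fs [vs ws _]] := fvw.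
have gfvw : in_face (vact g v) (vact g w) (vact g w).
  exists (face_image g s); first exact: face_act.
  by split; apply/imfsetP; [exists v | exists w | exists w].
by rewrite !key// vertex_lift_act// kL.
Qed.

(** The element [psi (g v) * (psi v)^-1] is the same at both ends of an edge by the gauge property,
    hence independent of [v] by connectedness. Computing it for [g] at the vertex [h v0] gives
    multiplicativity. *)
Lemma extension_splits : exists theta : G -> E,
  {in L &, {morph theta : g h / (g * h)%g}} /\ forall g, g \in L -> p (theta g) = g.
Proof.
have [psi [ppsi psiL]] := invariant_gauge.
have [x _] := Kcontr; have [v0 _] := supp_neq0 x.
exists (fun g => psi (vact g v0) * (psi v0)^-1)%g.
have const g v : g \in L -> (psi (vact g v) * (psi v)^-1 = psi (vact g v0) * (psi v0)^-1)%g.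
  move=> gL; apply: (face_const Kcontr (h := fun v => (psi (vact g v) * (psi v)^-1)%g)) => a b fab.
  apply: (mulgI (psi (vact g a))^-1%g); by rewrite mulKg mulgA (psiL _ _ _ gL fab) mulgK.
split=> [g h gL hL|g gL].
  by rewrite -(const g (vact h v0) gL) vactM -!mulgA mulKg.
by rewrite (ce_pM ext) (ce_pV ext) !ppsi vertex_label_act// mulgK.
Qed.
End Splitting.

Lemma nonprincipal_ultrafilter : exists U : set_system nat, UltraFilter U /\ nonprincipal U.
Proof.
have [U [UU ooU]] := @ultraFilterLemma nat \oo _.
exists U; split=> // i Ui.
have Uge : U [set n | (i < n)%N] by apply: ooU; exists i.+1.
have [n [/= -> ]] := @filter_ex _ U _ _ (filterI Ui Uge).
by rewrite ltnn.
Qed.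

Theorem theorem3p13 (R : realType) (G : groupType) (A : finZmodType)
    (G_countable : countable [set: G])
    (G_residually_finite : residually_finite G)
    (G_finite_type : finite_type R G)
    (G_cosystolic : cosystolic_inequality 2 (@finite_transitive_action R G) A)
    (E : groupType) (iota : A -> E) (p : E -> G)
    (E_extension : central_extension iota p)
    (E_not_residually_finite : ~ residually_finite E) :
  stable_in_finite_actions R G -> ~ sofic R E.
Proof.
move=> stable Esofic.
have [K [nu [eps [[Kcontr Kfree Kfin] nuP eps0 cosys]]]] := G_cosystolic.
have [U [UU Unp]] := nonprincipal_ultrafilter.
have [S [B Bc]] := sofic_limit_cocycle UU Unp E_extension Esofic.
have [L La] := weakly_contained_vanishes E_extension Kfree Kfin eps0 nuP cosys Bc (stable S U UU Unp).
have [theta [thetaM p_theta]] := extension_splits E_extension Kfree Kcontr La.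
exact: E_not_residually_finite (split_residually_finite E_extension thetaM p_theta G_residually_finite).
Qed.
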